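(* Let $s>1$, $0<\alpha<\frac{n}{s}$, and $1\le q<s$. For any q.e. defined function $u$ in $\mathbb{R}^n$, $$\|u\|_{L^q(\mathrm{cap}_{\alpha,s})}\simeq\dot{\lambda}^{\alpha,s}_q(u)\simeq\dot{\beta}^{\alpha,s}_q(u),$$ where $$\dot{\lambda}^{\alpha,s}_q(u)=\inf\Big\{\|f\|_{\dot{\widetilde{O}}^{\alpha,s}_q}:0\le f\in\dot{\widetilde{O}}^{\alpha,s}_q,\ I_\alpha f\ge|u|\text{ q.e.}\Big\},$$ $$\dot{\beta}^{\alpha,s}_q(u)=\inf\Big\{\Big(\int_{\mathbb{R}^n}f^s(I_\alpha f)^{q-s}\,dx\Big)^{1/q}:0\le f\in\dot{\widetilde{O}}^{\alpha,s}_q,\ I_\alpha f\ge|u|\text{ q.e.}\Big\}.$$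
   Context: Here $n\ge1$ is an integer. $A\simeq B$ means $c_1A\le B\le c_2A$ with positive constants $c_1,c_2$ independent of $u$; $\inf\emptyset=+\infty$. The Riesz potential is $I_\alpha f(x)=\gamma(n,\alpha)\int_{\mathbb{R}^n}|x-y|^{\alpha-n}f(y)\,dy$, with $\gamma(n,\alpha)=\Gamma(\frac{n-\alpha}{2})/[\pi^{n/2}2^\alpha\Gamma(\frac{\alpha}{2})]$. The Riesz capacity of $E\subset\mathbb{R}^n$ is $\mathrm{cap}_{\alpha,s}(E)=\inf\{\|f\|_{L^s(\mathbb{R}^n)}^s: f\ge0,\ I_\alpha f\ge1\text{ on }E\}$. ''q.e.'' means except on a set of zero $\mathrm{cap}_{\alpha,s}$-capacity. $\|u\|_{L^q(\mathrm{cap}_{\alpha,s})}=(\int_0^\infty\mathrm{cap}_{\alpha,s}(\{|u|^q>t\})\,dt)^{1/q}$ for q.e. defined $u:\mathbb{R}^n\to[-\infty,\infty]$. A weight is a nonnegative locally integrable function on $\mathbb{R}^n$. $\dot{\widetilde{O}}^{\alpha,s}_q$ is the space of measurable functions $g$ on $\mathbb{R}^n$ with finite quasi-norm $\|g\|_{\dot{\widetilde{O}}^{\alpha,s}_q}=\inf_w(\int_{\{g\ne0\}}|g|^sw^{q-s}\,dx)^{1/s}$, the infimum being over all q.e. defined weights $w$ with $\|w\|_{L^q(\mathrm{cap}_{\alpha,s})}\le1$. The integrand $f^s(I_\alpha f)^{q-s}$ is taken to be $0$ where $f=0$. *)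

(* Defs.v *)
From HB Require Import structures.
From mathcomp Require Import all_boot all_order all_algebra.
From mathcomp Require Import all_classical all_reals all_analysis.
From mathcomp Require Import measurable_realfun.

Set Implicit Arguments.
Unset Strict Implicit.
Unset Printing Implicit Defensive.
Import Order.TTheory GRing.Theory Num.Theory.
Import numFieldNormedType.Exports.

Local Open Scope classical_set_scope.
Local Open Scope ring_scope.

Section euclidean_space.
Context {R : realType}.

Definition tuple_cons n (p : n.-tuple (measurableTypeR R) * measurableTypeR R) :
    n.+1.-tuple (measurableTypeR R) := [the n.+1.-tuple _ of p.2 :: p.1].

Lemma measurable_tuple_cons n : measurable_fun [set: _] (@tuple_cons n).
Proof. exact: measurable_cons. Qed.

Section measure_succ.
Context {n : nat} (m : {measure set (n.-tuple (measurableTypeR R)) -> \bar R}).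

Definition measure_succ : set (n.+1.-tuple (measurableTypeR R)) -> \bar R :=
  pushforward (m \x lebesgue_measure)%E (@tuple_cons n).

Let mcons := @measurable_tuple_cons n.

Let measure_succ0 : measure_succ set0 = 0%E.
Proof. by rewrite /measure_succ /pushforward preimage_set0 measure0. Qed.

Let measure_succ_ge0 A : (0 <= measure_succ A)%E.
Proof. exact: measure_ge0. Qed.

Let measure_succ_sigma_additive : semi_sigma_additive measure_succ.
Proof.
exact: (@measure_semi_sigma_additive _ _ _ (pushforward (m \x lebesgue_measure)%E
  (@tuple_cons n) : {measure set _ -> \bar R})).
Qed.

HB.instance Definition _ := isMeasure.Build _ _ _ measure_succ
  measure_succ0 measure_succ_ge0 measure_succ_sigma_additive.

End measure_succ.

(* Lebesgue measure on the Borel sets of R^n, as the n-fold product measure *)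
Fixpoint borel_lebesgue n :
    {measure set (n.-tuple (measurableTypeR R)) -> \bar R} :=
  match n with
  | 0%N => dirac ([tuple] : 0.-tuple (measurableTypeR R))
  | n'.+1 => measure_succ (borel_lebesgue n')
  end.

End euclidean_space.

(* R^n with its sigma-algebra of Lebesgue (not just Borel) measurable sets *)
Definition Rn (R : realType) n : Type :=
  caratheodory_type ((@borel_lebesgue R n)^*)%mu.
HB.instance Definition _ (R : realType) n := Measurable.on (Rn R n).

Definition lebesgue (R : realType) n : set (Rn R n) -> \bar R :=
  @completed_measure_extension _ _ _ (@borel_lebesgue R n).
HB.instance Definition _ (R : realType) n := Measure.on (@lebesgue R n).
Arguments lebesgue : clear implicits.

Section potentials.
Context {R : realType}.
Local Open Scope ereal_scope.

Definition eucl_dist n (x y : Rn R n) : R :=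
  Num.sqrt (\sum_(i < n) (tnth x i - tnth y i) ^+ 2)%R.

(* Powers of nonnegative extended reals with 0 `^ r = +oo and +oo `^ r = 0 when
   r < 0; the library's poweR gives 0 and +oo there. *)
Definition epow (x : \bar R) (r : R) : \bar R :=
  if (0 <= r)%R then x `^ r else (x `^ (- r))^-1.

Definition Gamma (x : R) : R :=
  (\int[lebesgue_measure]_(t in `]0, +oo[) (t `^ (x - 1) * expR (- t)))%R.

Definition riesz_const n (alpha : R) : R :=
  (Gamma ((n%:R - alpha) / 2) /
   (pi `^ (n%:R / 2) * 2 `^ alpha * Gamma (alpha / 2)))%R.

Definition riesz n (alpha : R) (f : Rn R n -> \bar R) (x : Rn R n) : \bar R :=
  (riesz_const n alpha)%:E *
  \int[lebesgue R n]_y (epow (eucl_dist x y)%:E (alpha - n%:R) * f y).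

Definition cap n (alpha s : R) (E : set (Rn R n)) : \bar R :=
  ereal_inf [set ('N[lebesgue R n]_(s%:E) [f]) `^ s | f in
    [set f : Rn R n -> \bar R |
      [/\ measurable_fun [set: Rn R n] f, (forall x, 0 <= f x) &
          (forall x, E x -> 1 <= riesz alpha f x)]]].

(* A q.e. defined function: the values of qe_val outside qe_dom are junk and
   are never used below. *)
Record qe_fun n (alpha s : R) := QeFun {
  qe_dom : set (Rn R n);
  qe_val :> Rn R n -> \bar R;
  qe_domP : cap alpha s (~` qe_dom) = 0 }.

Section fixed_parameters.
Context {n : nat} (alpha s q : R).
Implicit Types (u w : qe_fun n alpha s) (f g : Rn R n -> \bar R).

Definition capnorm u : \bar R :=
  (\int[lebesgue_measure]_(t in `]0%R, +oo[)
     cap alpha s [set x | qe_dom u x /\ t%:E < `|u x| `^ q]) `^ q^-1.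

(* The measurability of the domain is spelled out because measurable_fun holds
   vacuously over a nonmeasurable set. *)
Definition is_weight w : Prop :=
  [/\ (forall x, qe_dom w x -> 0 <= w x),
      measurable (qe_dom w), measurable_fun (qe_dom w) w &
      forall (c : Rn R n) (r : R),
        \int[lebesgue R n]_(x in qe_dom w `&` [set x | (eucl_dist c x <= r)%R]) w x
          < +oo].

Definition Onorm g : \bar R :=
  ereal_inf [set (\int[lebesgue R n]_(x in qe_dom w `&` [set x | g x != 0])
                    (`|g x| `^ s * epow (w x) (q - s))) `^ s^-1 |
             w in [set w | is_weight w /\ capnorm w <= 1]].

Definition Ospace : set (Rn R n -> \bar R) :=
  [set g | measurable_fun [set: Rn R n] g /\ Onorm g < +oo].

Definition admissible u : set (Rn R n -> \bar R) :=
  [set f | [/\ (forall x, 0 <= f x), Ospace f &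
    cap alpha s (~` [set x | qe_dom u x /\ `|u x| <= riesz alpha f x]) = 0]].

Definition lambda_dot u : \bar R := ereal_inf [set Onorm f | f in admissible u].

Definition beta_dot u : \bar R :=
  ereal_inf [set (\int[lebesgue R n]_(x in [set x | f x != 0])
                    (f x `^ s * epow (riesz alpha f x) (q - s))) `^ q^-1 |
             f in admissible u].

End fixed_parameters.

Definition simeq (U : Type) (A B : U -> \bar R) : Prop :=
  exists c1 c2 : R, [/\ (0 < c1)%R, (0 < c2)%R &
    forall u, c1%:E * A u <= B u /\ B u <= c2%:E * A u].

End potentials.

(* Main.v *)
(** Riesz potentials are comparable to potentials [I f] of the kernel
    [d(x, y)^(alpha - n)], [d] the l1 distance, and [||u||^q] is comparable to the
    sum over [k] in Z of [2^(k q) cap {|u| > 2^k}].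

    Sweeping.  Suppose [I h >= a] on the support of [g].  Averaging [g] over the
    Whitney cells of the complement of [{I h <= l}] changes [I g] on [{I h <= l}]
    by a bounded factor only.  Potentials satisfy a weak A_1 condition with
    exponent [n / (n - alpha)], so by Hoelder's inequality the averages satisfy
      [cap ({I h <= l} and {I g > t}) <= C t^(-s) (l / a)^sigma \int g^s],
    with [sigma = n (s - 1) / (n - alpha) > s - 1].

    Upper bounds for [||u||].  Cutting [f] along the dyadic levels of [I f] and
    sweeping with [h = f] gives, for [1 <= q <= s],
      [||I f||^q <= C \int f^s (I f)^(q - s)]
    as soon as the left-hand side is finite; [q = s] is the capacitary strong type
    inequality.  Cutting [f] along the levels of a weight [w] with [||w|| <= 1] and
    sweeping with [h_k = F_k min (I F_k, 1)^(s/q - 1)], where [F_k] is near-optimal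
    for [{w > 2^k}], gives [||I f||^q <= C (1 + \int f^s w^(q - s))].

    Lower bounds.  Let [F_k] be near-optimal for [{|u| > 2^k}], let
    [F^s = sum_k (2^(k q / s) F_k)^s] and [v = I F >= c |u|^(q/s)].  Then
    [h = F v^(s/q - 1)] satisfies [I h >= c v^(s/q) >= c' |u|], and both
    [\int h^s (I h)^(q - s)] and [\int h^s (v^(s/q))^(q - s)] are at most
    [C \int F^s <= C' ||u||^q].  By the strong type inequality a multiple of
    [v^(s/q) / ||u||] is an admissible weight. *)

Require Import Defs.
From HB Require Import structures.
From mathcomp Require Import all_boot all_order all_algebra archimedean.
From mathcomp Require Import all_classical all_reals all_analysis.
From mathcomp Require Import measurable_realfun.
From mathcomp Require Import ring lra.

Set Implicit Arguments.
Unset Strict Implicit.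
Unset Printing Implicit Defensive.
Import Order.TTheory GRing.Theory Num.Theory.
Import numFieldNormedType.Exports.

Local Open Scope classical_set_scope.
Local Open Scope ring_scope.

(** * Dyadic cells in R^n *)

Section euclidean_cells.
Context {R : realType}.

(** The obstacle in the upper bounds: a piece of [f] lying [i] levels above the current one, used
    directly as a test function, costs [2^(i (s - q))] times what the energy pays for it. Sweeping
    it onto a set where [I h] is small gains [2^(- i sigma)], and [sigma > s - 1 >= s - q] because
    [q >= 1]. Pieces far below the level are removed by a maximum principle when the levels are
    those of [I f]; when they are those of a weight, they are summed directly, which converges as
    [q < s].

    With a weight, the set to sweep onto must be produced by hand, with [I h_k <= l = 2^(- slope i)]
    on it. Sweeping with [F_k] would leave exceptional sets of capacity about [l^(-s)] and require
    both [slope s < q] and [slope sigma > s - q], which can be incompatible. The power of [I F_k] in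
    [h_k] improves [l^(-s)] to [l^(-q)], so that [slope < 1] suffices, and the cap at [1] keeps
    [h_k] in [L^s].

    Finiteness is what discards the remainder of an iteration over levels. For the second functional
    it comes from the bound with a weight, applied to the weight that membership of [f] in the space
    provides. *)

Lemma powR2D (a b : R) : 2 `^ (a + b) = 2 `^ a * 2 `^ b.
Proof. by rewrite powRD//; apply/implyP => _; rewrite pnatr_eq0. Qed.

Definition box n (a b : 'I_n -> R) : set (n.-tuple R) :=
  [set x | forall i, a i <= tnth x i < b i].

Lemma measurable_box n (a b : 'I_n -> R) :
  measurable (box a b : set (n.-tuple (measurableTypeR R))).
Proof.
have -> : box a b = \bigcap_(i in [set: 'I_n]) ((fun x => tnth x i) @^-1` `[a i, b i[).
  apply/seteqP; split => x /=.
    by move=> xab i /= _; rewrite in_itv/=; exact: xab.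
  by move=> xab i; have := xab i Logic.I; rewrite /= in_itv.
apply: fin_bigcap_measurable => // i _; rewrite -[X in measurable X]setTI.
by apply: measurable_tnth => //; exact: measurable_itv.
Qed.

Lemma borel_lebesgue_box n (a b : 'I_n -> R) : (forall i, a i <= b i) ->
  @borel_lebesgue R n (box a b) = (\prod_(i < n) (b i - a i))%:E.
Proof.
elim: n a b => [|n IH] a b ab.
  rewrite big_ord0 /= /dirac indicE mem_set// => -[].
  by case.
rewrite big_ord_recl/= /measure_succ /pushforward.
have -> : @tuple_cons R n @^-1` box a b =
    box (a \o lift ord0) (b \o lift ord0) `*` `[a ord0, b ord0[%classic.
  apply/seteqP; split=> -[x y] /=.
    move=> xyab; split.
      by move=> i /=; have := xyab (lift ord0 i); rewrite tnthS.
    by rewrite in_itv; exact: (xyab ord0).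
  rewrite in_itv/= => -[xab yab] i; case: (unliftP ord0 i) => [j|] ->.
    by rewrite tnthS; exact: xab.
  exact: yab.
rewrite product_measure1E//; last exact: measurable_box.
rewrite IH/=; last by move=> i; exact: ab.
have := ab ord0; rewrite lebesgue_measure_itv/= lte_fin le_eqVlt.
by case/predU1P => [->|->]; rewrite ?ltxx ?subrr ?mule0 ?mul0r// -EFinB -EFinM mulrC.
Qed.

Lemma borel_measurable n (A : set (n.-tuple (measurableTypeR R))) :
  measurable A -> measurable (A : set (Rn R n)).
Proof. exact: caratheodory_measurable_mu_ext. Qed.

Lemma lebesgue_borel n (A : set (n.-tuple (measurableTypeR R))) :
  measurable A -> lebesgue R n A = borel_lebesgue n A.
Proof. exact: measurable_mu_extE. Qed.

Lemma lebesgue_box n (a b : 'I_n -> R) : (forall i, a i <= b i) ->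
  lebesgue R n (box a b) = (\prod_(i < n) (b i - a i))%:E.
Proof.
by move=> ab; rewrite lebesgue_borel ?borel_lebesgue_box//; exact: measurable_box.
Qed.

Lemma lebesgue_sigma_finite n : sigma_finite [set: Rn R n] (lebesgue R n).
Proof.
exists (fun k => box (fun=> - k%:R) (fun=> k%:R)).
  apply/esym; rewrite -subTset => x _.
  pose M : R := \sum_(i < n) `|tnth x i|.
  exists (Num.truncn M).+1 => // i.
  have xM : `|tnth x i| < (Num.truncn M).+1%:R.
    apply: le_lt_trans (truncnS_gt _).
    by rewrite /M (bigD1 i)//= lerDl sumr_ge0.
  by move: xM; rewrite ltr_norml => /andP[/ltW -> ->].
move=> k; split; first by apply: borel_measurable; exact: measurable_box.
by rewrite lebesgue_box ?ltry// => i; have := ler0n R k; lra.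
Qed.

HB.instance Definition _ n :=
  Measure_isSigmaFinite.Build _ _ _ (lebesgue R n) (@lebesgue_sigma_finite n).

Lemma measurable_Rn_tnth n (i : 'I_n) :
  measurable_fun [set: Rn R n] (fun x : Rn R n => tnth x i : R).
Proof.
move=> _ A mA; apply: borel_measurable.
exact: measurable_tnth.
Qed.

Definition dist1 n (x y : Rn R n) : R := \sum_(i < n) `|tnth x i - tnth y i|.

Lemma dist1C n (x y : Rn R n) : dist1 x y = dist1 y x.
Proof. by apply: eq_bigr => i _; rewrite distrC. Qed.

Lemma dist1_triangle n (x y z : Rn R n) : dist1 x z <= dist1 x y + dist1 y z.
Proof.
by rewrite -big_split; apply: ler_sum => i _ /=; exact: ler_distD.
Qed.

Lemma measurable_dist1 n :
  measurable_fun [set: Rn R n * Rn R n] (fun p => dist1 p.1 p.2).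
Proof.
apply: measurable_sum => i.
apply: measurableT_comp => //; apply: measurable_funB.
  exact: (measurableT_comp (@measurable_Rn_tnth n i)).
exact: (measurableT_comp (@measurable_Rn_tnth n i)).
Qed.

Lemma le_norm_dist1 n (x y : Rn R n) i : `|tnth x i - tnth y i| <= dist1 x y.
Proof. by rewrite /dist1 (bigD1 i)//= lerDl sumr_ge0. Qed.

Lemma le_lebesgue_ball n (x : Rn R n) (r : R) : 0 < r ->
  (lebesgue R n [set y | (dist1 x y < r)%R] <= (2 ^+ n * r `^ n%:R)%:E)%E.
Proof.
move=> r0; rewrite powR_mulrn ?(ltW r0)// -exprMn.
have <- : lebesgue R n (box (fun i => tnth x i - r) (fun i => tnth x i + r)) =
    ((2 * r) ^+ n)%:E.
  rewrite lebesgue_box => [|i]; last by lra.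
  congr (_%:E); rewrite (eq_bigr (fun=> 2 * r)) => [|i _]; last by lra.
  by rewrite prodr_const card_ord.
(* Monotonicity of the outer measure asks for no measurability of the ball. *)
apply: le_mu_ext => y /= xyr i.
have := le_lt_trans (le_norm_dist1 x y i) xyr.
by rewrite ltr_norml; lra.
Qed.

(** The index of the half-open dyadic cube of side [2^(- j)] that contains [x]; a cube is thus a
    fibre of [cell j]. *)
Definition cell n (j : int) (x : Rn R n) : {ffun 'I_n -> int} :=
  [ffun i => Num.floor (2 `^ j%:~R * tnth x i)].

Lemma cell_preimage n (j : int) (c : {ffun 'I_n -> int}) :
  cell j @^-1` [set c] =
  box (fun i => 2 `^ (- j%:~R) * (c i)%:~R) (fun i => 2 `^ (- j%:~R) * (c i + 1)%:~R).
Proof.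
have e : 2 `^ j%:~R * 2 `^ (- j%:~R) = 1 :> R.
  by rewrite -powR2D subrr powRr0.
have p (t : R): 0 < (2 `^ t : R) by rewrite powR_gt0.
have flr (z : R) m : (2 `^ (- j%:~R) * m%:~R <= z < 2 `^ (- j%:~R) * (m + 1)%:~R)
    = (Num.floor (2 `^ j%:~R * z) == m).
  rewrite floor_eq -(ler_pM2l (p j%:~R)) -(ltr_pM2l (p j%:~R) z).
  by rewrite !mulrA e !mul1r.
apply/seteqP; split => x /=.
  by move=> <- i; rewrite flr ffunE eqxx.
move=> xc; apply/ffunP => i; rewrite ffunE; apply/eqP; rewrite -flr; exact: xc.
Qed.

Lemma measurable_cell n j (c : {ffun 'I_n -> int}) :
  measurable (cell j @^-1` [set c] : set (Rn R n)).
Proof. by rewrite cell_preimage; apply: borel_measurable; exact: measurable_box. Qed.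

Lemma lebesgue_cell n j (x : Rn R n) :
  lebesgue R n (cell j @^-1` [set cell j x]) = ((2 `^ (- j%:~R)) `^ n%:R)%:E.
Proof.
rewrite cell_preimage lebesgue_box; last first.
  by move=> i; rewrite ler_pM2l ?powR_gt0// ler_int lerDl.
rewrite powR_mulrn ?powR_ge0//; congr (_%:E).
rewrite (eq_bigr (fun=> 2 `^ (- j%:~R))) ?prodr_const ?card_ord//.
by move=> i _; rewrite -mulrBr intrD addrAC subrr add0r mulr1.
Qed.

Lemma cell_dist1 n j (x y : Rn R n) : (0 < n)%N -> cell j x = cell j y ->
  dist1 x y < n%:R * 2 `^ (- j%:~R).
Proof.
move=> n0 xy.
have xc : (cell j @^-1` [set cell j x]) x by [].
have yc : (cell j @^-1` [set cell j x]) y by exact: esym.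
move: xc yc; rewrite cell_preimage => xc yc.
have -> : n%:R * 2 `^ (- j%:~R) = \sum_(i < n) (2 `^ (- j%:~R)) :> R.
  by rewrite sumr_const card_ord mulr_natl.
apply: ltr_sum => [|i _].
  by apply/hasP; exists (Ordinal n0) => //; rewrite mem_index_enum.
have := xc i; have := yc i; rewrite intrD mulrDr mulr1 => + +.
by rewrite ltr_norml; lra.
Qed.

(** [Num.floor u] is determined by [Num.floor (2 * u)]: the integer [2 * Num.floor u] is at most
    [2 * u], hence at most its floor. *)
Lemma cell_nested n j (x y : Rn R n) : cell j x = cell j y ->
  cell (j - 1) x = cell (j - 1) y.
Proof.
move=> /ffunP xy; apply/ffunP => i; have := xy i; rewrite !ffunE.
have -> : 2 `^ j%:~R = 2 * 2 `^ (j - 1)%:~R :> R.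
  by rewrite -[X in X * _](@powRr1 R 2)// -powR2D intrB addrC subrK.
suff le_fl (u v : R) : Num.floor (2 * u) = Num.floor (2 * v) ->
    Num.floor u <= Num.floor v.
  by rewrite -!mulrA => uv; apply/eqP; rewrite eq_le !le_fl.
move=> uv; rewrite floor_ge_int.
suff : (Num.floor u *+ 2)%:~R <= 2 * v by rewrite rmorphMn/=; lra.
apply: le_trans (floor_le (2 * v)); rewrite ler_int -uv floor_ge_int.
by have := floor_le u; rewrite rmorphMn/=; lra.
Qed.

Lemma eucl_dist_le n (x y : Rn R n) : eucl_dist x y <= dist1 x y.
Proof.
have d0 : 0 <= dist1 x y by exact: sumr_ge0.
rewrite /eucl_dist -(ger0_norm d0) -sqrtr_sqr ler_sqrt ?sqr_ge0//.
rewrite expr2 {1}/dist1 mulr_suml; apply: ler_sum => i _.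
by rewrite -real_normK ?num_real// expr2 ler_wpM2l// le_norm_dist1.
Qed.

Lemma dist1_le n (x y : Rn R n) : dist1 x y <= n%:R * eucl_dist x y.
Proof.
rewrite mulr_natl -[X in _ *+ X]card_ord -sumr_const; apply: ler_sum => i _.
rewrite /eucl_dist -sqrtr_sqr ler_wsqrtr// (bigD1 i)//= lerDl sumr_ge0// => j _.
exact: sqr_ge0.
Qed.

End euclidean_cells.

(** * Powers of extended reals *)

Section extended_powers.
Context {R : realType}.
Implicit Types (x y : \bar R) (r s t : R).
Local Open Scope ereal_scope.

Lemma measurable_epow r : measurable_fun [set: \bar R] (fun x : \bar R => epow x r).
Proof.
have [r0|r0] := leP 0%R r.
  by rewrite /epow r0; exact: measurable_poweR.
(* The explicit form for a negative exponent: [+oo] at [0] and at [-oo], [0] at [+oo], a real power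
   elsewhere. *)
pose F x : \bar R := if x == 0 then +oo else if x \is a fin_num then (fine x `^ r)%:E
                     else if x == +oo then 0 else +oo.
rewrite (_ : (fun x : \bar R => _) = F); last first.
  have nr0 : (- r != 0)%R by rewrite oppr_eq0 lt_eqF.
  apply/funext => -[u||]; rewrite /F /epow leNgt r0 /=.
  - rewrite inver eqe; have [->|u0] := eqVneq u 0%R.
      by rewrite powR0// eqxx.
    by rewrite powR_eq0 (negPf u0)/= powRN invrK.
  - by rewrite (negPf nr0).
  - by rewrite (negPf nr0) inve0.
have mset1 c : measurable_fun [set: \bar R] (eq_op^~ c).
  apply: (measurable_fun_bool true); rewrite setTI.
  rewrite (_ : _ @^-1` _ = [set c]); first exact: emeasurable_set1.
  by apply/seteqP; split => x /= /eqP.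
apply: measurable_fun_ifT => //; apply: measurable_fun_ifT => //=.
- by apply: (measurable_fun_bool true); exact/emeasurable_fin_num.
- apply/measurable_EFinP; apply: (measurableT_comp (measurable_powR r)).
  exact: fine_measurable.
- exact: measurable_fun_ifT.
Qed.

Lemma epow_ge0 x r : 0 <= epow x r.
Proof. by rewrite /epow; case: ifPn => _; rewrite ?inve_ge0 poweR_ge0. Qed.

Lemma epow_EFin t r : (0 < t)%R -> epow t%:E r = (t `^ r)%:E.
Proof.
move=> t0; rewrite /epow; case: ifPn => // r0.
by rewrite poweR_EFin inver gt_eqF ?powR_gt0// powRN invrK.
Qed.

Lemma epow_le0 x y r : (r <= 0)%R -> 0 <= x -> x <= y -> epow y r <= epow x r.
Proof.
move=> r0 x0 xy; rewrite /epow; case: ifPn => r0'.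
  by rewrite (_ : r = 0)%R ?poweRe0//; apply/eqP; rewrite eq_le r0.
rewrite lee_pV2 ?inE ?poweR_ge0//.
rewrite gt0_ler_poweR// ?oppr_ge0// ?in_itv/= ?leey ?andbT//.
exact: le_trans xy.
Qed.

Lemma le_poweR x y r : (0 <= r)%R -> 0 <= x -> x <= y -> x `^ r <= y `^ r.
Proof.
move=> r0 x0 xy; rewrite gt0_ler_poweR// ?in_itv/= ?leey ?andbT//.
exact: le_trans xy.
Qed.

Lemma poweRK x r : 0 <= x -> r != 0%R -> (x `^ r) `^ r^-1 = x.
Proof. by move=> x0 r0; rewrite -poweRrM mulfV// poweRe1. Qed.

Lemma le_poweRV x y r : (0 < r)%R -> 0 <= x -> 0 <= y ->
  (x `^ r <= y `^ r) = (x <= y).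
Proof.
move=> r0 x0 y0; apply/idP/idP => [|]; last by apply: le_poweR; rewrite ?(ltW r0).
move=> /(le_poweR (ltW (_ : 0 < r^-1)%R)).
by rewrite !poweRK ?gt_eqF// invr_gt0; apply => //; exact: poweR_ge0.
Qed.

(** If [x > t], then [x = x^(1 - s) x^s <= t^(1 - s) x^s]. This linearises Hoelder's inequality; the
    threshold [t] is optimised in [weighted_jensen]. *)
Lemma le_young x t s : 0 <= x -> (0 < t)%R -> (1 <= s)%R ->
  x <= t%:E + (t `^ (1 - s))%:E * x `^ s.
Proof.
move=> x0 t0 s1; case: x x0 => [x||]// x0; last first.
  by rewrite poweRyr ?gt_eqF ?(lt_le_trans ltr01)// gt0_muley ?addey ?lte_fin ?powR_gt0.
rewrite lee_fin in x0; rewrite poweR_EFin -EFinM -EFinD lee_fin.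
have [xt|tx] := leP x t.
  by rewrite (le_trans xt)// lerDl mulr_ge0// powR_ge0.
rewrite (@le_trans _ _ (t `^ (1 - s) * x `^ s))%R//; last by rewrite lerDr ltW.
have x0' : (0 < x)%R by exact: lt_trans tx.
rewrite -[X in (x `^ X)%R](subrK 1%R s) (@powRD _ x); last first.
  by apply/implyP => _; rewrite gt_eqF.
rewrite mulrA powRr1// ler_peMl//.
rewrite -[(1 - s)%R]opprB powRN mulrC ler_pdivlMr ?powR_gt0// mul1r.
by rewrite ge0_ler_powR ?subr_ge0// ?nnegrE; exact: ltW.
Qed.

End extended_powers.

(** Hoelder's inequality for the measure [k mu], of total mass at most [m], with the extra factor
    [2^s] left by integrating [le_young] at the best [t]. *)
Lemma weighted_jensen {R : realType} {d} {T : measurableType d}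
    (mu : {measure set T -> \bar R}) (A : set T) (k f : T -> \bar R) (m s : R) :
  measurable A -> measurable_fun A k -> measurable_fun A f ->
  (forall x, A x -> 0 <= k x)%E -> (forall x, A x -> 0 <= f x)%E ->
  0 < m -> 1 <= s -> (\int[mu]_(x in A) k x <= m%:E)%E ->
  ((\int[mu]_(x in A) (k x * f x)) `^ s <=
   (2 `^ s * m `^ (s - 1))%:E * \int[mu]_(x in A) (k x * f x `^ s))%E.
Proof.
move=> mA mk mf k0 f0 m0 s1 km.
have s0 : 0 < s by exact: lt_le_trans s1.
have mfs : measurable_fun A (fun x => f x `^ s)%E.
  exact: (measurableT_comp (measurable_poweR s)).
set e := (\int[mu]_(x in A) (k x * f x `^ s))%E.
have e0 : (0 <= e)%E.
  by apply: integral_ge0 => x Ax; rewrite mule_ge0 ?k0 ?poweR_ge0.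
have c0 : 0 < 2 `^ s * m `^ (s - 1) by rewrite mulr_gt0 ?powR_gt0.
(* A strictly positive finite bound [e'] replaces [e], which may be [0] or infinite, so that the
   threshold [t] below is positive. *)
suff main (e' : R) : 0 < e' -> (e <= e'%:E)%E ->
    ((\int[mu]_(x in A) (k x * f x)) `^ s <= (2 `^ s * m `^ (s - 1) * e')%:E)%E.
  have [->|] := eqVneq e +oo%E; first by rewrite gt0_muley ?lte_fin// leey.
  rewrite -ltey => ey; have fe : e \is a fin_num by rewrite ge0_fin_numE.
  move: e0 main; rewrite -(fineK fe); move: (fine e) => r.
  rewrite lee_fin => r0 main; apply/lee_addgt0Pr => eps eps0.
  have eps1 : 0 < eps / (2 `^ s * m `^ (s - 1)) by rewrite divr_gt0.
  have := main (r + eps / (2 `^ s * m `^ (s - 1))).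
  rewrite -EFinM -EFinD mulrDr mulrCA divff ?gt_eqF// mulr1; apply.
    by rewrite ltr_wpDl.
  by rewrite lee_fin lerDl ltW.
move=> e'0 ee'.
(* This choice balances the two terms: [t * m = t^(1 - s) * e']. *)
pose t := (e' / m) `^ s^-1.
have t0 : 0 < t by rewrite powR_gt0// divr_gt0.
have ts : t `^ s = e' / m.
  by rewrite /t -powRrM mulVf ?gt_eqF// powRr1// divr_ge0 ?ltW.
have kf : (\int[mu]_(x in A) (k x * f x) <= (2 * t * m)%:E)%E.
  apply: (@le_trans _ _ (\int[mu]_(x in A)
      (t%:E * k x + (t `^ (1 - s))%:E * (k x * f x `^ s)))%E).
    apply: ge0_le_integral => //.
    - by move=> x Ax; rewrite mule_ge0 ?k0 ?f0.
    - exact: emeasurable_funM.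
    - apply: emeasurable_funD; apply: emeasurable_funM => //.
      exact: emeasurable_funM.
    - move=> x Ax; rewrite (muleC t%:E) [X in (_ + X)%E]muleCA -ge0_muleDr; last 2 first.
      + by rewrite lee_fin ltW.
      + by rewrite mule_ge0 ?poweR_ge0// lee_fin powR_ge0.
      by rewrite lee_wpmul2l ?k0// le_young ?f0.
  rewrite ge0_integralD//; last 4 first.
  - by move=> x Ax; rewrite mule_ge0 ?k0// lee_fin ltW.
  - by apply: emeasurable_funM.
  - by move=> x Ax; rewrite !mule_ge0 ?k0 ?poweR_ge0// lee_fin powR_ge0.
  - by apply: emeasurable_funM => //; apply: emeasurable_funM.
  rewrite ge0_integralZl_EFin ?(ltW t0)// ge0_integralZl_EFin ?powR_ge0//; last 2 first.
  - by move=> x Ax; rewrite mule_ge0 ?k0 ?poweR_ge0.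
  - exact: emeasurable_funM.
  apply: (@le_trans _ _ (t%:E * m%:E + (t `^ (1 - s))%:E * e'%:E)%E).
    by apply: leeD; rewrite lee_wpmul2l// lee_fin ?powR_ge0 ?(ltW t0).
  rewrite -!EFinM -EFinD lee_fin powRB ?powRr1 ?(ltW t0)//; last first.
    by apply/implyP => _; rewrite gt_eqF.
  rewrite ts le_eqVlt; apply/orP; left; apply/eqP; field.
  by rewrite !gt_eqF.
apply: (le_trans (le_poweR (ltW s0) _ kf)).
  by apply: integral_ge0 => x Ax; rewrite mule_ge0 ?k0 ?f0.
rewrite poweR_EFin lee_fin !powRM ?mulr_ge0 ?(ltW t0) ?(ltW m0)// ts.
rewrite powRB ?powRr1 ?(ltW m0)//; last by apply/implyP => _; rewrite gt_eqF.
by rewrite le_eqVlt; apply/orP; left; apply/eqP; field; rewrite gt_eqF.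
Qed.

(** * Dyadic sums *)

Lemma powR_subC {R : realType} (v x y : R) : 0 < v ->
  v `^ (x - y) * v `^ (y - x) = 1.
Proof.
move=> v0; rewrite -powRD ?subrKA ?subrr ?powRr0//.
by rewrite (gt_eqF v0) implybT.
Qed.

Lemma powRVN {R : realType} (c x : R) : 0 <= c -> c^-1 `^ (- x) = c `^ x.
Proof. by move=> c0; rewrite -powR_inv1// -powRrM mulrNN mul1r. Qed.

Lemma le_nneseries_term {R : realType} (f : nat -> \bar R) i :
  (forall k, 0 <= f k)%E -> (f i <= \sum_(k <oo) f k)%E.
Proof.
move=> f0; rewrite (@nneseriesD1 _ _ i)//; apply: leeDl.
exact: nneseries_ge0.
Qed.

Lemma ge0_nneseriesZl {R : realType} (x : \bar R) (f : nat -> \bar R) :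
  (0 <= x)%E -> (forall i, 0 <= f i)%E ->
  (x * \sum_(i <oo) f i = \sum_(i <oo) (x * f i))%E.
Proof.
move=> x0 f0; case: x x0 => [x||]// x0; first by rewrite nneseriesZl.
have [f00|] := pselect (forall i, f i = 0%E).
  by rewrite !eseries0 ?mule0// => i _ _; rewrite f00 ?mule0.
move=> /existsNP[i /eqP fi]; have {}fi : (0 < f i)%E by rewrite lt_def fi f0.
rewrite gt0_mulye ?(lt_le_trans fi) ?le_nneseries_term//.
rewrite (@nneseries_pinfty _ _ _ i)// ?gt0_mulye// => k _.
by rewrite mule_ge0.
Qed.

Lemma dyadic_bracket {R : realType} (t : R) : 0 < t ->
  exists m : int, 2 `^ m%:~R <= t < 2 `^ (m + 1)%:~R.
Proof.
move=> t0; have l2 : 0 < ln (2 : R) by rewrite ln_gt0// ltr1n.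
exists (Num.floor (ln t / ln 2)).
rewrite -[_ <= t]ler_ln ?posrE ?powR_gt0// -[t < _]ltr_ln ?posrE ?powR_gt0//.
by rewrite !ln_powR -ler_pdivlMr// -ltr_pdivrMr// floor_itv.
Qed.

Lemma nneseries_geometric {R : realType} (z : R) : 0 <= z < 1 ->
  (\sum_(i <oo) (z ^+ i)%:E <= ((1 - z)^-1)%:E)%E.
Proof.
move=> /andP[z0 z1]; apply: lime_le.
  by apply: is_cvg_nneseries => i _ _; rewrite lee_fin exprn_ge0.
apply: nearW => k; rewrite sumEFin lee_fin -[leRHS]mul1r ler_pdivlMr ?subr_gt0//.
rewrite big_mkord mulrC -opprB mulNr -subrX1 opprB lerBlDr lerDl.
by rewrite exprn_ge0.
Qed.

Lemma powR2_itv {R : realType} (c : R) : 0 < c -> 0 <= (2 `^ (- c) : R) < 1.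
Proof.
move=> c0; rewrite powR_ge0/= powRN invf_lt1 ?powR_gt0//.
have gt1 : 1 < (2 : R) by rewrite ltr1n.
rewrite lt_neqAle eq_sym powR_eq1 (gt_eqF gt1) (gt_eqF c0) orbF/=.
rewrite ltNge ler0n/= -[leLHS](powRr0 2).
by apply: ler_powR; rewrite ltW.
Qed.

Lemma powR2_natM {R : realType} (c : R) i : 2 `^ (- (c * i%:R)) = (2 `^ (- c)) ^+ i.
Proof. by rewrite -mulNr powRrM powR_mulrn ?powR_ge0. Qed.

Lemma nneseries_ge_cst {R : realType} (a : R) (u : nat -> \bar R) : 0 < a ->
  (forall i, a%:E <= u i)%E -> (\sum_(i <oo) u i = +oo)%E.
Proof.
move=> a0 au; apply/eqyP => A A0.
have u0 i : (0 <= u i)%E by apply: le_trans (au i); rewrite lee_fin ltW.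
pose k := (Num.truncn (A / a)).+1.
apply: le_trans (nneseries_lim_ge k _) => //.
apply: (@le_trans _ _ (\sum_(0 <= i < k) a%:E)%E); last exact: lee_sum.
rewrite sumEFin lee_fin sumr_const_nat subn0 -[leRHS]mulr_natr mulrC.
by rewrite -ler_pdivrMr// ltW// truncnS_gt.
Qed.

Lemma nneseries_recl_succ {R : realType} (f : nat -> \bar R) :
  (forall k, 0 <= f k)%E ->
  (\sum_(k <oo) f k = f 0%N + \sum_(k <oo) f k.+1)%E.
Proof.
move=> f0; rewrite nneseries_recl// -nneseries_addn//.
by congr (_ + _)%E; apply: eq_eseriesr => i _; rewrite addn1.
Qed.

(** * Sums over Z of nonnegative terms *)

Section sums_over_int.
Context {R : realType}.
Implicit Types a b : int -> \bar R.
Local Open Scope ereal_scope.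

(** A sum over Z folded into a series over N: [Negz i] is [- (i + 1)], so every integer occurs
    exactly once. *)
Definition zsum a : \bar R := \sum_(i <oo) (a (Posz i) + a (Negz i)).

Lemma zsum_ge0 a : (forall k, 0 <= a k) -> 0 <= zsum a.
Proof. by move=> a0; apply: nneseries_ge0 => i _ _; rewrite adde_ge0. Qed.

Lemma le_zsum a b : (forall k, 0 <= a k) -> (forall k, a k <= b k) ->
  zsum a <= zsum b.
Proof.
move=> a0 ab; apply: lee_nneseries => [i _ _|i _]; first by rewrite adde_ge0.
exact: leeD.
Qed.

Lemma le_zsum_term a k : (forall k, 0 <= a k) -> a k <= zsum a.
Proof.
move=> a0; case: k => i.
  apply: le_trans (le_nneseries_term i _); first exact: leeDl.
  by move=> j; rewrite adde_ge0.
apply: le_trans (le_nneseries_term i _); first exact: leeDr.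
by move=> j; rewrite adde_ge0.
Qed.

Lemma zsumZ (c : R) a : (forall k, 0 <= a k) -> (0 <= c)%R ->
  zsum (fun k => c%:E * a k) = c%:E * zsum a.
Proof.
move=> a0 c0; rewrite /zsum -nneseriesZl; last by move=> i _; rewrite adde_ge0.
by apply: eq_eseriesr => i _; rewrite ge0_muleDr.
Qed.

Lemma zsumD a b : (forall k, 0 <= a k) -> (forall k, 0 <= b k) ->
  zsum (fun k => a k + b k) = zsum a + zsum b.
Proof.
move=> a0 b0; rewrite /zsum -nneseriesD; last 2 first.
- by move=> i _ _; rewrite adde_ge0.
- by move=> i _ _; rewrite adde_ge0.
by apply: eq_eseriesr => i _; rewrite addeACA.
Qed.

Lemma zsum_nneseries (a : int -> nat -> \bar R) : (forall k i, 0 <= a k i) ->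
  zsum (fun k => \sum_(i <oo) a k i) = \sum_(i <oo) zsum (a ^~ i).
Proof.
move=> a0; rewrite /zsum -nneseries_interchange; last first.
  by move=> i k; rewrite adde_ge0.
by apply: eq_eseriesr => i _; rewrite nneseriesD.
Qed.

Lemma zsumS a : (forall k, 0 <= a k) -> zsum (fun k => a (k + 1)%R) = zsum a.
Proof.
move=> a0; rewrite /zsum !nneseriesD//; last first.
rewrite [X in _ = X + _]nneseries_recl_succ//.
rewrite [X in _ + X = _]nneseries_recl_succ//.
(* The shift moves the first term of the negative half to the head of the nonnegative half. *)
rewrite (_ : (Negz 0 + 1 = Posz 0)%R)//.
rewrite addeCA addeA; congr (_ + _ + _).
  by apply: eq_eseriesr => i _; rewrite intS addrC.
apply: eq_eseriesr => i _; congr a.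
by rewrite !NegzE -(addn1 i.+1) PoszD opprD subrK.
Qed.

Lemma zsum_shift a (m : int) : (forall k, 0 <= a k) ->
  zsum (fun k => a (k + m)%R) = zsum a.
Proof.
move=> a0; have sh (b : int -> \bar R) (i : nat) : (forall k, 0 <= b k) ->
    zsum (fun k => b (k + i%:Z)%R) = zsum b.
  elim: i b => [|i IH] b b0; first by congr zsum; apply/funext => k; rewrite addr0.
  rewrite -[RHS]zsumS// -(IH (fun k => b (k + 1)%R))//.
  by congr zsum; apply/funext => k; rewrite -addn1 PoszD addrA.
case: m => i; first exact: sh.
rewrite -(sh (fun k => a (k + Negz i)%R) i.+1)//.
by congr zsum; apply/funext => k; rewrite NegzE addrK.
Qed.

(** A convolution inequality: translating [Y] by [m i] costs [2^(- m i p)] in the weighted sum, and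
    [b i] times this cost is bounded by a geometric sequence. *)
Lemma zsum_layers (Y : int -> \bar R) (b : nat -> R) (m : nat -> int) (p B z : R) :
  (forall k, 0 <= Y k) -> (forall i, 0 <= b i)%R -> (0 <= z < 1)%R -> (0 <= B)%R ->
  (forall i, b i * 2 `^ (- ((m i)%:~R * p)) <= B * z ^+ i)%R ->
  zsum (fun k => (2 `^ (k%:~R * p))%:E * \sum_(i <oo) ((b i)%:E * Y (k + m i)%R)) <=
  (B / (1 - z))%:E * zsum (fun k => (2 `^ (k%:~R * p))%:E * Y k).
Proof.
move=> Y0 b0 /andP[z0 z1] B0 bB.
have t0 k i : 0 <= (b i)%:E * Y (k + m i)%R by rewrite mule_ge0 ?lee_fin.
have u0 k : 0 <= (2 `^ (k%:~R * p))%:E * Y k by rewrite mule_ge0 ?lee_fin ?powR_ge0.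
rewrite (_ : (fun k => _ * \sum_(i <oo) _) = (fun k => \sum_(i <oo)
    ((b i * 2 `^ (- ((m i)%:~R * p)))%:E *
     ((2 `^ ((k + m i)%:~R * p))%:E * Y (k + m i)%R)))); last first.
  apply/funext => k; rewrite -nneseriesZl//; apply: eq_eseriesr => i _.
  rewrite !muleA -!EFinM; congr (_%:E * _).
  rewrite -mulrA -powR2D mulrC; congr (_ * _ `^ _)%R.
  by rewrite intrD; ring.
rewrite zsum_nneseries; last first.
  by move=> k i; rewrite mule_ge0 ?lee_fin ?mulr_ge0 ?powR_ge0.
apply: (@le_trans _ _ (\sum_(i <oo) (B * z ^+ i)%:E *
    zsum (fun k => (2 `^ (k%:~R * p))%:E * Y k))).
  apply: lee_nneseries => [i _ _|i _].
    by apply: zsum_ge0 => k; rewrite mule_ge0 ?lee_fin ?mulr_ge0 ?powR_ge0.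
  rewrite zsumZ//; last by rewrite mulr_ge0 ?powR_ge0.
  rewrite (zsum_shift (a := fun k => (2 `^ (k%:~R * p))%:E * Y k))//.
  by rewrite lee_wpmul2r ?zsum_ge0// lee_fin.
rewrite (_ : \sum_(i <oo) _ = (B%:E * zsum (fun k => (2 `^ (k%:~R * p))%:E * Y k)) *
    \sum_(i <oo) (z ^+ i)%:E); last first.
  rewrite ge0_nneseriesZl//; last 2 first.
  - by rewrite mule_ge0 ?lee_fin ?zsum_ge0.
  - by move=> i; rewrite lee_fin exprn_ge0.
  by apply: eq_eseriesr => i _; rewrite EFinM muleAC.
rewrite EFinM [leRHS]muleAC; apply: lee_wpmul2l.
  by rewrite mule_ge0 ?lee_fin ?zsum_ge0.
by apply: nneseries_geometric; rewrite z0.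
Qed.

End sums_over_int.

(** * Integrals over the half-line as sums over dyadic layers *)

Section dyadic_layers.
Context {R : realType}.
Local Open Scope ereal_scope.

(** Preimages of rays are intervals. This is what makes [t |-> cap {|u|^q > t}] integrable term by
    term, with no measurability of [u]. *)
Lemma antitone_measurable (f : R -> \bar R) : (forall x y, (x <= y)%R -> f y <= f x) ->
  measurable_fun [set: R] f.
Proof.
move=> fA; apply: (measurability _ (ErealGenOInfty.measurableE R)) => _ /= -[_ [r ->] <-].
apply: measurableI => //; apply: is_interval_measurable => s t/=.
rewrite !in_itv/= !andbT => fs ft u /andP[su ut].
by rewrite in_itv/= andbT (lt_le_trans ft)// fA.
Qed.

Definition layer (c p : R) (k : int) : set R :=
  `[(c * 2 `^ (k%:~R * p))%R, (c * 2 `^ ((k + 1)%:~R * p))%R[%classic.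

Context (c p : R) (c0 : (0 < c)%R) (p0 : (0 < p)%R).

Let le_powR2 (x y : R) : (2 `^ x <= 2 `^ y :> R)%R = (x <= y)%R.
Proof.
apply/idP/idP => [|xy]; last by apply: ler_powR => //; rewrite ler1n.
apply: contraTT; rewrite -!ltNge => yx; have -> : y = (x + - (x - y))%R by ring.
have xy0 : (0 < x - y)%R by rewrite subr_gt0.
by rewrite powR2D gtr_pMr ?powR_gt0//; have /andP[] := powR2_itv xy0.
Qed.

Lemma layer_inj k k' t : layer c p k t -> layer c p k' t -> k = k'.
Proof.
wlog kk' : k k' / (k <= k')%R.
  by have [kk' H|/ltW k'k H h1 h2] := leP k k'; [exact: H|exact/esym/H].
rewrite /layer /= !in_itv/= => /andP[_ h1] /andP[h2 _]; apply/eqP; rewrite eq_le kk'/= leNgt.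
apply/negP => klt; have := le_lt_trans h2 h1.
by rewrite ltNge ler_pM2l// le_powR2 ler_pM2r// ler_int addrC lez1D klt.
Qed.

Lemma layer_cover : \bigcup_i (layer c p (Posz i) `|` layer c p (Negz i)) = `]0%R, +oo[%classic.
Proof.
apply/seteqP; split => [t [i _]|t].
  have lt0 k : layer c p k t -> (0 < t)%R.
    rewrite /layer/= in_itv/= => /andP[h _]; apply: lt_le_trans h.
    by rewrite mulr_gt0// powR_gt0.
  by rewrite /= in_itv/= andbT => -[]; exact: lt0.
rewrite /= in_itv/= andbT => t0; have tc0 : (0 < t / c)%R by rewrite divr_gt0.
have [k /andP[h1 h2]] := dyadic_bracket (powR_gt0 p^-1 tc0).
have tE : (t = c * ((t / c) `^ p^-1) `^ p)%R.
  by rewrite -powRrM mulVf ?gt_eqF// powRr1 ?(ltW tc0)// mulrC divfK ?gt_eqF.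
have kt : layer c p k t.
  rewrite /layer/= in_itv/= [X in (_ <= X)%R]tE [X in (X < _)%R]tE ler_pM2l// ltr_pM2l//.
  rewrite 2!powRrM ge0_ler_powR ?nnegrE ?powR_ge0 ?(ltW p0)//=.
  by rewrite gt0_ltr_powR ?nnegrE ?powR_ge0.
by case: k kt {h1 h2} => i ki; exists i => //; [left|right].
Qed.

Lemma measurable_layer k : measurable (layer c p k).
Proof. exact: measurable_itv. Qed.

Lemma lebesgue_layer k :
  lebesgue_measure (layer c p k) = (c * 2 `^ (k%:~R * p) * (2 `^ p - 1))%:E.
Proof.
rewrite /layer lebesgue_measure_itv/= lte_fin ltr_pM2l// ltNge le_powR2 ler_pM2r//.
rewrite ler_int addrC lez1D ltxx/= -EFinB; congr _%:E.
by rewrite intrD mulrDl mul1r powR2D; ring.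
Qed.

Lemma int_layersE (f : R -> \bar R) : measurable_fun [set: R] f -> (forall t, 0 <= f t) ->
  \int[lebesgue_measure]_(t in `]0%R, +oo[) f t =
  zsum (fun k => \int[lebesgue_measure]_(t in layer c p k) f t).
Proof.
move=> mf f0; rewrite -layer_cover ge0_integral_bigcup//; last 3 first.
- by move=> i; apply: measurableU; exact: measurable_layer.
- exact: measurable_funTS.
- apply/trivIsetP => i j _ _; apply: contraNeq => /set0P[t [ti tj]]; apply/eqP.
  by case: ti tj => ti [] tj; have := layer_inj ti tj => // -[].
rewrite /zsum; apply: eq_eseriesr => i _; rewrite ge0_integral_setU//.
- exact: measurable_layer.
- exact: measurable_layer.
- exact: measurable_funTS.
- by apply/disj_setPS => t [t1 t2]; have := layer_inj t1 t2.
Qed.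

Lemma int_le_layers (f : R -> \bar R) (M : int -> \bar R) : measurable_fun [set: R] f ->
  (forall t, 0 <= f t) -> (forall k, 0 <= M k) ->
  (forall k t, layer c p k t -> f t <= M k) ->
  \int[lebesgue_measure]_(t in `]0%R, +oo[) f t <=
  zsum (fun k => (c * 2 `^ (k%:~R * p) * (2 `^ p - 1))%:E * M k).
Proof.
move=> mf f0 M0 fM; rewrite int_layersE//; apply: le_zsum => k; first exact: integral_ge0.
rewrite -lebesgue_layer muleC -(@integral_cst _ _ _ lebesgue_measure _ (measurable_layer k)).
apply: ge0_le_integral => //; [exact: measurable_layer|exact: measurable_funTS|].
by move=> t; exact: fM.
Qed.

Lemma layers_le_int (f : R -> \bar R) (M : int -> \bar R) : measurable_fun [set: R] f ->
  (forall t, 0 <= f t) -> (forall k, 0 <= M k) ->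
  (forall k t, layer c p k t -> M k <= f t) ->
  zsum (fun k => (c * 2 `^ (k%:~R * p) * (2 `^ p - 1))%:E * M k) <=
  \int[lebesgue_measure]_(t in `]0%R, +oo[) f t.
Proof.
move=> mf f0 M0 fM; rewrite int_layersE//; apply: le_zsum => k.
  rewrite mule_ge0// -lebesgue_layer; exact: measure_ge0.
rewrite -lebesgue_layer muleC -(@integral_cst _ _ _ lebesgue_measure _ (measurable_layer k)).
apply: ge0_le_integral => //; [exact: measurable_layer|by move=> t _; exact: M0|exact: measurable_funTS|].
by move=> t; exact: fM.
Qed.

End dyadic_layers.

(** * Positivity of the Gamma function *)

Section gamma.
Context {R : realType} (x : R) (x0 : 0 < x).

Let g (t : R) : R := t `^ (x - 1) * expR (- t).

Let g0 t : 0 <= g t. Proof. by rewrite mulr_ge0 ?powR_ge0 ?expR_ge0. Qed.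

Let mg : measurable_fun [set: R] (EFin \o g).
Proof.
apply/measurable_EFinP; apply: measurable_funM; first exact: measurable_powR.
by apply: measurableT_comp => //; exact: measurable_expR.
Qed.

(** Finiteness matters because [Gamma] is a [fine] part, which reads an infinite integral as [0]. On
    the layer of [2^k] the integral is at most a multiple of [2^(k x) min (1, 2^(- k m))], summable
    for [k >= 0] since [m > x] and for [k < 0] since [x > 0]. *)
Lemma Gamma_integral_lty : (\int[lebesgue_measure]_(t in `]0%R, +oo[) (g t)%:E < +oo)%E.
Proof.
pose m := (Num.truncn x).+1; have xm : x < m%:R by exact: truncnS_gt.
pose C : R := 2 `^ `|x - 1|; have C0 : 0 <= C by exact: powR_ge0.
have gle k t : layer 1 1 k t ->
    g t <= C * m`!%:R * 2 `^ (k%:~R * (x - 1)) * Num.min 1 (2 `^ (- (k%:~R * m%:R))).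
  rewrite /layer/= in_itv/= !mul1r !mulr1 => /andP[h1 h2].
  have k0 : 0 < 2 `^ k%:~R :> R by rewrite powR_gt0.
  have t0 : 0 < t by exact: lt_le_trans h1.
  have pw : t `^ (x - 1) <= C * 2 `^ (k%:~R * (x - 1)).
    have -> : t = 2 `^ k%:~R * (t / 2 `^ k%:~R) by rewrite mulrC divfK ?gt_eqF.
    have u1 : 1 <= t / 2 `^ k%:~R by rewrite ler_pdivlMr// mul1r.
    have u2 : t / 2 `^ k%:~R <= 2.
      by rewrite ler_pdivrMr// ltW// (lt_le_trans h2)// intrD powR2D powRr1// mulrC.
    rewrite (powRM _ (ltW k0) (le_trans ler01 u1)) -powRrM mulrC ler_wpM2r ?powR_ge0//.
    apply: (@le_trans _ _ ((t / 2 `^ k%:~R) `^ `|x - 1|)).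
      by apply: ler_powR => //; exact: ler_norm.
    by rewrite ge0_ler_powR ?nnegrE// (le_trans ler01).
  have ex : expR (- t) <= m`!%:R * Num.min 1 (2 `^ (- (k%:~R * m%:R))).
    have f1 : 1 <= m`!%:R :> R by rewrite ler1n fact_gt0.
    rewrite minr_pMr ?(le_trans ler01)// le_min mulr1; apply/andP; split.
      by rewrite (le_trans _ f1)// expRN invf_le1 ?expR_gt0// ltW// expR_gt1.
    have tm : t ^+ m / m`!%:R <= expR t.
      apply: le_trans (expR_ge1Dxn (Num.truncn x) (ltW t0)).
      by rewrite -/m lerDr.
    have tm0 : 0 < t ^+ m / m`!%:R by rewrite divr_gt0 ?exprn_gt0// (lt_le_trans ltr01).
    rewrite expRN; apply: (@le_trans _ _ (t ^+ m / m`!%:R)^-1).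
      by rewrite lef_pV2 ?posrE ?expR_gt0.
    rewrite invf_div powRN; apply: ler_wpM2l; first exact: le_trans f1.
    rewrite lef_pV2 ?posrE ?exprn_gt0 ?powR_gt0// powRrM powR_mulrn ?powR_ge0//.
    by rewrite lerXn2r ?nnegrE ?(ltW t0) ?(ltW k0).
  apply: le_trans (ler_pM (powR_ge0 _ _) (expR_ge0 _) pw ex) _.
  by rewrite le_eqVlt; apply/orP; left; apply/eqP; ring.
pose D : R := C * m`!%:R; have D0 : 0 <= D by rewrite mulr_ge0.
pose M (k : int) := (D * 2 `^ (k%:~R * (x - 1)) * Num.min 1 (2 `^ (- (k%:~R * m%:R))))%:E.
apply: le_lt_trans (@int_le_layers _ 1 1 ltr01 ltr01 _ M mg _ _ _) _.
- by move=> t; rewrite lee_fin.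
- by move=> k; rewrite lee_fin !mulr_ge0 ?powR_ge0// le_min ler01 powR_ge0.
- by move=> k t /gle; rewrite lee_fin.
pose z1 : R := 2 `^ (- (m%:R - x)); pose z2 : R := 2 `^ (- x).
have z1P : 0 <= z1 < 1 by apply: powR2_itv; rewrite subr_gt0.
have z2P : 0 <= z2 < 1 by exact: powR2_itv.
have s0 z : 0 <= z < 1 -> (\sum_(i <oo) (D * z ^+ i)%:E < +oo)%E.
  move=> zP; under eq_eseriesr => i _ do rewrite EFinM.
  rewrite nneseriesZl; last by move=> i _; rewrite lee_fin exprn_ge0//; case/andP: zP.
  apply: le_lt_trans (lee_wpmul2l _ (nneseries_geometric zP)) _; first by rewrite lee_fin.
  by rewrite -EFinM ltry.
apply: (@le_lt_trans _ _ (\sum_(i <oo) ((D * z1 ^+ i)%:E + (D * z2 ^+ i)%:E))%E); last first.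
  rewrite nneseriesD; last 2 first.
  - by move=> i _ _; rewrite lee_fin mulr_ge0// exprn_ge0//; case/andP: z1P.
  - by move=> i _ _; rewrite lee_fin mulr_ge0// exprn_ge0//; case/andP: z2P.
  by rewrite lte_add_pinfty ?s0.
have nn k : 0 <= 1 * 2 `^ (k%:~R * 1) * (2 `^ 1 - 1) * (D * 2 `^ (k%:~R * (x - 1)) *
    Num.min 1 (2 `^ (- (k%:~R * m%:R)))) :> R.
  apply: mulr_ge0.
    have h21 : 0 <= 2 `^ 1 - 1 :> R by rewrite powRr1//; lra.
    by apply: mulr_ge0 => //; rewrite mul1r powR_ge0.
  apply: mulr_ge0; first by apply: mulr_ge0 => //; exact: powR_ge0.
  by rewrite le_min ler01 powR_ge0.
apply: lee_nneseries => [i _ _|i _]; first by rewrite -!EFinM adde_ge0// lee_fin nn.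
rewrite -!EFinM !mulr1 !mul1r powRr1//; apply: leeD; rewrite lee_fin.
  have -> : 2 - 1 = 1 :> R by ring.
  rewrite mulr1 mulrCA -mulrA ler_wpM2l//.
  apply: (@le_trans _ _ (2 `^ i%:~R * (2 `^ (i%:~R * (x - 1)) * 2 `^ (- (i%:~R * m%:R))))).
    rewrite mulrCA; do 2 (apply: ler_wpM2l; first exact: powR_ge0).
    by rewrite ge_min lexx orbT.
  rewrite -!powR2D /z1 -powR2_natM le_eqVlt; apply/orP; left; apply/eqP.
  by congr (_ `^ _); rewrite -pmulrn; ring.
have -> : 2 - 1 = 1 :> R by ring.
rewrite mulr1 mulrCA -mulrA ler_wpM2l//.
apply: (@le_trans _ _ (2 `^ (Negz i)%:~R * (2 `^ ((Negz i)%:~R * (x - 1)) * 1))).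
  rewrite mulrCA; do 2 (apply: ler_wpM2l; first exact: powR_ge0).
  by rewrite ge_min lexx.
rewrite mulr1 -!powR2D /z2 -powR2_natM; apply: ler_powR; first by rewrite ler1n.
by rewrite NegzE intrN -pmulrn -natr1; have := x0; lra.
Qed.

Lemma Gamma_gt0 : 0 < Gamma x.
Proof.
rewrite /Gamma /Rintegral fine_gt0//; apply/andP; split; last exact: Gamma_integral_lty.
pose a : R := Num.min 1 (2 `^ (x - 1)) * expR (- 2).
have a0 : 0 < a by rewrite mulr_gt0 ?expR_gt0// lt_min ltr01 powR_gt0.
apply: (@lt_le_trans _ _ (a%:E * lebesgue_measure (`[1%R, 2%R]%classic : set R))%E).
  rewrite lebesgue_measure_itv/= lte_fin ltr1n -EFinB -EFinM lte_fin mulr_gt0//; lra.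
rewrite -integral_cst//; apply: (@le_trans _ _ (\int[lebesgue_measure]_(t in `[1%R, 2%R]) (g t)%:E)%E).
  apply: ge0_le_integral => //.
  - by move=> t _; rewrite lee_fin ltW.
  - by apply: measurable_funTS; exact: mg.
  move=> t; rewrite /= in_itv/= => /andP[t1 t2]; rewrite lee_fin /a /g.
  apply: ler_pM; rewrite ?expR_ge0 ?le_min ?ler01 ?powR_ge0//; last by rewrite ler_expR lerN2.
  have t0 := le_trans ler01 t1; have [x1|x1] := leP 1 x.
    rewrite ge_min; apply/orP; left; rewrite -[leLHS](powRr0 t); apply: ler_powR => //.
    by rewrite subr_ge0.
  rewrite ge_min; apply/orP; right; rewrite -(opprB 1 x) !powRN.
  have t_gt0 := lt_le_trans ltr01 t1.
  rewrite lef_pV2 ?posrE ?powR_gt0// ge0_ler_powR ?nnegrE ?subr_ge0//.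
  exact: ltW.
apply: ge0_subset_integral => //; first by apply: measurable_funTS; exact: mg.
  by move=> t _; rewrite lee_fin.
by move=> t; rewrite /= !in_itv/= andbT => /andP[h _]; exact: lt_le_trans h.
Qed.

End gamma.

(** * Potentials *)

(* On R^n, [dist] will be the l1 distance, which is comparable to the Euclidean
   one and keeps balls and dyadic cells elementary. *)
Section potentials.
Context {R : realType} {disp : measure_display} {T : measurableType disp}.
Context (mu : {sigma_finite_measure set T -> \bar R}) (dist : T -> T -> R).
Context (N alpha V : R).
Context (dist_refl : forall x, dist x x = 0)
  (distC : forall x y, dist x y = dist y x)
  (dist_triangle : forall x y z, dist x z <= dist x y + dist y z)
  (mdist : measurable_fun [set: T * T] (fun p => dist p.1 p.2))
  (V0 : 0 < V)
  (mu_ball : forall x r, 0 < r ->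
    (mu [set y | (dist x y < r)%R] <= (V * r `^ N)%:E)%E)
  (alpha0 : 0 < alpha) (alphaN : alpha < N).

Let nalpha : 0 < N - alpha. Proof. by rewrite subr_gt0. Qed.

Lemma dist_ge0 x y : 0 <= dist x y.
Proof.
by have := dist_triangle x y x; rewrite dist_refl (distC y) -mulr2n pmulrn_lge0.
Qed.

Local Open Scope ereal_scope.

Definition kern (x y : T) : \bar R := epow (dist x y)%:E (alpha - N).

Lemma kern_ge0 x y : 0 <= kern x y. Proof. exact: epow_ge0. Qed.

Lemma kernC x y : kern x y = kern y x. Proof. by rewrite /kern distC. Qed.

Lemma measurable_kern : measurable_fun [set: T * T] (fun p => kern p.1 p.2).
Proof.
by apply: (measurableT_comp (measurable_epow _)); exact/measurable_EFinP.
Qed.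

Lemma measurable_kernl x : measurable_fun [set: T] (kern x).
Proof.
exact: (measurableT_comp measurable_kern (pair1_measurable x)).
Qed.

Lemma measurable_distl x : measurable_fun [set: T] (dist x).
Proof. exact: (measurableT_comp mdist (pair1_measurable x)). Qed.

Lemma kern_le (c : R) x y x' y' : (0 < c)%R -> (dist x y <= c * dist x' y')%R ->
  kern x' y' <= (c `^ (N - alpha))%:E * kern x y.
Proof.
move=> c0 xy; rewrite /kern.
have an : (alpha - N < 0)%R by rewrite subr_lt0.
have [d0|d0] := leP (dist x y) 0%R.
  have -> : dist x y = 0%R by apply/eqP; rewrite eq_le d0 dist_ge0.
  have -> : epow 0%:E (alpha - N) = +oo :> \bar R.
    by rewrite /epow leNgt an/= inver powR0 ?eqxx// oppr_eq0 lt_eqF.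
  by rewrite gt0_muley ?leey// lte_fin powR_gt0.
have d0' : (0 < dist x' y')%R by rewrite -(pmulr_rgt0 _ c0) (lt_le_trans d0).
rewrite !epow_EFin// -EFinM lee_fin -[(alpha - N)%R]opprB !powRN.
rewrite ler_pdivlMr ?powR_gt0// mulrC ler_pdivrMr ?powR_gt0//.
rewrite -powRM ?(ltW c0) ?dist_ge0//.
by rewrite ge0_ler_powR ?nnegrE ?mulr_ge0 ?dist_ge0 ?(ltW c0) ?(ltW nalpha).
Qed.

Lemma kern_le_radius x y (r : R) : (0 < r)%R -> (r <= dist x y)%R ->
  kern x y <= (r `^ (alpha - N))%:E.
Proof.
move=> r0 rxy; rewrite -epow_EFin//; apply: epow_le0.
- by rewrite subr_le0 ltW.
- by rewrite lee_fin ltW.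
- by rewrite lee_fin.
Qed.

Lemma radius_le_kern x y (r : R) : (0 < r)%R -> (dist x y <= r)%R ->
  (r `^ (alpha - N))%:E <= kern x y.
Proof.
move=> r0 rxy; rewrite -epow_EFin//; apply: epow_le0.
- by rewrite subr_le0 ltW.
- by rewrite lee_fin dist_ge0.
- by rewrite lee_fin.
Qed.

Lemma measurable_ball_dist x (r : R) : measurable [set y | (dist x y < r)%R].
Proof.
rewrite -[X in measurable X]setTI.
have := measurable_distl x measurableT (measurable_itv `]-oo, r[).
by congr (measurable _); apply/seteqP; split => y /=; rewrite in_itv.
Qed.

Definition pot (f : T -> \bar R) (x : T) : \bar R := \int[mu]_y (kern x y * f y).

Definition nneg_mfun (f : T -> \bar R) :=
  measurable_fun [set: T] f /\ forall x, 0 <= f x.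

Lemma nneg_mfun_restrict f A : measurable A -> nneg_mfun f -> nneg_mfun (f \_ A).
Proof.
move=> mA [mf f0]; split; last by move=> x; rewrite patchE; case: ifP.
apply/(measurable_restrictT _ _).1 => //; exact: measurable_funTS.
Qed.

Lemma nneg_mfun_indic A : measurable A -> nneg_mfun (EFin \o \1_A).
Proof.
by move=> mA; split; [exact/measurable_EFinP|move=> x; rewrite lee_fin].
Qed.

Lemma nneg_mfunM f g : nneg_mfun f -> nneg_mfun g -> nneg_mfun (f \* g).
Proof.
move=> [mf f0] [mg g0]; split => [|x]; first exact: emeasurable_funM.
by rewrite mule_ge0.
Qed.

Lemma nneg_mfun_poweR f s : nneg_mfun f -> nneg_mfun (fun x => f x `^ s).
Proof.
move=> [mf f0]; split => [|x]; last exact: poweR_ge0.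
exact: (measurableT_comp (measurable_poweR s)).
Qed.

Lemma nneg_mfun_kern x : nneg_mfun (kern x).
Proof. by split => [|y]; [exact: measurable_kernl|exact: kern_ge0]. Qed.

Lemma measurable_kernM f x : nneg_mfun f ->
  measurable_fun [set: T] (fun y => kern x y * f y).
Proof. by move=> mf; exact: (nneg_mfunM (nneg_mfun_kern x) mf).1. Qed.

Lemma int_indic A : measurable A -> \int[mu]_x (\1_A x)%:E = mu A.
Proof. by move=> mA; rewrite integral_indic// setIT. Qed.

Lemma int_nnegZ (k : \bar R) f : nneg_mfun f -> 0 <= k ->
  \int[mu]_x (k * f x) = k * \int[mu]_x f x.
Proof. by move=> [mf f0] k0; rewrite ge0_integralZl. Qed.

Lemma int_nnegD f g : nneg_mfun f -> nneg_mfun g ->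
  \int[mu]_x (f x + g x) = \int[mu]_x f x + \int[mu]_x g x.
Proof. by move=> [mf f0] [mg g0]; rewrite ge0_integralD. Qed.

Lemma le_int f g : nneg_mfun f -> nneg_mfun g -> (forall x, f x <= g x) ->
  \int[mu]_x f x <= \int[mu]_x g x.
Proof. by move=> [mf f0] [mg g0] fg; apply: ge0_le_integral. Qed.

Lemma nneg_mfunZ (k : \bar R) f : 0 <= k -> nneg_mfun f ->
  nneg_mfun (fun x => k * f x).
Proof. by move=> k0 mf; apply: nneg_mfunM => //; split. Qed.

Lemma nneg_mfunD f g : nneg_mfun f -> nneg_mfun g ->
  nneg_mfun (fun x => f x + g x).
Proof.
move=> [mf f0] [mg g0]; split => [|x]; last exact: adde_ge0.
exact: emeasurable_funD.
Qed.

Lemma pot_ge0 f x : nneg_mfun f -> 0 <= pot f x.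
Proof.
by move=> mf; apply: integral_ge0 => y _; rewrite mule_ge0 ?kern_ge0 ?mf.2.
Qed.

Lemma measurable_kern2 f : nneg_mfun f ->
  measurable_fun [set: T * T] (fun p => kern p.1 p.2 * f p.2).
Proof.
move=> mf; apply: emeasurable_funM; first exact: measurable_kern.
exact: (measurableT_comp mf.1).
Qed.

Lemma measurable_pot f : nneg_mfun f -> measurable_fun [set: T] (pot f).
Proof.
move=> mf; have := measurable_fun_fubini_tonelli_F (m2 := mu) _ (measurable_kern2 mf).
by apply => x; rewrite mule_ge0 ?kern_ge0 ?mf.2.
Qed.

Lemma nneg_mfun_pot f : nneg_mfun f -> nneg_mfun (pot f).
Proof. by move=> mf; split => [|x]; [exact: measurable_pot|exact: pot_ge0]. Qed.

(** Tonelli's theorem and the symmetry of the kernel. *)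
Lemma pot_sym f g : nneg_mfun f -> nneg_mfun g ->
  \int[mu]_x (g x * pot f x) = \int[mu]_y (f y * pot g y).
Proof.
move=> mf mg; pose F (p : T * T) := g p.1 * (kern p.1 p.2 * f p.2).
have mF : measurable_fun setT F.
  apply: emeasurable_funM; last exact: measurable_kern2.
  exact: (measurableT_comp mg.1).
have F0 p : 0 <= F p by rewrite !mule_ge0 ?kern_ge0 ?mf.2 ?mg.2.
transitivity (\int[mu]_x \int[mu]_y F (x, y)).
  apply: eq_integral => x _; rewrite /pot -ge0_integralZl// ?mg.2//.
    exact: measurable_kernM.
  by move=> y _; rewrite mule_ge0 ?kern_ge0 ?mf.2.
rewrite (fubini_tonelli F)//; apply: eq_integral => y _.
rewrite /pot -ge0_integralZl ?mf.2//; last 2 first.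
- exact: measurable_kernM.
- by move=> x _; rewrite mule_ge0 ?kern_ge0 ?mg.2.
by apply: eq_integral => x _; rewrite /F/= kernC muleA muleC [g x * _]muleC.
Qed.

Lemma le_pot f g x : nneg_mfun f -> nneg_mfun g -> (forall y, f y <= g y) ->
  pot f x <= pot g x.
Proof.
move=> mf mg fg; apply: ge0_le_integral => //.
- by move=> y _; rewrite mule_ge0 ?kern_ge0 ?mf.2.
- exact: measurable_kernM.
- exact: measurable_kernM.
- by move=> y _; rewrite lee_wpmul2l ?kern_ge0.
Qed.

Lemma potZ f (c : R) x : nneg_mfun f -> (0 <= c)%R ->
  pot (fun y => c%:E * f y) x = c%:E * pot f x.
Proof.
move=> mf c0; rewrite /pot -ge0_integralZl//; last 2 first.
- exact: measurable_kernM.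
- by move=> y _; rewrite mule_ge0 ?kern_ge0 ?mf.2.
by apply: eq_integral => y _; rewrite muleCA.
Qed.

Lemma potD f g x : nneg_mfun f -> nneg_mfun g ->
  pot (fun y => f y + g y) x = pot f x + pot g x.
Proof.
move=> mf mg; rewrite /pot -ge0_integralD//; first last.
- exact: measurable_kernM.
- by move=> y _; rewrite mule_ge0 ?kern_ge0 ?mg.2.
- exact: measurable_kernM.
- by move=> y _; rewrite mule_ge0 ?kern_ge0 ?mf.2.
by apply: eq_integral => y _; rewrite ge0_muleDr ?mf.2 ?mg.2.
Qed.

Lemma pot_nneseries (f : nat -> T -> \bar R) x : (forall i, nneg_mfun (f i)) ->
  pot (fun y => \sum_(i <oo) f i y) x = \sum_(i <oo) pot (f i) x.
Proof.
move=> mf; rewrite /pot -integral_nneseries//; last 2 first.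
- by move=> i; exact: measurable_kernM.
- by move=> i y _; rewrite mule_ge0 ?kern_ge0 ?(mf i).2.
by apply: eq_integral => y _; rewrite ge0_nneseriesZl ?kern_ge0// => i; exact: (mf i).2.
Qed.

Lemma pot_restrict f A x : pot (f \_ A) x = \int[mu]_(y in A) (kern x y * f y).
Proof.
rewrite [RHS]integral_mkcond; apply: eq_integral => y _.
by rewrite !patchE; case: ifP => // _; rewrite mule0.
Qed.

(** * Potentials of indicators and the weak type estimate *)

Definition ball_const : R := (V * 2 `^ (N - alpha) / (1 - 2 `^ (- alpha)))%R.

Lemma ball_const_gt0 : (0 < ball_const)%R.
Proof.
rewrite !mulr_gt0 ?powR_gt0// invr_gt0 subr_gt0.
by have /andP[] := powR2_itv alpha0.
Qed.

Lemma kern_le_shells x y (r : R) : (0 < r)%R -> (dist x y < r)%R ->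
  kern x y <= \sum_(i <oo) ((2 `^ (- (i.+1)%:R) * r) `^ (alpha - N))%:E *
    (\1_[set y | (dist x y < 2 `^ (- i%:R) * r)%R] y)%:E.
Proof.
move=> r0 xyr.
have u0 i : 0 <= ((2 `^ (- (i.+1)%:R) * r) `^ (alpha - N))%:E *
    (\1_[set y | (dist x y < 2 `^ (- i%:R) * r)%R] y)%:E.
  by rewrite -EFinM lee_fin mulr_ge0// powR_ge0.
(* At distance [0] the kernel is [+oo], and so is the series, whose terms are then bounded below. *)
have [d0|d0] := leP (dist x y) 0%R.
  rewrite (@nneseries_ge_cst _ ((2^-1 * r) `^ (alpha - N))) ?leey//.
    by rewrite powR_gt0// mulr_gt0.
  move=> i; rewrite indicE mem_set/= ?mule1; last first.
    by rewrite (le_lt_trans d0)// mulr_gt0 ?powR_gt0.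
  rewrite lee_fin -[(alpha - N)%R]opprB !powRN lef_pV2 ?posrE ?powR_gt0 ?mulr_gt0 ?powR_gt0//.
  rewrite ge0_ler_powR ?nnegrE ?(ltW nalpha) ?mulr_ge0 ?powR_ge0 ?invr_ge0 ?(ltW r0)//.
  rewrite ler_pM2r// lef_pV2 ?posrE ?powR_gt0// -[leLHS]powRr1//.
  by apply: ler_powR; rewrite ?ler1n.
have [|m /andP[h1 h2]] := @dyadic_bracket _ (dist x y / r); first exact: divr_gt0.
rewrite ler_pdivlMr// in h1; rewrite ltr_pdivrMr// in h2.
have m0 : (m < 0)%R.
  rewrite ltNge; apply/negP => m0; have := le_lt_trans h1 xyr.
  rewrite -[ltRHS]mul1r ltr_pM2r// ltNge -[leLHS](powRr0 2) ler_powR ?ler1n//.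
  by rewrite ler0z.
have [i mi] : exists i : nat, m = (- (i.+1)%:Z)%R.
  by exists `|m|.-1%N; rewrite prednK ?absz_gt0 ?lt_eqF// ltz0_abs// opprK.
apply: le_trans (le_nneseries_term i u0).
rewrite indicE mem_set ?mule1/=; last first.
  move: h2; rewrite mi (_ : (- (i.+1)%:Z + 1 = - i%:Z)%R) ?mulrNz//.
  by rewrite -addn1 PoszD opprD subrK.
apply: kern_le_radius; first by rewrite mulr_gt0 ?powR_gt0.
by move: h1; rewrite mi mulrNz.
Qed.

(** The shell [2^(- i - 1) r <= dist x y < 2^(- i) r] contributes at most
    [V 2^(N - alpha) r^alpha 2^(- alpha i)]; [ball_const] is the geometric sum of these bounds
    without [r^alpha]. *)
Lemma int_kern_ball x (r : R) : (0 < r)%R ->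
  \int[mu]_y (kern x y * (\1_[set y | (dist x y < r)%R] y)%:E) <=
  (ball_const * r `^ alpha)%:E.
Proof.
move=> r0; pose a i := ((2 `^ (- (i.+1)%:R) * r) `^ (alpha - N))%R.
pose B i := [set y | (dist x y < 2 `^ (- i%:R) * r)%R].
have mB i : measurable (B i) by exact: measurable_ball_dist.
have a0 i : (0 <= a i)%R by exact: powR_ge0.
apply: (@le_trans _ _ (\int[mu]_y \sum_(i <oo) ((a i)%:E * (\1_(B i) y)%:E))).
  apply: ge0_le_integral => //.
  - by move=> y _; rewrite mule_ge0 ?kern_ge0 ?lee_fin.
  - apply: measurable_kernM; apply: nneg_mfun_indic; exact: measurable_ball_dist.
  - apply: ge0_emeasurable_sum => i y _; first by rewrite -EFinM lee_fin mulr_ge0.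
    by apply: emeasurable_funM => //; exact/measurable_EFinP.
  - move=> y _; rewrite indicE; have [|_] := boolP (y \in _); last first.
      by rewrite mule0; apply: nneseries_ge0 => i _ _; rewrite -EFinM lee_fin mulr_ge0.
    by rewrite inE/= mule1; exact: kern_le_shells.
rewrite integral_nneseries//; last 2 first.
- by move=> i; apply: emeasurable_funM => //; exact/measurable_EFinP.
- by move=> i y _; rewrite -EFinM lee_fin mulr_ge0.
pose z : R := (2 `^ (- alpha))%R.
apply: (@le_trans _ _ (\sum_(i <oo) ((V * 2 `^ (N - alpha) * r `^ alpha)%:E * (z ^+ i)%:E))).
  apply: lee_nneseries => [i _ _|i _].
    by apply: integral_ge0 => y _; rewrite -EFinM lee_fin mulr_ge0.
  rewrite int_nnegZ ?lee_fin//; last exact: nneg_mfun_indic.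
  rewrite int_indic//.
  apply: (@le_trans _ _ ((a i)%:E * (V * (2 `^ (- i%:R) * r) `^ N)%:E)).
    by rewrite lee_wpmul2l ?lee_fin// mu_ball// mulr_gt0 ?powR_gt0.
  rewrite -EFinM lee_fin /a /z -powR2_natM.
  rewrite !powRM ?powR_ge0 ?(ltW r0)// -!powRrM.
  have rN : (r `^ N = r `^ alpha * (r `^ (alpha - N))^-1)%R.
    by rewrite -powRN -powRD ?opprB ?subrKC//; apply/implyP => _; rewrite gt_eqF.
  rewrite rN.
  have -> : (2 `^ (- i.+1%:R * (alpha - N)) = 2 `^ (N - alpha) *
     2 `^ (- (alpha * i%:R)) * (2 `^ (- i%:R * N))^-1 :> R)%R.
    by rewrite -powRN -!powR2D; congr (_ `^ _)%R; rewrite -natr1; ring.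
  rewrite le_eqVlt; apply/orP; left; apply/eqP; field.
  by rewrite !gt_eqF ?powR_gt0.
rewrite nneseriesZl; last by move=> i _; rewrite lee_fin exprn_ge0// powR_ge0.
apply: (@le_trans _ _ ((V * 2 `^ (N - alpha) * r `^ alpha)%:E * ((1 - z)^-1)%:E)).
  rewrite lee_wpmul2l ?nneseries_geometric ?powR2_itv// lee_fin.
  by rewrite !mulr_ge0 ?powR_ge0 ?(ltW V0).
rewrite -EFinM lee_fin /ball_const le_eqVlt; apply/orP; left; apply/eqP.
by rewrite -/z; ring.
Qed.

(** Within distance [r] the kernel itself is integrated; beyond it the kernel is at most
    [r^(alpha - N)]. The radius is left free for [weak_pot]. *)
Lemma pot_indic_le x A (r : R) : measurable A -> (0 < r)%R ->
  pot (EFin \o \1_A) x <=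
  (ball_const * r `^ alpha)%:E + (r `^ (alpha - N))%:E * mu A.
Proof.
move=> mA r0; have mB := measurable_ball_dist x r.
apply: (@le_trans _ _ (\int[mu]_y (kern x y * (\1_[set y | (dist x y < r)%R] y)%:E +
    (r `^ (alpha - N))%:E * (\1_A y)%:E))).
  apply: ge0_le_integral => //.
  - by move=> y _; rewrite mule_ge0 ?kern_ge0 ?lee_fin.
  - exact/measurable_kernM/nneg_mfun_indic.
  - apply: emeasurable_funD; first exact/measurable_kernM/nneg_mfun_indic.
    by apply: emeasurable_funM => //; exact/measurable_EFinP.
  - move=> y _ /=; rewrite !indicE; case: (y \in A) => /=; last first.
      by rewrite !mule0 adde0 mule_ge0 ?kern_ge0 ?lee_fin.
    rewrite !mule1; have [yB|yB] := boolP (y \in _).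
      by rewrite mule1 leeDl// lee_fin powR_ge0.
    rewrite mule0 add0e kern_le_radius//; move: yB; rewrite notin_setE/=.
    by move/negP; rewrite -leNgt.
rewrite ge0_integralD//; last 4 first.
- by move=> y _; rewrite mule_ge0 ?kern_ge0 ?lee_fin.
- exact/measurable_kernM/nneg_mfun_indic.
- by move=> y _; rewrite -EFinM lee_fin mulr_ge0 ?powR_ge0.
- by apply: emeasurable_funM => //; exact/measurable_EFinP.
apply: leeD; first exact: int_kern_ball.
rewrite ge0_integralZl ?integral_indic ?setIT ?lee_fin ?powR_ge0//.
exact/measurable_EFinP.
Qed.

(** The weak type estimate of exponent [N / (N - alpha)] on [L^1]. By symmetry [t mu A] is at most
    the integral of [f] against the potential of [A], which [pot_indic_le] bounds; half of [t mu A]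
    is then absorbed, whence the finiteness of [mu A]. *)
Lemma weak_pot (f : T -> \bar R) A (M t : R) : nneg_mfun f -> measurable A ->
  mu A < +oo -> (0 < M)%R -> (0 < t)%R -> \int[mu]_y f y <= M%:E ->
  (forall x, A x -> t%:E <= pot f x) ->
  mu A <= (ball_const * (2 * M / t) `^ (N / (N - alpha)))%:E.
Proof.
move=> mf mA Afin M0 t0 fM At.
have fA : mu A \is a fin_num by rewrite ge0_fin_numE.
(* With this radius [M r^(alpha - N) = t / 2], the part to be absorbed. *)
pose r : R := ((2 * M / t) `^ (N - alpha)^-1)%R.
have Mt0 : (0 < 2 * M / t)%R by rewrite divr_gt0// mulr_gt0.
have r0 : (0 < r)%R by rewrite powR_gt0.
have rNa : (r `^ (N - alpha) = 2 * M / t)%R.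
  by rewrite -powRrM mulVf ?gt_eqF// powRr1// ltW.
have raN : (r `^ (alpha - N) = t / (2 * M))%R.
  by rewrite -opprB powRN rNa invf_div.
have h : t%:E * mu A <=
    M%:E * ((ball_const * r `^ alpha)%:E + (r `^ (alpha - N))%:E * mu A).
  apply: (@le_trans _ _ (\int[mu]_x ((\1_A x)%:E * pot f x))).
    rewrite -(int_indic mA) -int_nnegZ; last 2 first.
    - exact: nneg_mfun_indic.
    - by rewrite lee_fin ltW.
    apply: le_int.
    - by apply: nneg_mfunZ; [rewrite lee_fin ltW|exact: nneg_mfun_indic].
    - by apply: nneg_mfunM; [exact: nneg_mfun_indic|exact: nneg_mfun_pot].
    move=> x; rewrite indicE; have [|_] := boolP (x \in A).
      by rewrite inE mule1 mul1e; exact: At.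
    by rewrite mule0 mul0e.
  rewrite (pot_sym mf (nneg_mfun_indic mA)).
  set c := _ + _; have c0 : 0 <= c.
    apply: adde_ge0; last by rewrite mule_ge0// lee_fin powR_ge0.
    by rewrite lee_fin mulr_ge0 ?powR_ge0// ltW// ball_const_gt0.
  apply: (@le_trans _ _ (\int[mu]_y (c * f y))).
    apply: le_int.
    - by apply: nneg_mfunM => //; apply/nneg_mfun_pot/nneg_mfun_indic.
    - exact: nneg_mfunZ.
    by move=> x; rewrite muleC lee_wpmul2r ?mf.2// pot_indic_le.
  by rewrite int_nnegZ// muleC lee_wpmul2r.
rewrite -(fineK fA) in h *.
rewrite raN -[X in _ <= _ * (_ + X)]EFinM -EFinD -!EFinM lee_fin in h.
rewrite lee_fin.
have -> : (N / (N - alpha) = (N - alpha)^-1 * N)%R by rewrite mulrC.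
rewrite powRrM -/r.
have rN : (r `^ N = r `^ alpha * (2 * M / t))%R.
  by rewrite -rNa -powRD ?subrKC//; apply/implyP => _; rewrite gt_eqF.
rewrite rN -(ler_pM2l t0).
have -> : (t * (ball_const * (r `^ alpha * (2 * M / t))) =
  2 * M * (ball_const * r `^ alpha))%R by field; rewrite gt_eqF.
have e : (M * (t / (2 * M) * fine (mu A)) = t * fine (mu A) / 2)%R.
  by field; rewrite gt_eqF.
by move: h; rewrite mulrDr e; lra.
Qed.

Lemma measurable_dist_ge x (r : R) : measurable [set y | (r <= dist x y)%R].
Proof.
rewrite -[X in measurable X]setTI.
have := measurable_distl x measurableT (measurable_itv `[r, +oo[).
by congr (measurable _); apply/seteqP; split => y /=; rewrite in_itv/= andbT.
Qed.

Lemma le_int_set (g : T -> \bar R) A B : nneg_mfun g -> measurable A ->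
  measurable B -> A `<=` B -> \int[mu]_(x in A) g x <= \int[mu]_(x in B) g x.
Proof.
move=> [mg g0] mA mB AB; apply: ge0_subset_integral => //.
exact: measurable_funTS.
Qed.

Lemma le_int_setT (g : T -> \bar R) A : nneg_mfun g -> measurable A ->
  \int[mu]_(x in A) g x <= \int[mu]_x g x.
Proof. by move=> mg mA; exact: le_int_set. Qed.

Lemma le_int_in (f g : T -> \bar R) A : measurable A -> nneg_mfun f ->
  nneg_mfun g -> (forall x, A x -> f x <= g x) ->
  \int[mu]_(x in A) f x <= \int[mu]_(x in A) g x.
Proof.
move=> mA [mf f0] [mg g0] fg.
by apply: ge0_le_integral => //; exact: measurable_funTS.
Qed.

Lemma int_nnegZ_in (k : \bar R) f A : measurable A -> nneg_mfun f -> 0 <= k ->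
  \int[mu]_(x in A) (k * f x) = k * \int[mu]_(x in A) f x.
Proof.
by move=> mA [mf f0] k0; rewrite ge0_integralZl//; exact: measurable_funTS.
Qed.

(** Monotone convergence along [i + 1 / (k + 1)]; it is applied where an infimum of distances need
    not be attained. *)
Lemma int_dist_gt (g : T -> \bar R) B x (i : R) (t : \bar R) :
  nneg_mfun g -> measurable B ->
  (forall e : R, (0 < e)%R ->
    \int[mu]_(y in B `&` [set y | (i + e <= dist x y)%R]) g y <= t) ->
  \int[mu]_(y in B `&` [set y | (i < dist x y)%R]) g y <= t.
Proof.
move=> mg mB H.
pose F (k : nat) := B `&` [set y | (i + k.+1%:R^-1 <= dist x y)%R].
have mF k : measurable (F k) by apply: measurableI => //; exact: measurable_dist_ge.
have -> : B `&` [set y | (i < dist x y)%R] = \bigcup_k F k.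
  apply/seteqP; split => [y [By /= iy]|y [k _ [By /= iky]]]; last first.
    by split => //=; apply: lt_le_trans iky; rewrite ltrDl invr_gt0.
  pose e := (dist x y - i)%R; have e0 : (0 < e)%R by rewrite subr_gt0.
  exists (Num.truncn e^-1) => //; split => //=.
  rewrite -lerBrDl -/e invf_ple ?posrE//.
  exact/ltW/truncnS_gt.
have ndF : nondecreasing_seq F.
  apply/nondecreasing_seqP => k; apply/subsetPset => y [By /= ky]; split => //=.
  by apply: le_trans ky; rewrite lerD2l lef_pV2 ?posrE// ler_nat.
have cF := ge0_nondecreasing_set_cvg_integral (mu := mu) ndF mF
  (fun k => measurable_funTS mg.1) (fun _ y _ => mg.2 y).
rewrite -(cvg_lim _ cF)//; apply: lime_le; first by apply/cvg_ex; eexists; exact: cF.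
by apply: nearW => k; apply: H; rewrite invr_gt0.
Qed.

Lemma dist0_null x : mu [set y | (dist x y <= 0)%R] = 0.
Proof.
apply/eqP; rewrite eq_le measure_ge0 andbT; apply/lee_addgt0Pr => e e0.
pose r : R := ((e / V) `^ N^-1)%R.
have N0 : (0 < N)%R by exact: lt_trans alphaN.
have r0 : (0 < r)%R by rewrite powR_gt0 ?divr_gt0.
apply: (@le_trans _ _ (mu [set y | (dist x y < r)%R])).
  apply: le_measure; rewrite ?inE//; last 2 first.
  - exact: measurable_ball_dist.
  - by move=> y /= /le_lt_trans; exact.
  rewrite -[X in measurable X]setCK; apply: measurableC.
  rewrite (_ : ~` _ = [set: T] `&` [set y | (0 < dist x y)%R]).
    rewrite (_ : [set y | _] = dist x @^-1` `]0%R, +oo[%classic).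
      by apply: measurable_distl => //; exact: measurable_itv.
    by apply/seteqP; split => y /=; rewrite in_itv/= andbT.
  rewrite setTI; apply/seteqP; split => y /=; first by move/negP; rewrite -ltNge.
  by rewrite ltNge => /negP.
apply: le_trans (mu_ball x r0) _.
rewrite add0e lee_fin -powRrM mulVf ?gt_eqF// powRr1; last exact/ltW/divr_gt0.
by rewrite mulrCA divff ?gt_eqF// mulr1.
Qed.

Lemma pot_far x y f (A : set T) : measurable A -> nneg_mfun f ->
  (forall z, A z -> (dist x z <= 2 * dist y z)%R) ->
  \int[mu]_(z in A) (kern y z * f z) <=
  (2 `^ (N - alpha))%:E * \int[mu]_(z in A) (kern x z * f z).
Proof.
move=> mA mf H; have mk z := nneg_mfunM (nneg_mfun_kern z) mf.
have c0 : 0 <= (2 `^ (N - alpha))%:E :> \bar R by rewrite lee_fin powR_ge0.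
rewrite -int_nnegZ_in//; apply: le_int_in => //; first exact: nneg_mfunZ.
move=> z Az /=; rewrite muleA lee_wpmul2r ?mf.2//.
by apply: kern_le => //; exact: H.
Qed.

(* A maximum principle: on [B = {pot f < c t}] the point of [B] closest to [x] sees
   the mass of [f] on [B] at most twice as far as [x] does. *)
Lemma pot_truncate f x (t : R) : nneg_mfun f -> (0 < t)%R ->
  pot (f \_ [set y | pot f y < (2 `^ (alpha - N) * t)%:E]) x <= t%:E.
Proof.
move=> mf t0; set B := [set y | _].
have mB : measurable B.
  rewrite -[X in measurable X]setTI.
  by apply: emeasurable_fun_infty_o => //; exact: measurable_pot.
have mk z := nneg_mfunM (nneg_mfun_kern z) mf.
rewrite pot_restrict.
have [->|/set0P[y0 By0]] := eqVneq B set0; first by rewrite integral_set0 lee_fin ltW.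
have far y : B y -> \int[mu]_(z in [set z | (dist x y <= dist x z)%R])
    (kern x z * f z) <= t%:E.
  move=> By; have mA := measurable_dist_ge x (dist x y).
  apply: le_trans (pot_far (x := y) mA mf _) _.
    move=> z /= xyz; apply: (le_trans (dist_triangle y x z)).
    by rewrite (distC y) mulrDl mul1r lerD2r.
  apply: (@le_trans _ _ ((2 `^ (N - alpha))%:E * pot f y)).
    by rewrite lee_wpmul2l ?lee_fin ?powR_ge0//; exact: le_int_setT.
  apply: (@le_trans _ _ ((2 `^ (N - alpha))%:E * (2 `^ (alpha - N) * t)%:E)).
    by apply: lee_wpmul2l; [rewrite lee_fin powR_ge0|exact: ltW].
  by rewrite -EFinM lee_fin mulrA -powR2D subrKA subrr powRr0 mul1r.
pose S := [set dist x y | y in B].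
have S0 : S !=set0 by exists (dist x y0), y0.
have lbS : has_inf S by split => //; exists 0%R => _ [y _ <-]; exact: dist_ge0.
have [[y By iy]|Si] := pselect (S (inf S)).
  apply: le_trans (far y By); apply: le_int_set => //.
    exact: measurable_dist_ge.
  by move=> z Bz /=; rewrite iy; apply: (ge_inf lbS.2); exists z.
(* The infimum is not attained, so every point of [B] lies strictly farther, and near-minimisers
   control the points at distance at least [inf S + e]. *)
have -> : B = B `&` [set y | (inf S < dist x y)%R].
  apply/seteqP; split => [y By|y []//]; split => //=.
  rewrite lt_neqAle (ge_inf lbS.2 (_ : S (dist x y))) ?andbT//; last by exists y.
  by apply/negP => /eqP iy; apply: Si; exists y.
apply: int_dist_gt => // e e0.
have [_ [y By <-] yi] := inf_adherent e0 lbS.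
apply: le_trans (far y By); apply: le_int_set => //.
- by apply: measurableI => //; exact: measurable_dist_ge.
- exact: measurable_dist_ge.
- by move=> z [_ /=]; apply: le_trans; exact: ltW.
Qed.

(** * The weak A_1 property of potentials *)

Lemma int_restrict_near f x (r : R) : nneg_mfun f -> (0 < r)%R ->
  \int[mu]_y (f \_ [set y | (dist x y < r)%R]) y <=
  (r `^ (N - alpha))%:E * pot f x.
Proof.
move=> mf r0; have mB := measurable_ball_dist x r.
rewrite -integral_mkcond.
have c0 : 0 <= (r `^ (N - alpha))%:E :> \bar R by rewrite lee_fin powR_ge0.
have mk := nneg_mfunM (nneg_mfun_kern x) mf.
rewrite -int_nnegZ//; apply: le_trans (le_int_setT _ mB); last exact: nneg_mfunZ.
apply: le_int_in => //; first exact: nneg_mfunZ.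
move=> y /= /ltW xy; rewrite muleA -[leLHS]mul1e lee_wpmul2r ?mf.2//.
apply: (@le_trans _ _ ((r `^ (N - alpha))%:E * (r `^ (alpha - N))%:E)).
  by rewrite -EFinM lee_fin -opprB powRN mulVf ?gt_eqF ?powR_gt0.
by apply: lee_wpmul2l => //; exact: radius_le_kern.
Qed.

Lemma pot_splitU f A x : measurable A -> nneg_mfun f ->
  pot f x = pot (f \_ A) x + pot (f \_ (~` A)) x.
Proof.
move=> mA mf; rewrite -potD; [|exact: nneg_mfun_restrict|].
  by congr pot; apply/funext => y; rewrite !patchE in_setC; case: ifPn => _;
    rewrite ?adde0 ?add0e.
by apply: nneg_mfun_restrict => //; exact: measurableC.
Qed.

(** The mass of [h] outside the ball of radius [2 * rho] contributes at most
    [2^(N - alpha) l <= a / 2] to the potential on [A]. The mass inside is at most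
    [(2 rho)^(N - alpha) l] because [pot h x0 <= l], and [weak_pot] applies to it at height
    [a / 2]. *)
Lemma weak_A1 h x0 A (l a rho : R) : nneg_mfun h -> measurable A -> mu A < +oo ->
  (0 < l)%R -> (0 < rho)%R -> (2 * 2 `^ (N - alpha) * l <= a)%R ->
  pot h x0 <= l%:E -> (forall z, A z -> (dist x0 z <= rho)%R) ->
  (forall z, A z -> a%:E <= pot h z) ->
  mu A <= (ball_const * (4 * l / a) `^ (N / (N - alpha)) * (2 * rho) `^ N)%:E.
Proof.
move=> mh mA Afin l0 rho0 la Wl Arho Aa.
have a0 : (0 < a)%R.
  by apply: lt_le_trans la; rewrite !mulr_gt0 ?powR_gt0.
pose B := [set y | (dist x0 y < 2 * rho)%R].
have mB : measurable B by exact: measurable_ball_dist.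
have r20 : (0 < 2 * rho)%R by rewrite mulr_gt0.
have mhB := nneg_mfun_restrict mB mh.
pose M : R := ((2 * rho) `^ (N - alpha) * l)%R.
have M0 : (0 < M)%R by rewrite mulr_gt0 ?powR_gt0.
have hM : \int[mu]_y (h \_ B) y <= M%:E.
  apply: (le_trans (int_restrict_near x0 mh r20)).
  by rewrite EFinM; apply: lee_wpmul2l => //; rewrite lee_fin powR_ge0.
have half z : A z -> (a / 2)%:E <= pot (h \_ B) z.
  move=> Az; have := Aa _ Az; rewrite (pot_splitU z mB mh).
  have far : pot (h \_ (~` B)) z <= (a / 2)%:E.
    rewrite pot_restrict.
    apply: le_trans (pot_far (x := x0) (measurableC mB) mh _) _.
      move=> y /= /negP; rewrite -leNgt => h1.
      have := dist_triangle x0 z y; have := Arho _ Az; lra.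
    apply: (@le_trans _ _ ((2 `^ (N - alpha))%:E * l%:E)); last first.
      by rewrite -EFinM lee_fin ler_pdivlMr//; lra.
    apply: lee_wpmul2l; first by rewrite lee_fin powR_ge0.
    apply: le_trans Wl; apply: le_int_setT; last exact: measurableC.
    exact: nneg_mfunM (nneg_mfun_kern x0) mh.
  move=> h2; have := le_trans h2 (leeD (lexx _) far).
  rewrite -leeBlDr// -EFinB; congr (_%:E <= _); lra.
apply: le_trans (weak_pot mhB mA Afin M0 _ hM half) _; first exact: divr_gt0.
rewrite lee_fin -[leRHS]mulrA ler_pM2l ?ball_const_gt0//.
have -> : (2 * M / (a / 2) = (2 * rho) `^ (N - alpha) * (4 * l / a))%R.
  by rewrite /M; field; rewrite gt_eqF.
rewrite powRM ?powR_ge0 ?divr_ge0 ?mulr_ge0 ?(ltW a0) ?(ltW l0)// mulrC.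
by rewrite -powRrM mulrCA divff ?mulr1// gt_eqF.
Qed.

(** If points of [{pot h <= l}] came arbitrarily close to [y], comparing kernels away from [y] would
    give [pot h y <= 2^(N - alpha) l]. The positive distance ensures that such a [y] lies in a
    Whitney cell of the complement of that set. *)
Lemma pot_gap h y (l a : R) : nneg_mfun h -> (0 <= l)%R ->
  (2 `^ (N - alpha) * l < a)%R -> a%:E <= pot h y ->
  exists2 e : R, (0 < e)%R & forall x, pot h x <= l%:E -> (e <= dist x y)%R.
Proof.
move=> mh l0 la ay; apply: contrapT => H.
suff : pot h y <= (2 `^ (N - alpha) * l)%:E.
  by move=> /(le_trans ay); rewrite lee_fin leNgt la.
have mk := nneg_mfunM (nneg_mfun_kern y) mh.
have mD : measurable [set z | (dist y z <= 0)%R].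
  rewrite (_ : [set z | _] = ~` [set z | (0 < dist y z)%R]); last first.
    by apply/seteqP; split => z /=; rewrite leNgt => /negP.
  apply: measurableC; rewrite (_ : [set y | _] = [set: T] `&` dist y @^-1` `]0%R, +oo[%classic).
    by apply: measurable_distl => //; exact: measurable_itv.
  by apply/seteqP; split => z /=; rewrite in_itv/= andbT//; case.
rewrite /pot (ge0_negligible_integral mD measurableT mk.1 _ (dist0_null y))//; last first.
  by move=> z _; exact: mk.2.
rewrite (_ : _ `\` _ = setT `&` [set z | (0 < dist y z)%R]); last first.
  by apply/seteqP; split => z /= [_] //; rewrite ltNge => /negP.
apply: int_dist_gt => // e e0; rewrite setTI add0r.
have [x [Wx xe]] : exists x, pot h x <= l%:E /\ ~ (e <= dist x y)%R.
  apply: contrapT => G; apply: H; exists e => // x Wx; apply: contrapT => xe.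
  by apply: G; exists x.
move/negP: xe; rewrite -ltNge => xe; have mE := measurable_dist_ge y e.
apply: le_trans (pot_far (x := x) mE mh _) _.
  by move=> z /= ez; have := dist_triangle x y z; lra.
rewrite EFinM; apply: lee_wpmul2l; first by rewrite lee_fin powR_ge0.
apply: le_trans Wx; apply: le_int_setT mE.
exact: nneg_mfunM (nneg_mfun_kern x) mh.
Qed.

Context {I : countType} (cell : int -> T -> I) (L : R) (L0 : (0 < L)%R)
  (mcell : forall j c, measurable (cell j @^-1` [set c]))
  (mu_cell : forall j x,
    mu (cell j @^-1` [set cell j x]) = ((2 `^ (- j%:~R)) `^ N)%:E)
  (cell_dist : forall j x y, cell j x = cell j y ->
    (dist x y < L * 2 `^ (- j%:~R))%R)
  (cell_nested : forall j x y, cell j x = cell j y ->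
    cell (j - 1)%R x = cell (j - 1)%R y).

(** * Whitney decomposition of the complement of a set *)

Section whitney.
Context (D : set T).

(** [L * 2^(- j)] bounds the diameter of a cell of scale [j]: a far cell is at least as far from [D]
    as that bound. *)
Definition far_cell (j : int) y :=
  forall x z, D x -> cell j z = cell j y -> (L * 2 `^ (- j%:~R) <= dist x z)%R.

(** Larger [j] means smaller cells, so a selected cell is a maximal far cell. *)
Definition selected j y := far_cell j y /\ ~ far_cell (j - 1)%R y.

(** Pairs of a scale and a cell index are coded by integers, so that the family can be summed over
    [nat]; a code of no selected cell gives the empty set. *)
Definition whitney (k : nat) : set T :=
  if pickle_inv k is Some p then [set y | cell p.1 y = p.2 /\ selected p.1 y]
  else set0.

Lemma far_cell_eq j y y' : cell j y = cell j y' -> far_cell j y -> far_cell j y'.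
Proof. by move=> yy' Fy x z Dx zy'; apply: Fy => //; rewrite zy'. Qed.

Lemma far_cellS j y : far_cell (j - 1)%R y -> far_cell j y.
Proof.
move=> Fy x z Dx zy; apply: le_trans (Fy x z Dx (cell_nested zy)).
rewrite ler_pM2l//; apply: ler_powR; first by rewrite ler1n.
by rewrite lerN2 ler_int gerBl.
Qed.

Lemma far_cell_le j (k : nat) y : far_cell (j - k%:Z)%R y -> far_cell j y.
Proof.
elim: k => [|k IH]; first by rewrite subr0.
by rewrite -addn1 PoszD opprD addrA => /far_cellS.
Qed.

Lemma selected_eq j y y' : cell j y = cell j y' -> selected j y -> selected j y'.
Proof.
move=> yy' [Fy Fy1]; split; first exact: far_cell_eq Fy.
by move=> Fy'; apply: Fy1; apply: far_cell_eq Fy'; exact/esym/cell_nested.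
Qed.

(** For [j < j'], a far cell of scale [j] makes its subcell of scale [j' - 1] far too, against the
    maximality at [j']. *)
Lemma selected_inj j j' y : selected j y -> selected j' y -> j = j'.
Proof.
wlog jj' : j j' / (j <= j')%R.
  by have [jj' H|/ltW jj' H h1 h2] := leP j j'; [exact: H|exact/esym/H].
move=> [Fj _] [_ Fj']; apply: contrapT => /eqP nj; apply: Fj'.
have lt : (j < j')%R by rewrite lt_neqAle nj.
have [k kE] : exists k : nat, (j' - 1 - j = k%:Z)%R.
  by exists `|(j' - 1 - j)%R|%N; rewrite gez0_abs// subr_ge0 -ltzD1 subrK.
by apply: (@far_cell_le _ k); rewrite -kE opprB addrC subrK.
Qed.

Lemma whitneyP k y : whitney k y ->
  exists j, whitney k = cell j @^-1` [set cell j y] /\ selected j y.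
Proof.
rewrite /whitney; case: (pickle_inv k) => [[j c]|]//= -[<- sel].
exists j; split => //; apply/seteqP; split => z /=; first by case.
by move=> zy; split => //; apply: selected_eq sel; exact: esym.
Qed.

Lemma measurable_whitney k : measurable (whitney k).
Proof.
have [->//|/set0P[y wy]] := eqVneq (whitney k) set0.
by have [j [-> _]] := whitneyP wy; exact: mcell.
Qed.

Lemma trivIset_whitney : trivIset setT whitney.
Proof.
apply/trivIsetP => k k' _ _; apply: contraNeq => /set0P[y []].
rewrite /whitney; case E : (pickle_inv k) => [[j c]|]//= -[jc sel].
case E' : (pickle_inv k') => [[j' c']|]//= -[jc' sel'].
have jj' := selected_inj sel sel'; subst j'.
have pickleE m (p : (int * I)%type) : pickle_inv m = Some p -> pickle p = m.
  by move=> mp; have := @pickle_invK (int * I)%type m; rewrite mp.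
by rewrite -(pickleE _ _ E) -(pickleE _ _ E') -jc -jc' eqxx.
Qed.

(** The diameter of a Whitney cell is at most its distance to [D]. Hence, for [x] in [D], [kern x]
    is constant on the cell up to a fixed factor. *)
Lemma whitney_dist k x z z' : D x -> whitney k z -> whitney k z' ->
  (dist x z <= 2 * dist x z')%R.
Proof.
move=> Dx wz wz'; have [j [wE [Fz _]]] := whitneyP wz.
have zz' : cell j z' = cell j z by move: wz'; rewrite wE.
have := Fz x z' Dx zz'; have := cell_dist zz'; have := dist_triangle x z' z; lra.
Qed.

(** The parent cell is not far: some point of [D] is within [2 L 2^(- j)] of it, and its own
    diameter is at most [2 L 2^(- j)]. *)
Lemma whitney_near k y : whitney k y -> exists x0 j, [/\ D x0,
  mu (whitney k) = ((2 `^ (- j%:~R)) `^ N)%:E &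
  forall z, whitney k z -> (dist x0 z <= 4 * L * 2 `^ (- j%:~R))%R].
Proof.
move=> wy; have [j [wE [_ Fy]]] := whitneyP wy.
have [x0 [z0 [Dx0 zy xz]]] : exists x z, [/\ D x, cell (j - 1)%R z = cell (j - 1)%R y &
    ~ (L * 2 `^ (- (j - 1)%:~R) <= dist x z)%R].
  apply: contrapT => H; apply: Fy => x z Dx zy; apply: contrapT => G.
  by apply: H; exists x, z.
exists x0, j; split => //; first by rewrite wE mu_cell.
move=> z; rewrite wE => /= zy'.
have e2 : (2 `^ (- (j - 1)%:~R) = 2 * 2 `^ (- j%:~R) :> R)%R.
  by rewrite -[X in (X * _)%R](@powRr1 R 2)// -powR2D intrB opprB.
have c := cell_dist (etrans zy (esym (cell_nested zy'))).
move/negP: xz; rewrite -ltNge e2 => xz; rewrite e2 in c.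
have := dist_triangle x0 z0 z; lra.
Qed.

(** Cells around [y] of size well below [e] are far, while huge ones are not since [D] is nonempty;
    the coarsest far scale is selected. *)
Lemma whitney_cover y (e : R) : D !=set0 -> (0 < e)%R ->
  (forall x, D x -> (e <= dist x y)%R) -> (\bigcup_k whitney k) y.
Proof.
move=> [x0 Dx0] e0 ey.
have [j1 F1] : exists j, far_cell j y.
  have [|m /andP[m1 _]] := @dyadic_bracket _ (e / (2 * L))%R.
    by rewrite divr_gt0// mulr_gt0.
  exists (- m)%R => x z Dx zy; rewrite mulrNz opprK.
  rewrite ler_pdivlMr ?mulr_gt0// in m1.
  have := cell_dist zy; rewrite mulrNz opprK.
  have := ey x Dx; have := dist_triangle x z y; lra.
have [j0 F0] : exists j, ~ far_cell j y.
  have [|m /andP[_ m1]] := @dyadic_bracket _ ((dist x0 y + 1) / L)%R.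
    by rewrite divr_gt0// ltr_wpDl ?dist_ge0.
  exists (- (m + 1))%R => /(_ x0 y Dx0 erefl); rewrite mulrNz opprK.
  rewrite ltr_pdivrMr// in m1; lra.
have j01 : (j0 < j1)%R.
  rewrite ltNge; apply/negP => j10; apply: F0.
  apply: (@far_cell_le _ `|(j0 - j1)%R|%N).
  by rewrite gez0_abs ?subr_ge0// opprB addrC subrK.
have ex : exists k : nat, `[< far_cell (j0 + k%:Z)%R y >].
  exists `|(j1 - j0)%R|%N; apply/asboolP.
  by rewrite gez0_abs ?subr_ge0 1?ltW// addrC subrK.
have [k /asboolP Fk kmin] := ex_minnP ex.
have k0 : (0 < k)%N by case: k Fk {kmin} => //; rewrite addr0.
have sel : selected (j0 + k%:Z)%R y.
  split => // Fk1; have := kmin k.-1; rewrite leqNgt prednK// leqnn => /(_ _)/negP.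
  case; last by []; apply/asboolP; move: Fk1; rewrite -[in X in X -> _](prednK k0).
  by rewrite -addn1 PoszD addrA addrK.
exists (pickle ((j0 + k%:Z)%R, cell (j0 + k%:Z)%R y)); first exact: Logic.I.
by rewrite /whitney pickleK_inv; split.
Qed.

End whitney.

(** * Balayage onto Whitney cells *)

Definition wcoef D (g : T -> \bar R) k : \bar R :=
  ((fine (mu (whitney D k)))^-1)%:E * \int[mu]_(y in whitney D k) g y.

(* The balayage of [g] onto the Whitney cells of the complement of [D]. *)
Definition sweep D (g : T -> \bar R) z : \bar R :=
  \sum_(k <oo) (wcoef D g k * (\1_(whitney D k) z)%:E).

Lemma wcoef_ge0 D g k : nneg_mfun g -> 0 <= wcoef D g k.
Proof.
move=> [mg g0]; rewrite mule_ge0 ?lee_fin ?invr_ge0 ?fine_ge0//.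
exact: integral_ge0.
Qed.

Lemma nneg_mfun_sweep D g : nneg_mfun g -> nneg_mfun (sweep D g).
Proof.
move=> mg; have t0 k z : 0 <= wcoef D g k * (\1_(whitney D k) z)%:E.
  by rewrite mule_ge0 ?wcoef_ge0 ?lee_fin.
split; last by move=> z; exact: nneseries_ge0.
apply: ge0_emeasurable_sum => k // _; apply: emeasurable_funM => //.
apply/measurable_EFinP; apply: measurable_indic; exact: measurable_whitney.
Qed.

Lemma sweepE D g k z : nneg_mfun g -> whitney D k z -> sweep D g z = wcoef D g k.
Proof.
move=> mg wz; rewrite /sweep (@nneseriesD1 _ _ k)//; last first.
  by move=> i _; rewrite mule_ge0 ?wcoef_ge0 ?lee_fin.
rewrite indicE mem_set// mule1 eseries0 ?adde0// => i _ /= ik.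
rewrite indicE memNset ?mule0// => wz'; move/negP: ik; apply.
by apply/eqP; apply: (@trivIset_whitney D) => //; exists z.
Qed.

Lemma sweep_out D g z : ~ (\bigcup_k whitney D k) z -> sweep D g z = 0.
Proof.
move=> nz; rewrite /sweep eseries0// => i _ _.
by rewrite indicE memNset ?mule0// => wz; apply: nz; exists i.
Qed.

Lemma le_int_whitney D (F G : T -> \bar R) (c : R) : nneg_mfun F -> nneg_mfun G ->
  (0 <= c)%R -> (forall z, ~ (\bigcup_k whitney D k) z -> F z = 0) ->
  (forall k, \int[mu]_(z in whitney D k) F z <= c%:E * \int[mu]_(z in whitney D k) G z) ->
  \int[mu]_z F z <= c%:E * \int[mu]_z G z.
Proof.
move=> mF mG c0 F0 FG.
have mw k := @measurable_whitney D k; have tw := @trivIset_whitney D.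
have mU : measurable (\bigcup_k whitney D k) by exact: bigcupT_measurable.
rewrite (_ : \int[mu]_z F z = \int[mu]_(z in \bigcup_k whitney D k) F z); last first.
  rewrite [RHS]integral_mkcond; apply: eq_integral => z _; rewrite patchE.
  by case: ifPn => //; rewrite notin_setE => /F0.
rewrite ge0_integral_bigcup//; last 2 first.
- exact: measurable_funTS mF.1.
- by move=> z _; exact: mF.2.
apply: (@le_trans _ _ (\sum_(k <oo) (c%:E * \int[mu]_(z in whitney D k) G z))).
  apply: lee_nneseries => [k _ _|k _]; last exact: FG.
  by apply: integral_ge0 => z _; exact: mF.2.
rewrite nneseriesZl; last by move=> k _; apply: integral_ge0 => z _; exact: mG.2.
apply: lee_wpmul2l; first by rewrite lee_fin.
rewrite -ge0_integral_bigcup//; last 2 first.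
- exact: measurable_funTS mG.1.
- by move=> z _; exact: mG.2.
exact: le_int_setT.
Qed.

Lemma wcoefE D g k : nneg_mfun g ->
  mu (whitney D k) * wcoef D g k = \int[mu]_(y in whitney D k) g y.
Proof.
move=> mg; have [w0|/set0P[y wy]] := eqVneq (whitney D k) set0.
  by rewrite w0 measure0 integral_set0 mul0e.
rewrite /wcoef; have [x0 [j [_ -> _]]] := whitney_near wy.
rewrite muleA -EFinM mulfV ?mul1e//= gt_eqF// powR_gt0// powR_gt0//.
Qed.

(** Freezing [kern x] at one point of each cell costs the factor [2^(N - alpha)], and unfreezing it
    after averaging costs the same factor again. *)
Lemma pot_sweep D g x : nneg_mfun g -> D x ->
  (forall z, ~ (\bigcup_k whitney D k) z -> g z = 0) ->
  pot g x <= ((2 `^ (N - alpha)) `^ 2)%:E * pot (sweep D g) x.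
Proof.
move=> mg Dx g0; set c := (2 `^ (N - alpha))%R.
have c0 : (0 < c)%R by rewrite powR_gt0.
have mS := nneg_mfun_sweep D mg; have mk := nneg_mfun_kern x.
apply: (le_int_whitney (D := D)).
- exact: nneg_mfunM.
- exact: nneg_mfunM.
- by rewrite powR_ge0.
- by move=> z /g0 ->; rewrite mule0.
move=> k; have mw := @measurable_whitney D k.
have [->|/set0P[z0 wz0]] := eqVneq (whitney D k) set0.
  by rewrite !integral_set0 mule0.
have kc z z' : whitney D k z -> whitney D k z' -> kern x z <= c%:E * kern x z'.
  by move=> wz wz'; apply: kern_le => //; exact: whitney_dist wz' wz.
apply: (@le_trans _ _ ((c%:E * kern x z0) * \int[mu]_(z in whitney D k) g z)).
  rewrite -int_nnegZ_in// ?mule_ge0 ?kern_ge0 ?lee_fin ?(ltW c0)//.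
  apply: le_int_in => //; first exact: nneg_mfunM.
    by apply: nneg_mfunZ => //; rewrite mule_ge0 ?kern_ge0// lee_fin ltW.
  by move=> z wz; rewrite lee_wpmul2r ?mg.2//; exact: kc.
rewrite -wcoefE// (powR_mulrn 2) ?(ltW c0)// expr2 EFinM -!muleA.
apply: lee_wpmul2l; first by rewrite lee_fin ltW.
rewrite (_ : \int[mu]_(z in _) _ = wcoef D g k * \int[mu]_(z in whitney D k) kern x z); last first.
  rewrite -int_nnegZ_in ?wcoef_ge0//; apply: eq_integral => z; rewrite inE => wz.
  by rewrite (sweepE _ wz)// muleC.
rewrite [leRHS]muleCA [leLHS]muleA [leLHS]muleC; apply: lee_wpmul2l; first exact: wcoef_ge0.
rewrite -(integral_cst mu mw) -int_nnegZ_in// ?lee_fin ?(ltW c0)//.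
apply: le_int_in => //.
- by split => // z; exact: kern_ge0.
- by apply: nneg_mfunZ => //; rewrite lee_fin ltW.
- by move=> z wz /=; exact: kc.
Qed.

(** The decay exponent [N / (N - alpha)] of [weak_A1] times the power [s - 1] that Hoelder's
    inequality puts on the measure of a support. *)
Definition sweep_exp (s : R) := (N / (N - alpha) * (s - 1))%R.

(** The constant of [weak_A1] at the radius [rho = 4 L 2^(- j)] of [whitney_near], relative to the
    measure of the cell. *)
Definition sweep_base : R :=
  (ball_const * 4 `^ (N / (N - alpha)) * (8 * L) `^ N)%R.

Lemma sweep_base_gt0 : (0 < sweep_base)%R.
Proof. rewrite /sweep_base; apply: mulr_gt0; last by rewrite powR_gt0// mulr_gt0.
by apply: mulr_gt0; [exact: ball_const_gt0|exact: powR_gt0]. Qed.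

(** On a cell of measure [v] the sweep is constant and the integral of its power is
    [v^(1 - s) (\int g)^s]. As [g] lives on [{pot h >= a}], whose share of the cell is small by
    [weak_A1], [weighted_jensen] gains the power [s - 1] of that share, and the powers of [v]
    cancel. *)
Lemma int_sweep h g (l a s : R) : nneg_mfun h -> nneg_mfun g -> (0 < l)%R ->
  (1 < s)%R -> (2 * 2 `^ (N - alpha) * l <= a)%R ->
  (forall y, g y != 0 -> a%:E <= pot h y) ->
  \int[mu]_z (sweep [set x | pot h x <= l%:E] g z `^ s) <=
  (2 `^ s * sweep_base `^ (s - 1) * (l / a) `^ (sweep_exp s))%:E *
    \int[mu]_z (g z `^ s).
Proof.
move=> mh mg l0 s1 la ga; set D := [set x | _].
have s0 : (0 < s)%R by exact: lt_trans s1.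
have a0 : (0 < a)%R by apply: lt_le_trans la; rewrite !mulr_gt0 ?powR_gt0.
have mS := nneg_mfun_sweep D mg.
have la0 : (0 < l / a)%R by rewrite divr_gt0.
apply: (le_int_whitney (D := D)).
- exact: nneg_mfun_poweR.
- exact: nneg_mfun_poweR.
- by rewrite !mulr_ge0 ?powR_ge0.
- by move=> z /sweep_out ->; rewrite poweR0r ?gt_eqF.
move=> k; have mw := @measurable_whitney D k.
have [->|/set0P[z0 wz0]] := eqVneq (whitney D k) set0.
  by rewrite !integral_set0 mule0.
have [x0 [j [Dx0 muw wx0]]] := whitney_near wz0.
set v : R := ((2 `^ (- j%:~R)) `^ N)%R in muw.
have v0 : (0 < v)%R by rewrite powR_gt0// powR_gt0.
pose A := [set y | a%:E <= pot h y].
have mA : measurable A.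
  rewrite -[X in measurable X]setTI.
  by apply: emeasurable_fun_c_infty => //; exact: measurable_pot.
pose m : R := (sweep_base * (l / a) `^ (N / (N - alpha)) * v)%R.
have m0 : (0 < m)%R.
  apply: mulr_gt0 => //; apply: mulr_gt0; first exact: sweep_base_gt0.
  exact: powR_gt0.
have mAw : mu (A `&` whitney D k) <= m%:E.
  have rho0 : (0 < 4 * L * 2 `^ (- j%:~R))%R by rewrite !mulr_gt0 ?powR_gt0.
  apply: le_trans (weak_A1 (x0 := x0) (rho := (4 * L * 2 `^ (- j%:~R))%R) mh _ _ l0 rho0 la Dx0 _ _) _.
  - exact: measurableI.
  - apply: (@le_lt_trans _ _ (mu (whitney D k))).
      by apply: le_measure; rewrite ?inE//; exact: measurableI.
    by rewrite muw ltry.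
  - by move=> z [_ wz]; exact: wx0.
  - by move=> z [].
  rewrite lee_fin /m /sweep_base /v.
  have -> : (4 * l / a = 4 * (l / a))%R by rewrite mulrA.
  have -> : (2 * (4 * L * 2 `^ (- j%:~R)) = 8 * L * 2 `^ (- j%:~R))%R by ring.
  rewrite (powRM _ _ (ltW la0))// (@powRM _ (8 * L)) ?mulr_ge0 ?powR_ge0 ?(ltW L0)//.
  by rewrite le_eqVlt; apply/orP; left; apply/eqP; ring.
have J := @weighted_jensen _ _ _ mu (whitney D k) (EFin \o \1_A) g m s mw
  (measurable_funTS (nneg_mfun_indic mA).1) (measurable_funTS mg.1)
  (fun x _ => (nneg_mfun_indic mA).2 x) (fun x _ => mg.2 x) m0 (ltW s1).
rewrite integral_indic// in J; have {}J := J mAw.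
have e1 : \int[mu]_(y in whitney D k) g y =
    \int[mu]_(x in whitney D k) ((EFin \o \1_A) x * g x).
  apply: eq_integral => y _ /=; rewrite indicE.
  have [yA|] := boolP (y \in A); first by rewrite mul1e.
  rewrite notin_setE mul0e => yA; apply: contrapT => /eqP gy; exact/yA/ga.
have e2 : \int[mu]_(x in whitney D k) ((EFin \o \1_A) x * g x `^ s) =
    \int[mu]_(y in whitney D k) (g y `^ s).
  apply: eq_integral => y _ /=; rewrite indicE.
  have [yA|] := boolP (y \in A); first by rewrite mul1e.
  rewrite notin_setE mul0e => yA.
  suff -> : g y = 0 by rewrite poweR0r ?gt_eqF.
  by apply: contrapT => /eqP gy; exact/yA/ga.
rewrite -e1 e2 in J.
rewrite (_ : \int[mu]_(z in whitney D k) _ = (v `^ (1 - s))%:E *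
    (\int[mu]_(y in whitney D k) g y) `^ s); last first.
  rewrite (eq_integral (cst (wcoef D g k `^ s))); last first.
    by move=> z; rewrite inE => wz; rewrite (sweepE _ wz).
  rewrite integral_cst// [X in _ * X = _]muw -(wcoefE D k mg) muw.
  rewrite (@poweRM _ v%:E) ?wcoef_ge0 ?lee_fin ?(ltW v0)//.
  rewrite muleA [RHS]muleC poweR_EFin; congr (_ * _).
  have v1s : (v `^ (1 - s) * v `^ s = v)%R.
    by rewrite -powRD ?subrK ?powRr1 ?(ltW v0)// oner_eq0.
  by rewrite -EFinM v1s.
apply: (@le_trans _ _ ((v `^ (1 - s))%:E * ((2 `^ s * m `^ (s - 1))%:E *
    \int[mu]_(y in whitney D k) (g y `^ s)))).
  by apply: lee_wpmul2l; rewrite ?lee_fin ?powR_ge0.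
rewrite muleA -EFinM lee_wpmul2r//.
  by apply: integral_ge0 => y _; exact: poweR_ge0.
have vs : (v `^ (1 - s) * v `^ (s - 1) = 1)%R.
  exact: powR_subC.
rewrite lee_fin /m /sweep_exp (powRrM _ (N / (N - alpha)) (s - 1)).
move: (sweep_base) sweep_base_gt0 ((l / a) `^ _)%R (powR_ge0 (l / a) (N / (N - alpha))).
move=> b b0 c c0; rewrite (@powRM _ (b * c)) ?mulr_ge0 ?(ltW b0) ?(ltW v0)//.
rewrite (@powRM _ b) ?(ltW b0)//.
rewrite [leLHS](_ : _ = 2 `^ s * (b `^ (s - 1) * c `^ (s - 1)) *
   (v `^ (1 - s) * v `^ (s - 1)))%R; last by ring.
by rewrite vs mulr1 mulrA.
Qed.

(** * Capacity *)

Section capacity.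
Context (s : R) (s1 : (1 < s)%R).

Let s0 : (0 < s)%R. Proof. exact: lt_trans s1. Qed.

Definition capI (E : set T) : \bar R :=
  ereal_inf [set \int[mu]_x (F x `^ s) | F in
    [set F | nneg_mfun F /\ forall x, E x -> 1 <= pot F x]].

Lemma capI_ge0 E : 0 <= capI E.
Proof.
by apply: le_ereal_inf_tmp => _ [F _ <-]; apply: integral_ge0 => x _; exact: poweR_ge0.
Qed.

Lemma le_capI E E' : E `<=` E' -> capI E <= capI E'.
Proof.
move=> EE'; apply: ereal_inf_le_tmp => _ [F [mF F1] <-]; exists F => //; split => //.
by move=> x /EE'; exact: F1.
Qed.

Lemma capI_le E g (t : R) : nneg_mfun g -> (0 < t)%R ->
  (forall x, E x -> t%:E <= pot g x) ->
  capI E <= (t `^ (- s))%:E * \int[mu]_x (g x `^ s).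
Proof.
move=> mg t0 Eg; have t'0 : (0 <= t^-1)%R by rewrite invr_ge0 ltW.
apply: ereal_inf_lbound; exists (fun x => (t^-1)%:E * g x).
  split; first by apply: nneg_mfunZ => //; rewrite lee_fin.
  move=> x Ex; rewrite potZ//.
  apply: (@le_trans _ _ ((t^-1)%:E * t%:E)); last first.
    by apply: lee_wpmul2l; rewrite ?lee_fin//; exact: Eg.
  by rewrite -EFinM mulVf ?gt_eqF.
rewrite -int_nnegZ ?lee_fin ?powR_ge0//; last exact: nneg_mfun_poweR.
apply: eq_integral => x _; rewrite poweRM ?lee_fin ?mg.2// poweR_EFin.
by congr (_%:E * _); rewrite -powR_inv1 ?(ltW t0)// -powRrM mulN1r.
Qed.

Lemma capI_approx E (e : R) : (0 < e)%R -> capI E < +oo ->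
  exists F, [/\ nneg_mfun F, (forall x, E x -> 1 <= pot F x) &
    \int[mu]_x (F x `^ s) <= capI E + e%:E].
Proof.
move=> e0 Eoo.
have fE : capI E \is a fin_num by rewrite ge0_fin_numE ?capI_ge0.
have [_ [F [mF F1] <-] FE] := lb_ereal_inf_adherent e0 fE.
by exists F; split => //; exact: ltW.
Qed.

(** The function [(sum_k F_k^s)^(1/s)] dominates every near-optimal [F_k], and the integral of its
    power [s] is the sum of theirs. *)
Lemma capI_sigma_subadditive (E : nat -> set T) :
  capI (\bigcup_k E k) <= \sum_(k <oo) capI (E k).
Proof.
have [->|] := eqVneq (\sum_(k <oo) capI (E k)) +oo; first by rewrite leey.
rewrite -ltey => Eoo.
have Ekoo k : capI (E k) < +oo.
  apply: le_lt_trans Eoo; apply: (@le_nneseries_term _ (capI \o E)) => i.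
  exact: capI_ge0.
apply/lee_addgt0Pr => e e0.
have /choice[F HF] k : exists F, [/\ nneg_mfun F, (forall x, E k x -> 1 <= pot F x) &
    \int[mu]_x (F x `^ s) <= capI (E k) + (e / (2 ^ k.+1)%:R)%:E].
  by apply: capI_approx => //; rewrite divr_gt0// ltr0n expn_gt0.
have mF k : nneg_mfun (F k) by case: (HF k).
have mFs k := nneg_mfun_poweR s (mF k).
pose G x := (\sum_(k <oo) F k x `^ s) `^ s^-1.
have S0 x : 0 <= \sum_(k <oo) F k x `^ s by apply: nneseries_ge0 => k _ _; exact: (mFs k).2.
have mG : nneg_mfun G.
  apply: nneg_mfun_poweR; split => //.
  by apply: ge0_emeasurable_sum => k *; [exact: (mFs k).2|exact: (mFs k).1].
have FG k x : F k x <= G x.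
  rewrite -[F k x](poweRK (r := s)) ?(gt_eqF s0)//; last exact: (mF k).2.
  apply: le_poweR.
  - by rewrite invr_ge0 ltW.
  - exact: poweR_ge0.
  by apply: (@le_nneseries_term _ (fun k => F k x `^ s)) => i; exact: poweR_ge0.
apply: (@le_trans _ _ (\int[mu]_x (G x `^ s))).
  apply: ereal_inf_lbound; exists G => //; split => // x [k _ Ekx].
  case: (HF k) => _ F1 _; apply: le_trans (F1 x Ekx) _; exact: le_pot.
rewrite (_ : \int[mu]_x _ = \sum_(k <oo) \int[mu]_x (F k x `^ s)); last first.
  rewrite -integral_nneseries//; last 2 first.
  - by move=> k; exact: (mFs k).1.
  - by move=> k x _; exact: (mFs k).2.
  apply: eq_integral => x _; rewrite /G -[in RHS](poweRK (r := s^-1) (S0 x)) ?invrK//.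
  by rewrite invr_eq0 gt_eqF.
apply: le_trans (epsilon_trick xpredT _ (ltW e0)); last by move=> k; exact: capI_ge0.
apply: lee_nneseries => k _; first by move=> _; apply: integral_ge0 => x _; exact: (mFs k).2.
by case: (HF k).
Qed.

Lemma capI0 : capI set0 = 0.
Proof.
apply/eqP; rewrite eq_le capI_ge0 andbT; apply: ereal_inf_lbound; exists (cst 0).
  by split => //; split.
by rewrite integral0_eq// => x _; rewrite poweR0r// gt_eqF.
Qed.

Lemma capIU E E' : capI (E `|` E') <= capI E + capI E'.
Proof.
have -> : E `|` E' = \bigcup_k bigcup2 E E' k by rewrite bigcup2E.
apply: le_trans (capI_sigma_subadditive _) _.
rewrite nneseries_recl_succ; last by move=> k; exact: capI_ge0.
rewrite leeD2l// nneseries_recl_succ; last by move=> k; exact: capI_ge0.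
by rewrite eseries0 ?adde0// => k _ _; exact: capI0.
Qed.

(** The first summand serves well separated levels, [2 * 2^(N - alpha) * l <= a]. The second serves
    the other case, where [(l / a)^sweep_exp] is bounded below and [g] itself is a sufficient test
    function. *)
Definition sweep_const : R :=
  (((2 `^ (N - alpha)) `^ 2) `^ s * (2 `^ s * sweep_base `^ (s - 1)) +
   (2 * 2 `^ (N - alpha)) `^ sweep_exp s)%R.

Lemma sweep_const_gt0 : (0 < sweep_const)%R.
Proof.
rewrite /sweep_const; apply: ltr_wpDl; first by rewrite !mulr_ge0 ?powR_ge0.
by rewrite powR_gt0// mulr_gt0// powR_gt0.
Qed.

Lemma sweep_exp_gt : (s - 1 < sweep_exp s)%R.
Proof.
rewrite /sweep_exp -[ltLHS]mul1r ltr_pM2r ?subr_gt0//.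
by rewrite ltr_pdivlMr// mul1r gtrBl.
Qed.

(* The exponent [sweep_exp s > s - 1] comes from the weak A_1 property of [pot h],
   whose level sets decay like [a^(- N / (N - alpha))] on every Whitney cell. *)
Lemma capI_sweep h g (l a t : R) : nneg_mfun h -> nneg_mfun g ->
  (0 < l)%R -> (0 < a)%R -> (0 < t)%R ->
  (forall y, g y != 0 -> a%:E <= pot h y) ->
  capI [set x | pot h x <= l%:E /\ t%:E <= pot g x] <=
  (sweep_const * t `^ (- s) * (l / a) `^ sweep_exp s)%:E * \int[mu]_x (g x `^ s).
Proof.
move=> mh mg l0 a0 t0 ga; set E := [set x | _].
have ig0 : 0 <= \int[mu]_x (g x `^ s) by apply: integral_ge0 => x _; exact: poweR_ge0.
have ts0 : (0 <= t `^ (- s))%R by exact: powR_ge0.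
have la0 : (0 < l / a)%R by rewrite divr_gt0.
have e0 : (0 <= sweep_exp s)%R.
  by apply: le_trans (ltW sweep_exp_gt); rewrite subr_ge0 ltW.
have [la|la] := leP (2 * 2 `^ (N - alpha) * l)%R a; last first.
  apply: le_trans (capI_le (E := E) mg t0 _) _; first by move=> x [].
  rewrite lee_wpmul2r// lee_fin -[leLHS]mulr1 [leRHS]mulrAC [leRHS]mulrC.
  apply: ler_wpM2l => //.
  apply: (@le_trans _ _ ((2 * 2 `^ (N - alpha)) `^ sweep_exp s * (l / a) `^ sweep_exp s)%R).
    have b0 : (0 <= 2 * 2 `^ (N - alpha) :> R)%R by rewrite mulr_ge0// powR_ge0.
    rewrite -(powRM _ b0 (ltW la0)).
    apply: (@le_trans _ _ (1 `^ sweep_exp s)%R); first by rewrite powR1.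
    apply: ge0_ler_powR => //.
    - by rewrite nnegrE.
    - by rewrite nnegrE mulr_ge0 ?(ltW la0)// mulr_ge0// powR_ge0.
    by rewrite mulrA ler_pdivlMr// mul1r ltW.
  apply: ler_wpM2r; first exact: powR_ge0.
  by rewrite lerDr !mulr_ge0 ?powR_ge0.
pose D := [set x | pot h x <= l%:E].
set c := ((2 `^ (N - alpha)) `^ 2 : R)%R.
have c0 : (0 < c)%R by rewrite powR_gt0// powR_gt0.
have tc0 : (0 < t / c)%R by rewrite divr_gt0.
apply: le_trans (capI_le (g := sweep D g) (nneg_mfun_sweep D mg) tc0 _) _.
  move=> x [Dx tx]; have : pot g x <= c%:E * pot (sweep D g) x.
    apply: pot_sweep => // z nz; apply: contrapT => /eqP gz; apply: nz.
    (* The support of [g] keeps away from [D], so each of its points lies in a Whitney cell. *)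
    have [|e e_gt0 ze] := pot_gap mh (ltW l0) _ (ga z gz).
      apply: lt_le_trans la; rewrite -mulrA ltr_pMl ?ltr1n//.
      by rewrite mulr_gt0// powR_gt0.
    by apply: (@whitney_cover D z e) => //; exists x.
  move=> /(le_trans tx) {}tx.
  have := lee_wpmul2l (_ : 0 <= (c^-1)%:E) tx.
  rewrite muleA -!EFinM mulVf ?gt_eqF// mul1e [(_ * t)%R]mulrC; apply.
  by rewrite lee_fin invr_ge0 ltW.
apply: (@le_trans _ _ (((t / c) `^ (- s))%:E * ((2 `^ s * sweep_base `^ (s - 1) *
    (l / a) `^ (sweep_exp s))%:E * \int[mu]_z (g z `^ s)))).
  apply: lee_wpmul2l; first by rewrite lee_fin powR_ge0.
  exact: int_sweep.
rewrite muleA -EFinM lee_wpmul2r// lee_fin powRM ?(ltW t0) ?invr_ge0 ?(ltW c0)//.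
have -> : (c^-1 `^ (- s) = c `^ s)%R.
  exact/powRVN/ltW.
rewrite [leLHS](_ : _ = c `^ s * (2 `^ s * sweep_base `^ (s - 1)) *
   (t `^ (- s) * (l / a) `^ sweep_exp s))%R; last by ring.
rewrite -[leRHS]mulrA; apply: ler_wpM2r; first by rewrite mulr_ge0// powR_ge0.
by rewrite lerDl powR_ge0.
Qed.

Lemma int_set_le A F (m e : R) : measurable A -> nneg_mfun F -> (0 < m)%R ->
  (0 < e)%R -> mu A <= m%:E -> \int[mu]_x (F x `^ s) <= e%:E ->
  \int[mu]_(x in A) F x <= (2 * m `^ (1 - s^-1) * e `^ s^-1)%:E.
Proof.
move=> mA mF m0 e0 Am Fe.
have i0 : 0 <= \int[mu]_(x in A) F x by apply: integral_ge0 => x _; exact: mF.2.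
have b0 : (0 <= 2 * m `^ (1 - s^-1) * e `^ s^-1)%R by rewrite !mulr_ge0 ?powR_ge0.
rewrite -(le_poweRV s0)//.
have := @weighted_jensen _ _ _ mu A (cst 1) F m s mA _ (measurable_funTS mF.1)
  (fun _ _ => lee01) (fun x _ => mF.2 x) m0 (ltW s1).
rewrite integral_cst// mul1e => /(_ _ Am).
under eq_integral do rewrite mul1e; under [X in _ <= _ * X]eq_integral do rewrite mul1e.
move=> J; apply: le_trans (J _) _ => //.
apply: (@le_trans _ _ ((2 `^ s * m `^ (s - 1))%:E * e%:E)).
  apply: lee_wpmul2l; first by rewrite lee_fin mulr_ge0 ?powR_ge0.
  by apply: le_trans Fe; apply: le_int_setT => //; exact: nneg_mfun_poweR.
rewrite -EFinM poweR_EFin lee_fin !powRM ?mulr_ge0 ?powR_ge0// -!powRrM.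
by rewrite mulrBl mul1r mulVf ?gt_eqF// powRr1// ltW.
Qed.

(** * Local integrability of potentials of functions in [L^s] *)

Context (alphas : (alpha * s < N)%R).

Definition far_const (r : R) : R :=
  (2 * (V * (2 * r) `^ N) `^ (1 - s^-1) * r `^ (alpha - N) /
   (1 - 2 `^ (- (N / s - alpha))))%R.

Let gap : (0 < N / s - alpha)%R.
Proof. by rewrite subr_gt0 ltr_pdivlMr. Qed.

(** By Hoelder's inequality the shell at distance about [2^i r] contributes a multiple of
    [2^(- i (N / s - alpha))], summable because [alpha s < N]; [far_const] is the sum. *)
Lemma int_kern_far x0 (r : R) F (e : R) : (0 < r)%R -> (0 < e)%R -> nneg_mfun F ->
  \int[mu]_x (F x `^ s) <= e%:E ->
  \int[mu]_(y in [set y | (r <= dist x0 y)%R]) (kern x0 y * F y) <=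
    (far_const r * e `^ s^-1)%:E.
Proof.
move=> r0 e0 mF Fe; set A := [set y | _].
have mA : measurable A by exact: measurable_dist_ge.
pose B (i : nat) := [set y | (dist x0 y < 2 * (2 `^ i%:R * r))%R].
have mB i : measurable (B i) by exact: measurable_ball_dist.
pose a (i : nat) := ((2 `^ i%:R * r) `^ (alpha - N))%R.
have a0 i : (0 <= a i)%R by exact: powR_ge0.
have mG i : nneg_mfun (fun y => (a i)%:E * (F \_ (B i)) y).
  by apply: nneg_mfunZ; [rewrite lee_fin|exact: nneg_mfun_restrict].
apply: (@le_trans _ _ (\int[mu]_y (\sum_(i <oo) (a i)%:E * (F \_ (B i)) y))).
  rewrite integral_mkcond; apply: le_int.
  - by apply: nneg_mfun_restrict => //; exact: nneg_mfunM (nneg_mfun_kern x0) mF.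
  - split => [|y]; last by apply: nneseries_ge0 => i _ _; exact: (mG i).2.
    by apply: ge0_emeasurable_sum => i *; [exact: (mG i).2|exact: (mG i).1].
  move=> y; rewrite patchE; case: ifPn => [|_]; last first.
    by apply: nneseries_ge0 => i _ _; exact: (mG i).2.
  rewrite inE /A/= => ry.
  have [|m /andP[h1 h2]] := @dyadic_bracket _ (dist x0 y / r).
    by rewrite divr_gt0// (lt_le_trans r0).
  rewrite ler_pdivlMr// in h1; rewrite ltr_pdivrMr// in h2.
  have [i mi] : exists i : nat, m = i.
    case: m h1 h2 => i h1 h2; first by exists i.
    exfalso; have := le_lt_trans ry h2; rewrite -[ltLHS]mul1r ltr_pM2r// ltNge.
    move/negP; apply; rewrite -[leRHS](powRr0 2); apply: ler_powR; first by rewrite ler1n.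
    by rewrite lerz0 NegzE -addn1 PoszD opprD subrK oppr_le0.
  subst m; apply: le_trans (@le_nneseries_term _ (fun i => (a i)%:E * (F \_ (B i)) y) i _).
    rewrite patchE mem_set; last first.
      move: h2; have -> : (2 `^ (i%:Z + 1)%:~R = 2 * 2 `^ i%:R :> R)%R.
        by rewrite intrD powR2D powRr1// mulrC.
      by rewrite -mulrA.
    rewrite lee_wpmul2r ?mF.2//; apply: kern_le_radius => //.
    by rewrite mulr_gt0// powR_gt0.
  by move=> j; exact: (mG j).2.
rewrite integral_nneseries//; last 2 first.
- by move=> i; exact: (mG i).1.
- by move=> i y _; exact: (mG i).2.
pose z : R := (2 `^ (- (N / s - alpha)))%R.
pose K : R := (2 * (V * (2 * r) `^ N) `^ (1 - s^-1) * r `^ (alpha - N) * e `^ s^-1)%R.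
have K0 : (0 <= K)%R by rewrite !mulr_ge0 ?powR_ge0.
apply: (@le_trans _ _ (\sum_(i <oo) (K%:E * (z ^+ i)%:E))).
  apply: lee_nneseries => [i _ _|i _].
    by apply: integral_ge0 => y _; exact: (mG i).2.
  rewrite int_nnegZ ?lee_fin//; last exact: nneg_mfun_restrict.
  rewrite -integral_mkcond.
  have r'0 : (0 < 2 * (2 `^ i%:R * r))%R by rewrite !mulr_gt0// powR_gt0.
  have v0 : (0 < V * (2 * (2 `^ i%:R * r)) `^ N)%R by rewrite mulr_gt0// powR_gt0.
  apply: le_trans (lee_wpmul2l _ (int_set_le (mB i) mF v0 e0 (mu_ball x0 r'0) Fe)) _.
    by rewrite lee_fin.
  rewrite -EFinM lee_fin /a /K /z -powR2_natM.
  have -> : (2 * (2 `^ i%:R * r) = 2 `^ i%:R * (2 * r))%R by ring.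
  have p2 : (0 <= 2 `^ i%:R :> R)%R by exact: powR_ge0.
  have r20 : (0 <= 2 * r)%R by rewrite mulr_ge0// ltW.
  rewrite (powRM _ p2 (ltW r0)) (powRM _ p2 r20).
  rewrite [(V * (_ * _))%R]mulrCA (@powRM _ ((2 `^ i%:R) `^ N)) ?mulr_ge0 ?powR_ge0 ?(ltW V0)//.
  rewrite -!powRrM.
  have -> : (2 `^ (- ((N / s - alpha) * i%:R)) =
     2 `^ (i%:R * (alpha - N)) * 2 `^ (i%:R * (N * (1 - s^-1))) :> R)%R.
    by rewrite -powR2D; congr (_ `^ _)%R; ring.
  by rewrite le_eqVlt; apply/orP; left; apply/eqP; ring.
rewrite nneseriesZl; last by move=> i _; rewrite lee_fin exprn_ge0// powR_ge0.
apply: (@le_trans _ _ (K%:E * ((1 - z)^-1)%:E)).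
  by rewrite lee_wpmul2l ?nneseries_geometric ?powR2_itv// lee_fin.
by rewrite -EFinM lee_fin /K /far_const -/z le_eqVlt; apply/orP; left; apply/eqP; ring.
Qed.

Lemma le_poweRD (x y : \bar R) : 0 <= x -> 0 <= y ->
  (x + y) `^ s <= (2 `^ s)%:E * (x `^ s + y `^ s).
Proof.
move=> x0 y0; wlog xy : x y x0 y0 / x <= y.
  move=> H; have [xy|/ltW yx] := leP x y; first exact: H.
  by rewrite addeC [X in _ * X]addeC; exact: H.
apply: (@le_trans _ _ ((2%:E * y) `^ s)).
  apply: le_poweR; [exact: ltW|exact: adde_ge0|].
  by rewrite mule_natl mule2n leeD2r.
by rewrite poweRM ?lee_fin// poweR_EFin lee_wpmul2l ?lee_fin ?powR_ge0// leeDr ?poweR_ge0.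
Qed.

Definition local_const (r : R) : R :=
  (2 `^ s * (2 `^ s * (ball_const * (3 * r) `^ alpha) `^ s +
     (2 `^ (N - alpha) * far_const (2 * r)) `^ s * (V * r `^ N)))%R.

(** [F] is split at radius [2 * r]. The far part has a potential bounded on the ball by
    [int_kern_far]. For the near part, [weighted_jensen] puts the power inside the potential, and
    symmetry then leaves the potential of a ball, bounded by [m]; the radius [3 * r] covers all the
    distances involved. *)
Lemma int_pot_local x0 (r : R) F (e : R) : (0 < r)%R -> (0 < e)%R -> nneg_mfun F ->
  \int[mu]_x (F x `^ s) <= e%:E ->
  \int[mu]_(x in [set x | (dist x0 x < r)%R]) (pot F x `^ s) <= (local_const r * e)%:E.
Proof.
move=> r0 e0 mF Fe; set B := [set x | _].
have r20 : (0 < 2 * r)%R by rewrite mulr_gt0.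
have r30 : (0 < 3 * r)%R by rewrite mulr_gt0.
pose B2 := [set x | (dist x0 x < 2 * r)%R].
have mB : measurable B by exact: measurable_ball_dist.
have mB2 : measurable B2 by exact: measurable_ball_dist.
have mFs := nneg_mfun_poweR s mF.
pose m : R := (ball_const * (3 * r) `^ alpha)%R.
have m0 : (0 < m)%R by rewrite mulr_gt0 ?powR_gt0 ?ball_const_gt0.
pose K : R := (2 `^ (N - alpha) * (far_const (2 * r) * e `^ s^-1))%R.
have fc0 : (0 <= far_const (2 * r))%R.
  rewrite /far_const !mulr_ge0 ?powR_ge0// invr_ge0 subr_ge0.
  by have /andP[_ /ltW] := powR2_itv gap.
have K0 : (0 <= K)%R.
  by apply: mulr_ge0; [|apply: mulr_ge0 => //]; exact: powR_ge0.
have near x : pot (F \_ B2) x `^ s <= (2 `^ s * m `^ (s - 1))%:E *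
    pot ((fun y => F y `^ s) \_ B2) x \/ ~ B x.
  have [Bx|] := pselect (B x); last by right.
  left; rewrite !pot_restrict; apply: weighted_jensen => //.
  - by apply: measurable_funTS; exact: (nneg_mfun_kern x).1.
  - exact: measurable_funTS mF.1.
  - by move=> y _; exact: kern_ge0.
  - by move=> y _; exact: mF.2.
  - exact: ltW.
  rewrite integral_mkcond; apply: le_trans (int_kern_ball x r30).
  apply: le_int.
  - by apply: nneg_mfun_restrict => //; exact: nneg_mfun_kern.
  - apply: nneg_mfunM; first exact: nneg_mfun_kern.
    by apply: nneg_mfun_indic; exact: measurable_ball_dist.
  move=> y; rewrite patchE; case: ifPn => [|_]; last by rewrite mule_ge0 ?kern_ge0 ?lee_fin.
  rewrite inE => B2y; rewrite indicE mem_set ?mule1//=.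
  have := dist_triangle x x0 y; rewrite (distC x x0); move: Bx B2y; rewrite /B /B2/=; lra.
have far x : B x -> pot (F \_ (~` B2)) x <= K%:E.
  move=> Bx; rewrite pot_restrict.
  apply: le_trans (pot_far (x := x0) (measurableC mB2) mF _) _.
    move=> y /= /negP; rewrite -leNgt => h1.
    by have := dist_triangle x0 x y; move: Bx; rewrite /B/=; lra.
  rewrite EFinM; apply: lee_wpmul2l; first by rewrite lee_fin powR_ge0.
  apply: le_trans (int_kern_far x0 r20 e0 mF Fe).
  apply: le_int_set; [exact: nneg_mfunM (nneg_mfun_kern x0) mF|exact: measurableC| |].
    exact: measurable_dist_ge.
  by move=> y /= /negP; rewrite -leNgt.
have mP2 : nneg_mfun (pot ((fun y => F y `^ s) \_ B2)).
  by apply: nneg_mfun_pot; exact: nneg_mfun_restrict.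
have c0 : 0 <= (2 `^ s * m `^ (s - 1))%:E by rewrite lee_fin mulr_ge0 ?powR_ge0.
apply: (@le_trans _ _ (\int[mu]_x ((2 `^ s)%:E *
    ((2 `^ s * m `^ (s - 1))%:E * ((EFin \o \1_B) x * pot ((fun y => F y `^ s) \_ B2) x) +
     (K `^ s)%:E * (\1_B x)%:E)))).
  rewrite integral_mkcond; apply: le_int.
  - by apply: nneg_mfun_restrict => //; exact/nneg_mfun_poweR/nneg_mfun_pot.
  - apply: nneg_mfunZ; first by rewrite lee_fin powR_ge0.
    apply: nneg_mfunD; apply: nneg_mfunZ => //.
    + by apply: nneg_mfunM => //; exact: nneg_mfun_indic.
    + by rewrite lee_fin powR_ge0.
    + exact: nneg_mfun_indic.
  move=> x; rewrite patchE /= indicE; case: ifPn => [|_]; last first.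
    by rewrite mul0e !mule0 adde0 mule0.
  rewrite inE => Bx; rewrite mul1e mule1 (pot_splitU x mB2 mF).
  apply: le_trans (le_poweRD _ _) _.
  - by apply: pot_ge0; exact: nneg_mfun_restrict.
  - by apply: pot_ge0; apply: nneg_mfun_restrict => //; exact: measurableC.
  apply: lee_wpmul2l; first by rewrite lee_fin powR_ge0.
  apply: leeD; first by case: (near x).
  rewrite -poweR_EFin; apply: le_poweR; [exact: ltW| |exact: far].
  by apply: pot_ge0; apply: nneg_mfun_restrict => //; exact: measurableC.
have mI := nneg_mfunM (nneg_mfun_indic mB) mP2.
rewrite int_nnegZ ?lee_fin ?powR_ge0//; last first.
  by apply: nneg_mfunD; apply: nneg_mfunZ => //; rewrite ?lee_fin ?powR_ge0//; exact: nneg_mfun_indic.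
have -> : (local_const r * e = 2 `^ s * ((2 `^ s * m `^ s +
    (2 `^ (N - alpha) * far_const (2 * r)) `^ s * (V * r `^ N)) * e))%R.
  by rewrite [RHS]mulrA.
rewrite [leRHS]EFinM; apply: lee_wpmul2l; first by rewrite lee_fin powR_ge0.
rewrite int_nnegD; last 2 first.
- exact: nneg_mfunZ.
- by apply: nneg_mfunZ; rewrite ?lee_fin ?powR_ge0//; exact: nneg_mfun_indic.
rewrite int_nnegZ// (int_nnegZ (nneg_mfun_indic mB)) ?lee_fin ?powR_ge0//.
rewrite int_indic// mulrDl EFinD; apply: leeD.
  rewrite pot_sym; [|exact: nneg_mfun_restrict|exact: nneg_mfun_indic].
  have -> : (2 `^ s * m `^ s * e)%:E = (2 `^ s * m `^ (s - 1))%:E * (m * e)%:E.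
    rewrite -EFinM; congr (_%:E).
    have -> : (m `^ s = m * m `^ (s - 1))%R by rewrite mulr_powRB1// ltW.
    by ring.
  apply: lee_wpmul2l => //.
  apply: (@le_trans _ _ (\int[mu]_y (m%:E * F y `^ s))); last first.
    rewrite int_nnegZ ?lee_fin ?(ltW m0)// [leRHS]EFinM.
    by apply: lee_wpmul2l; rewrite ?lee_fin ?(ltW m0).
  apply: le_int.
  - apply: nneg_mfunM; first exact: nneg_mfun_restrict.
    exact/nneg_mfun_pot/nneg_mfun_indic.
  - by apply: nneg_mfunZ; rewrite ?lee_fin ?(ltW m0).
  move=> y; rewrite patchE; case: ifPn => [|_]; last first.
    by rewrite mul0e mule_ge0 ?poweR_ge0// lee_fin ltW.
  rewrite inE => B2y; rewrite muleC lee_wpmul2r ?poweR_ge0//.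
  apply: le_trans (int_kern_ball y r30); apply: le_pot.
  - exact: nneg_mfun_indic.
  - by apply: nneg_mfun_indic; exact: measurable_ball_dist.
  move=> x /=; rewrite lee_fin !indicE ler_nat; case: (boolP (x \in B)) => //.
  rewrite inE => Bx; rewrite mem_set//=.
  have := dist_triangle y x0 x; rewrite (distC y x0); move: Bx B2y; rewrite /B /B2/=; lra.
apply: (@le_trans _ _ ((K `^ s)%:E * (V * r `^ N)%:E)).
  by apply: lee_wpmul2l; rewrite ?lee_fin ?powR_ge0//; exact: mu_ball.
rewrite -EFinM lee_fin /K mulrA.
have q0 : (0 <= 2 `^ (N - alpha) * far_const (2 * r))%R.
  by apply: mulr_ge0 => //; exact: powR_ge0.
have es : ((e `^ s^-1) `^ s = e)%R by rewrite -powRrM mulVf ?gt_eqF// powRr1// ltW.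
by rewrite (powRM _ q0 (powR_ge0 _ _)) es mulrAC.
Qed.

(** Test functions of vanishing norm have potentials at least [1] on [E] but, by [int_pot_local], of
    vanishing [L^s] norm on each ball. *)
Lemma capI_null E : capI E = 0 -> mu.-negligible E.
Proof.
move=> E0; pose x0 : T := point.
pose B (k : nat) := [set x | (dist x0 x < k.+1%:R)%R].
have mB k : measurable (B k) by exact: measurable_ball_dist.
suff H k : mu.-negligible (E `&` B k).
  have -> : E = \bigcup_k (E `&` B k).
    apply/seteqP; split => [x Ex|x [k _ []]//].
    by exists (Num.truncn (dist x0 x)) => //; split => //; exact: truncnS_gt.
  exact: negligible_bigcup.
have e0 (j : nat) : (0 < j.+1%:R^-1 :> R)%R by rewrite invr_gt0.
have E0' : capI E < +oo by rewrite E0 ltry.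
have /choice[F HF] (j : nat) := capI_approx (e0 j) E0'.
have mF j : nneg_mfun (F j) by case: (HF j).
pose A j := [set x | 1 <= pot (F j) x] `&` B k.
have mP j : measurable [set x | 1 <= pot (F j) x].
  rewrite -[X in measurable X]setTI.
  by apply: emeasurable_fun_c_infty => //; exact: measurable_pot.
have mA j : measurable (A j) by exact: measurableI.
exists (\bigcap_j A j); split.
- exact: bigcapT_measurable.
- apply/eqP; rewrite eq_le measure_ge0 andbT; apply/lee_addgt0Pr => e e_gt0.
  have l0 : (0 <= `|local_const k.+1%:R|)%R by [].
  pose j := Num.truncn (`|local_const k.+1%:R| / e)%R.
  apply: (@le_trans _ _ (mu (A j))).
    apply: le_measure; rewrite ?inE//; first exact: bigcapT_measurable.
    by move=> x; apply.
  apply: (@le_trans _ _ (\int[mu]_(x in B k) (pot (F j) x `^ s))).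
    rewrite -(int_indic (mA j)) [leRHS]integral_mkcond; apply: le_int.
    - exact: nneg_mfun_indic.
    - by apply: nneg_mfun_restrict => //; exact/nneg_mfun_poweR/nneg_mfun_pot.
    move=> x /=; rewrite indicE; case: (boolP (x \in A j)) => [|_]; last first.
      by rewrite patchE; case: ifP => // _; rewrite poweR_ge0.
    rewrite inE => -[/= p1 Bx]; rewrite patchE mem_set// -(poweR1r s).
    by apply: le_poweR => //; exact: ltW.
  have [_ _] := HF j; rewrite E0 add0e => Fj.
  apply: le_trans (int_pot_local x0 _ (e0 j) (mF j) Fj) _ => //.
  rewrite add0e lee_fin ler_pdivrMr// (le_trans (ler_norm _))//.
  by rewrite -ler_pdivrMl// mulrC ltW// truncnS_gt.
- by move=> x [Ex Bx] j _; split => //; case: (HF j) => _ + _; exact.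
Qed.

(** * Cutting a function along the dyadic slabs of a weight *)

Definition slab (w : T -> \bar R) (m : int) : set T :=
  [set y | (2 `^ m%:~R)%:E <= w y < (2 `^ (m + 1)%:~R)%:E].

Lemma measurable_slab w m : nneg_mfun w -> measurable (slab w m).
Proof.
move=> mw; rewrite /slab (_ : [set y | _] =
    ([set: T] `&` [set y | (2 `^ m%:~R)%:E <= w y]) `&`
    ([set: T] `&` [set y | w y < (2 `^ (m + 1)%:~R)%:E])); last first.
  by apply/seteqP; split => y /=; [move=> /andP[]|move=> [[_ ->] [_ ->]]].
apply: measurableI.
  exact: emeasurable_fun_c_infty mw.1 _.
exact: emeasurable_fun_infty_o mw.1 _.
Qed.

Lemma slab_inj w m m' y : slab w m y -> slab w m' y -> m = m'.
Proof.
wlog mm' : m m' / (m <= m')%R.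
  by have [mm' H|/ltW m'm H h1 h2] := leP m m'; [exact: H|exact/esym/H].
move=> /andP[_ h1] /andP[h2 _]; apply/eqP; rewrite eq_le mm'/= leNgt.
apply/negP => mlt; have := le_lt_trans h2 h1; rewrite lte_fin ltNge ler_powR ?ler1n//.
by rewrite ler_int addrC lez1D.
Qed.

Definition piece (f w : T -> \bar R) m : T -> \bar R := f \_ (slab w m).

Lemma nneg_mfun_piece f w m : nneg_mfun f -> nneg_mfun w -> nneg_mfun (piece f w m).
Proof. by move=> mf mw; apply: nneg_mfun_restrict => //; exact: measurable_slab. Qed.

(** The common form of the two functionals: [w] is a weight for [lambda_dot] and, up to comparable
    kernels, the potential of [f] for [beta_dot]. *)
Definition energy (q : R) f (w : T -> \bar R) : \bar R :=
  \int[mu]_(x in [set x | f x != 0]) (f x `^ s * epow (w x) (q - s)).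

Lemma measurable_support f : nneg_mfun f -> measurable [set x | f x != 0].
Proof.
move=> mf; rewrite -[X in measurable X]setTI.
exact: emeasurable_neq mf.1 _.
Qed.

Lemma nneg_mfun_epow w r : nneg_mfun w -> nneg_mfun (fun x => epow (w x) r).
Proof.
move=> mw; split => [|x]; last exact: epow_ge0.
exact: (measurableT_comp (measurable_epow r)) mw.1.
Qed.

(** On the slab of index [m], [2^(m (q - s))] exceeds [w^(q - s)] by a factor of at most
    [2^(s - q)]. The factor [2] comes from bounding each half of Z by the whole energy. *)
Lemma energy_pieces (q : R) f w : (q <= s)%R -> nneg_mfun f -> nneg_mfun w ->
  zsum (fun m => (2 `^ (m%:~R * (q - s)))%:E * \int[mu]_x (piece f w m x `^ s)) <=
  (2 * 2 `^ (s - q))%:E * energy q f w.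
Proof.
move=> qs mf mw.
pose g := (fun x => f x `^ s * epow (w x) (q - s)) \_ [set x | f x != 0].
have mg : nneg_mfun g.
  apply: nneg_mfun_restrict; first exact: measurable_support.
  by apply: nneg_mfunM; [exact: nneg_mfun_poweR|exact: nneg_mfun_epow].
have eg : energy q f w = \int[mu]_x g x by rewrite [RHS]integral_mkcond patch_setT -integral_mkcond.
have half (e : nat -> int) : injective e ->
    \sum_(i <oo) ((2 `^ ((e i)%:~R * (q - s)))%:E *
      \int[mu]_x (piece f w (e i) x `^ s)) <= (2 `^ (s - q))%:E * energy q f w.
  move=> einj.
  have mS i : measurable (slab w (e i)) by exact: measurable_slab.
  apply: (@le_trans _ _ (\sum_(i <oo) ((2 `^ (s - q))%:E * \int[mu]_(x in slab w (e i)) g x))).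
    apply: lee_nneseries => [i _ _|i _].
      rewrite mule_ge0 ?lee_fin ?powR_ge0//; apply: integral_ge0 => x _; exact: poweR_ge0.
    rewrite -int_nnegZ ?lee_fin ?powR_ge0//; last exact/nneg_mfun_poweR/nneg_mfun_piece.
    rewrite -int_nnegZ_in ?lee_fin ?powR_ge0// [leRHS]integral_mkcond; apply: le_int.
    - by apply: nneg_mfunZ; [rewrite lee_fin powR_ge0|exact/nneg_mfun_poweR/nneg_mfun_piece].
    - by apply: nneg_mfun_restrict => //; apply: nneg_mfunZ => //; rewrite lee_fin powR_ge0.
    move=> x; rewrite /piece !patchE; case: ifPn => [|_]; last first.
      by rewrite poweR0r ?gt_eqF// mule0.
    rewrite inE => /andP[_ wx]; rewrite /g patchE; case: ifPn => [_|]; last first.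
      by rewrite notin_setE/= => /negP/negPn/eqP ->; rewrite poweR0r ?gt_eqF// !mule0.
    rewrite muleCA [leLHS]muleC; apply: lee_wpmul2l; first exact: poweR_ge0.
    apply: (@le_trans _ _ ((2 `^ (s - q))%:E * epow (2 `^ (e i + 1)%:~R)%:E (q - s))).
      rewrite epow_EFin ?powR_gt0// -EFinM lee_fin -powRrM -powR2D.
      by apply: ler_powR; rewrite ?ler1n// intrD; lra.
    apply: lee_wpmul2l; first by rewrite lee_fin powR_ge0.
    by apply: epow_le0; [rewrite subr_le0|exact: mw.2|exact: ltW].
  rewrite nneseriesZl; last by move=> i _; apply: integral_ge0 => x _; exact: mg.2.
  apply: lee_wpmul2l; first by rewrite lee_fin powR_ge0.
  rewrite -ge0_integral_bigcup//.
  - by rewrite eg; apply: le_int_setT => //; exact: bigcupT_measurable.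
  - exact: measurable_funTS mg.1.
  - by move=> x _; exact: mg.2.
  - apply/trivIsetP => i j _ _; apply: contraNeq => /set0P[y [yi yj]].
    by apply/eqP/einj; exact: slab_inj yi yj.
rewrite /zsum nneseriesD; last 2 first.
- by move=> i _ _; rewrite mule_ge0 ?lee_fin ?powR_ge0//; apply: integral_ge0 => x _; exact: poweR_ge0.
- by move=> i _ _; rewrite mule_ge0 ?lee_fin ?powR_ge0//; apply: integral_ge0 => x _; exact: poweR_ge0.
rewrite EFinM -muleA mule_natl mule2n; apply: leeD; apply: half.
  by move=> i j [].
by move=> i j [].
Qed.

(** The slabs from [m] upwards exhaust [{w >= 2^m}] except for the points where [w = +oo], whence
    the negligibility hypothesis. *)
Lemma pot_pieces f w (m : int) x : nneg_mfun f -> nneg_mfun w ->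
  mu.-negligible [set y | w y = +oo] ->
  pot (f \_ [set y | (2 `^ m%:~R)%:E <= w y]) x <=
  \sum_(i <oo) pot (piece f w (m + i%:Z)%R) x.
Proof.
move=> mf mw [Z [mZ Z0 wZ]].
have mp i : nneg_mfun (piece f w (m + i%:Z)%R) by exact: nneg_mfun_piece.
rewrite -pot_nneseries//; set A := [set y | _].
have mA : measurable A.
  rewrite -[X in measurable X]setTI.
  exact: emeasurable_fun_c_infty mw.1 _.
have mfA : nneg_mfun (f \_ A) by exact: nneg_mfun_restrict.
have mS : nneg_mfun (fun y => \sum_(i <oo) piece f w (m + i%:Z)%R y).
  split => [|y]; last by apply: nneseries_ge0 => i _ _; exact: (mp i).2.
  by apply: ge0_emeasurable_sum => i *; [exact: (mp i).2|exact: (mp i).1].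
apply: ae_ge0_le_integral => //.
- by move=> y _; rewrite mule_ge0 ?kern_ge0 ?mfA.2.
- exact: measurable_kernM.
- by move=> y _; rewrite mule_ge0 ?kern_ge0 ?mS.2.
- exact: measurable_kernM.
exists Z; split => // y /= H; apply: wZ; apply: contrapT => /= /eqP woo; apply: H => _.
rewrite lee_wpmul2l ?kern_ge0// patchE; case: ifPn => [|_]; last exact: mS.2.
rewrite inE /A/= => wy.
have wfin : w y \is a fin_num by rewrite ge0_fin_numE ?mw.2// ltey.
have w0 : (0 < fine (w y))%R.
  by rewrite -lte_fin fineK//; apply: lt_le_trans wy; rewrite lte_fin powR_gt0.
have [m' /andP[h1 h2]] := dyadic_bracket w0.
have mm' : (m <= m')%R.
  rewrite leNgt; apply/negP => m'm; move: wy; rewrite -(fineK wfin) lee_fin => wy.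
  have := le_lt_trans wy h2; rewrite ltNge ler_powR ?ler1n//.
  by rewrite ler_int addrC lez1D.
have [i mi] : exists i : nat, m' = (m + i%:Z)%R.
  by exists `|(m' - m)%R|%N; rewrite gez0_abs ?subr_ge0// subrKC.
apply: le_trans (@le_nneseries_term _ (fun i => piece f w (m + i%:Z)%R y) i _).
  by rewrite /piece patchE mem_set// /slab/= -mi -(fineK wfin) lee_fin lte_fin h1.
by move=> j; exact: (mp j).2.
Qed.

(** The thresholds add up to [t / 2 < t], so at least one of them is reached wherever the series is
    at least [t]. *)
Lemma capI_pot_series (D : set T) (g : nat -> T -> \bar R) (t z : R) :
  (0 < t)%R -> (0 <= z < 1)%R -> (forall i, nneg_mfun (g i)) ->
  capI [set x | D x /\ t%:E <= \sum_(i <oo) pot (g i) x] <=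
  \sum_(i <oo) capI [set x | D x /\ (t * (1 - z) / 2 * z ^+ i)%:E <= pot (g i) x].
Proof.
move=> t0 /andP[z0 z1] mg; apply: le_trans (capI_sigma_subadditive _).
apply: le_capI => x [Dx tx]; apply: contrapT => H.
have {}H i : pot (g i) x <= (t * (1 - z) / 2 * z ^+ i)%:E.
  rewrite leNgt; apply/negP => /ltW lt; apply: H; exists i => //; split => //.
have : \sum_(i <oo) pot (g i) x <= (t / 2)%:E.
  apply: (@le_trans _ _ (\sum_(i <oo) ((t * (1 - z) / 2)%:E * (z ^+ i)%:E))).
    by apply: lee_nneseries => [i _ _|i _]; [exact: pot_ge0|rewrite -EFinM].
  rewrite nneseriesZl; last by move=> i _; rewrite lee_fin exprn_ge0.
  apply: (@le_trans _ _ ((t * (1 - z) / 2)%:E * ((1 - z)^-1)%:E)).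
    apply: lee_wpmul2l; last by apply: nneseries_geometric; rewrite z0.
    by rewrite lee_fin !mulr_ge0 ?(ltW t0)// subr_ge0 ltW.
  rewrite -EFinM lee_fin le_eqVlt; apply/orP; left; apply/eqP; field.
  by rewrite gt_eqF ?subr_gt0.
move=> /(le_trans tx); rewrite lee_fin leNgt => /negP; apply.
by rewrite ltr_pdivrMr// ltr_pMr// ltr1n.
Qed.

(** * The strong type estimate *)

Definition level (w : T -> \bar R) (k : int) : set T :=
  [set x | (2 `^ k%:~R)%:E < w x].

(** The discrete form of the power [q] of the capacitary norm; [rint_level] and [level_le_rint] give
    the two comparisons. *)
Definition strong_sum (q : R) (w : T -> \bar R) : \bar R :=
  zsum (fun k => (2 `^ (k%:~R * q))%:E * capI (level w k)).

Lemma le_level w (k k' : int) : (k <= k')%R -> level w k' `<=` level w k.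
Proof.
move=> kk' x; apply: le_lt_trans; rewrite lee_fin; apply: ler_powR; first by rewrite ler1n.
by rewrite ler_int.
Qed.

Lemma negligible_oo w :
  (forall e : R, (0 < e)%R -> exists m, capI (level w m) <= e%:E) ->
  mu.-negligible [set y | w y = +oo].
Proof.
move=> H; apply: capI_null; apply/eqP; rewrite eq_le capI_ge0 andbT.
apply/lee_addgt0Pr => e /H[m Hm]; rewrite add0e; apply: le_trans Hm; apply: le_capI.
by move=> y /= wy; rewrite /level/= wy ltry.
Qed.

(** An integer above [N - alpha + 1]: below the level [k - level_shift], the maximum principle
    [pot_truncate] leaves a potential of at most [2^k / 2]. *)
Definition level_shift : nat := (Num.truncn (N - alpha + 1)).+1.

(** Half the excess of [sweep_exp s] over [s - q]. One half is spent on the decreasing thresholds of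
    [capI_pot_series]; the other remains as geometric decay. *)
Definition step_rate (q : R) : R := ((sweep_exp s - (s - q)) / 2)%R.

Definition step_const (q : R) : R :=
  (sweep_const * ((1 - 2 `^ (- (step_rate q / s))) / 4) `^ (- s) *
   2 `^ ((1 + level_shift%:R) * sweep_exp s))%R.

Lemma step_rate_gt0 q : (1 <= q)%R -> (0 < step_rate q)%R.
Proof. by move=> q1; have := sweep_exp_gt; rewrite /step_rate; lra. Qed.

(** Removing the next level set leaves points with [pot f <= 2^(k + 1)], an upper level to sweep
    onto. There the part of [f] below the level [k - level_shift] contributes at most [2^k / 2], so
    the pieces above it contribute as much, and each of them is swept with [h = f]. *)
Lemma capI_level_step (q : R) f (k : int) : (1 <= q)%R -> nneg_mfun f ->
  mu.-negligible [set y | pot f y = +oo] ->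
  capI (level (pot f) k) <=
  (2 `^ (k%:~R * - s) * step_const q)%:E *
  \sum_(i <oo) (2 `^ (i%:R * (step_rate q - sweep_exp s)))%:E *
     \int[mu]_x (piece f (pot f) (k + (i%:Z - level_shift%:Z))%R x `^ s)
  + capI (level (pot f) (k + 1)%R).
Proof.
move=> q1 mf foo; pose eta : R := (step_rate q / s)%R.
have eta0 : (0 < eta)%R by rewrite divr_gt0// step_rate_gt0.
pose z : R := (2 `^ (- eta))%R.
have z01 : (0 <= z < 1)%R by exact: powR2_itv.
have mu_f := nneg_mfun_pot mf.
pose g i := piece f (pot f) (k + (i%:Z - level_shift%:Z))%R.
have mg i : nneg_mfun (g i) by exact: nneg_mfun_piece.
pose D := [set x | pot f x <= (2 `^ (k + 1)%:~R)%:E].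
pose t : R := (2 `^ k%:~R / 2)%R.
have t0 : (0 < t)%R by rewrite divr_gt0// powR_gt0.
have t2 : (t + t = 2 `^ k%:~R)%R by rewrite /t; field.
apply: (@le_trans _ _ (capI ([set x | D x /\ t%:E <= \sum_(i <oo) pot (g i) x] `|`
    level (pot f) (k + 1)%R))).
  apply: le_capI => x kx; have [Dx|] := leP (pot f x) (2 `^ (k + 1)%:~R)%:E; last by right.
  left; split => //.
  pose A := [set y | (2 `^ (k - level_shift%:Z)%:~R)%:E <= pot f y].
  have mA : measurable A.
    rewrite -[X in measurable X]setTI.
    exact: emeasurable_fun_c_infty mu_f.1 _.
  have low : pot (f \_ (~` A)) x <= t%:E.
    apply: le_trans (pot_truncate x mf t0); apply: le_pot.
    - by apply: nneg_mfun_restrict => //; exact: measurableC.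
    - apply: nneg_mfun_restrict => //; rewrite -[X in measurable X]setTI.
      exact: emeasurable_fun_infty_o mu_f.1 _.
    move=> y; rewrite !patchE; case: ifPn => [|_]; last by case: ifP => // _; exact: mf.2.
    rewrite inE => /negP; rewrite -ltNge => fy; rewrite mem_set//=.
    apply: lt_le_trans fy _; rewrite lee_fin /t.
    have -> : (2 `^ k%:~R / 2 = 2 `^ (k%:~R - 1) :> R)%R by rewrite powR2D powR_inv1.
    rewrite -powR2D; apply: ler_powR; first by rewrite ler1n.
    rewrite intrB -pmulrn; have := truncnS_gt (N - alpha + 1)%R; rewrite -/level_shift; lra.
  have up : pot (f \_ A) x <= \sum_(i <oo) pot (g i) x.
    apply: le_trans (pot_pieces _ x mf mu_f foo) _.
    apply: lee_nneseries => i _; first by move=> _; apply: pot_ge0; exact: nneg_mfun_piece.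
    by rewrite /g addrAC addrA.
  apply: le_trans up; have := ltW kx; rewrite (pot_splitU x mA mf) -t2 EFinD => h.
  have := le_trans h (leeD (lexx _) low).
  by rewrite leeD2rE.
apply: le_trans (capIU _ _) _; apply: leeD => //.
apply: le_trans (capI_pot_series D t0 z01 mg) _.
rewrite ge0_nneseriesZl; last 2 first.
- by rewrite lee_fin mulr_ge0 ?powR_ge0// !mulr_ge0 ?powR_ge0 ?(ltW sweep_const_gt0).
- move=> i; rewrite mule_ge0 ?lee_fin ?powR_ge0//.
  by apply: integral_ge0 => x _; exact: poweR_ge0.
apply: lee_nneseries => i _; first by move=> _; exact: capI_ge0.
have l0 : (0 < 2 `^ (k + 1)%:~R :> R)%R by rewrite powR_gt0.
have a0 : (0 < 2 `^ (k + (i%:Z - level_shift%:Z))%:~R :> R)%R by rewrite powR_gt0.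
have /andP[z0 z1] := z01.
have z_gt0 : (0 < z)%R by rewrite powR_gt0.
have ti0 : (0 < t * (1 - z) / 2 * z ^+ i)%R.
  by rewrite mulr_gt0 ?exprn_gt0// divr_gt0// mulr_gt0// subr_gt0.
apply: le_trans (capI_sweep mf (mg i) l0 a0 ti0 _) _.
  move=> y; rewrite /g /piece patchE; case: ifPn; last by rewrite eqxx.
  by rewrite inE => /andP[].
rewrite muleA -!EFinM lee_wpmul2r//.
  by apply: integral_ge0 => x _; exact: poweR_ge0.
rewrite lee_fin /step_const -/eta -/z.
have -> : (t * (1 - z) / 2 * z ^+ i = 2 `^ k%:~R * ((1 - z) / 4) * z ^+ i)%R.
  by rewrite /t; field.
have y0 : (0 <= (1 - z) / 4)%R by rewrite divr_ge0// subr_ge0 ltW.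
have p0 : (0 <= 2 `^ k%:~R :> R)%R by exact: powR_ge0.
rewrite (powRM _ (mulr_ge0 p0 y0) (exprn_ge0 i z0)) (powRM _ p0 y0) -[in X in (X <= _)%R]powRrM.
have es : (eta * s = step_rate q)%R by rewrite /eta divfK// gt_eqF.
have -> : ((z ^+ i) `^ (- s) = 2 `^ (i%:R * step_rate q))%R.
  by rewrite /z -powR2_natM -powRrM -es; congr (_ `^ _)%R; ring.
have -> : ((2 `^ (k + 1)%:~R / 2 `^ (k + (i%:Z - level_shift%:Z))%:~R) `^ sweep_exp s =
    2 `^ ((1 + level_shift%:R) * sweep_exp s) * 2 `^ (i%:R * - sweep_exp s) :> R)%R.
  rewrite -powRN -powR2D -powRrM -powR2D; congr (_ `^ _)%R.
  by rewrite !intrD intrN; ring.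
have -> : (2 `^ (i%:R * (step_rate q - sweep_exp s)) =
    2 `^ (i%:R * step_rate q) * 2 `^ (i%:R * - sweep_exp s) :> R)%R.
  by rewrite -powR2D; congr (_ `^ _)%R; ring.
by rewrite le_eqVlt; apply/orP; left; apply/eqP; ring.
Qed.

Definition strong_const (q : R) : R :=
  ((1 - 2 `^ (- q))^-1 * (step_const q *
   (2 `^ (level_shift%:R * (q - s)) / (1 - 2 `^ (- step_rate q)) *
    (2 * 2 `^ (s - q)))))%R.

Lemma step_const_ge0 q : (1 <= q)%R -> (0 <= step_const q)%R.
Proof.
move=> q1; rewrite /step_const !mulr_ge0 ?powR_ge0//.
exact/ltW/sweep_const_gt0.
Qed.

Lemma strong_const_ge0 q : (1 <= q)%R -> (0 <= strong_const q)%R.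
Proof.
move=> q1; have /andP[_ h1] := powR2_itv (lt_le_trans ltr01 q1).
have /andP[_ h2] := powR2_itv (step_rate_gt0 q1).
apply: mulr_ge0; first by rewrite invr_ge0 subr_ge0 ltW.
apply: mulr_ge0; first exact: step_const_ge0.
apply: mulr_ge0; last by rewrite mulr_ge0// powR_ge0.
by rewrite divr_ge0 ?powR_ge0// subr_ge0 ltW.
Qed.

(** [capI_level_step] is iterated upwards in [k]; nothing is absorbed, and the tail hypothesis
    removes the remainder. It also makes [{pot f = +oo}] null, as the decomposition into pieces
    requires. *)
Lemma strong_estimate (q : R) f : (1 <= q)%R -> (q <= s)%R -> nneg_mfun f ->
  (forall e : R, (0 < e)%R -> exists m, capI (level (pot f) m) <= e%:E) ->
  strong_sum q (pot f) <= (strong_const q)%:E * energy q f (pot f).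
Proof.
move=> q1 qs mf tail; have foo := negligible_oo tail.
have q0 : (0 < q)%R by exact: lt_le_trans q1.
have mu_f := nneg_mfun_pot mf.
pose c k := capI (level (pot f) k).
pose Y m := \int[mu]_x (piece f (pot f) m x `^ s).
have Y0 m : 0 <= Y m by apply: integral_ge0 => x _; exact: poweR_ge0.
pose b i : R := (2 `^ (i%:R * (step_rate q - sweep_exp s)))%R.
pose X k := (2 `^ (k%:~R * - s) * step_const q)%:E *
  \sum_(i <oo) (b i)%:E * Y (k + (i%:Z - level_shift%:Z))%R.
have sc0 := step_const_ge0 q1.
have X0 k : 0 <= X k.
  apply: mule_ge0; first by rewrite lee_fin; apply: mulr_ge0 => //; exact: powR_ge0.
  by apply: nneseries_ge0 => i _ _; rewrite mule_ge0 ?lee_fin ?powR_ge0.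
have step k : c k <= X k + c (k + 1)%R by exact: capI_level_step.
have iter k M : c k <= \sum_(0 <= j < M) X (k + j%:Z)%R + c (k + M%:Z)%R.
  elim: M => [|M IH]; first by rewrite big_geq// add0e addr0.
  apply: le_trans IH _; rewrite big_nat_recr//= -addeA leeD2l//.
  apply: le_trans (step _) _; rewrite leeD2l// -addrA.
  by rewrite (_ : (M%:Z + 1 = M.+1%:Z)%R)// intS addrC.
have cX k : c k <= \sum_(j <oo) 1%:E * X (k + j%:Z)%R.
  apply/lee_addgt0Pr => e /tail[m Hm].
  pose M := `|(m - k)%R|%N.
  apply: le_trans (iter k M) _; apply: leeD.
    apply: le_trans (nneseries_lim_ge M _); last first.
      by move=> j _ _; rewrite mul1e.
    by rewrite (eq_bigr (fun j => 1%:E * X (k + j%:Z)%R))// => j _; rewrite mul1e.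
  apply: le_trans Hm; apply: le_capI; apply: le_level.
  by rewrite -lerBlDl /M; case: (m - k)%R => n //=; rewrite lez_nat.
apply: (@le_trans _ _ (zsum (fun k => (2 `^ (k%:~R * q))%:E *
    \sum_(j <oo) 1%:E * X (k + j%:Z)%R))).
  apply: le_zsum => k; first by rewrite mule_ge0 ?lee_fin ?powR_ge0 ?capI_ge0.
  by apply: lee_wpmul2l; [rewrite lee_fin powR_ge0|exact: cX].
(* The sum over the iterates has ratio [2^(- q)]; the sum over the pieces, treated below, has ratio
   [2^(- step_rate q)]. *)
have L1 := @zsum_layers R X (fun=> 1%R) (fun j => j%:Z) q 1 (2 `^ (- q)) X0
  (fun=> ler01) (powR2_itv q0) ler01.
apply: le_trans (L1 _) _.
  by move=> i; rewrite !mul1r -powR2_natM -pmulrn mulrC.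
rewrite /strong_const mul1r EFinM -muleA; apply: lee_wpmul2l.
  by rewrite lee_fin invr_ge0 subr_ge0 ltW//; have /andP[] := powR2_itv q0.
rewrite (_ : (fun k => _ * X k) = (fun k => (step_const q)%:E *
    ((2 `^ (k%:~R * (q - s)))%:E *
      \sum_(i <oo) (b i)%:E * Y (k + (i%:Z - level_shift%:Z))%R))); last first.
  apply/funext => k; rewrite /X !muleA -!EFinM; congr (_%:E * _).
  by rewrite mulrA -powR2D mulrC; congr (_ * _ `^ _)%R; ring.
rewrite zsumZ//; last first.
  move=> k; rewrite mule_ge0 ?lee_fin ?powR_ge0//.
  by apply: nneseries_ge0 => i _ _; rewrite mule_ge0 ?lee_fin ?powR_ge0.
rewrite [X in _ <= X * _]EFinM -[leRHS]muleA; apply: lee_wpmul2l; first by rewrite lee_fin.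
have L2 := @zsum_layers R Y b (fun i => (i%:Z - level_shift%:Z)%R) (q - s)
  (2 `^ (level_shift%:R * (q - s))) (2 `^ (- step_rate q)) Y0
  (fun=> powR_ge0 _ _) (powR2_itv (step_rate_gt0 q1)) (powR_ge0 _ _).
apply: le_trans (L2 _) _.
  move=> i; rewrite -powR2_natM /b -!powR2D le_eqVlt; apply/orP; left; apply/eqP.
  by congr (_ `^ _)%R; rewrite /step_rate intrB; field.
rewrite [X in _ <= X * _]EFinM -[leRHS]muleA; apply: lee_wpmul2l; last exact: energy_pieces.
rewrite lee_fin divr_ge0 ?powR_ge0// subr_ge0 ltW//.
by have /andP[] := powR2_itv (step_rate_gt0 q1).
Qed.

(** The multiple [2^(- m) h] is a test function for the level [m], so its capacity is at most
    [2^(- m s) \int h^s]. *)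
Lemma tail_pot h (e : R) : nneg_mfun h -> \int[mu]_x (h x `^ s) < +oo ->
  (0 < e)%R -> exists m, capI (level (pot h) m) <= e%:E.
Proof.
move=> mh hoo e0; have h0 : 0 <= \int[mu]_x (h x `^ s).
  by apply: integral_ge0 => x _; exact: poweR_ge0.
have hfin : \int[mu]_x (h x `^ s) \is a fin_num by rewrite ge0_fin_numE.
set H := fine (\int[mu]_x (h x `^ s)).
have H0 : (0 <= H)%R by rewrite fine_ge0.
have He1 : (0 < H / e + 1)%R by rewrite ltr_wpDl// divr_ge0// ltW.
have [m /andP[_ Hm]] := dyadic_bracket (powR_gt0 s^-1 He1).
exists (m + 1)%R.
have tm : (0 < 2 `^ (m + 1)%:~R :> R)%R by rewrite powR_gt0.
apply: le_trans (capI_le mh tm _) _; first by move=> x /ltW.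
rewrite -(fineK hfin) -/H -EFinM lee_fin powRN mulrC ler_pdivrMr ?powR_gt0//.
have : ((H / e + 1) <= (2 `^ (m + 1)%:~R) `^ s)%R.
  have -> : (H / e + 1 = ((H / e + 1) `^ s^-1) `^ s)%R.
    by rewrite -powRrM mulVf ?(lt0r_neq0 s0)// powRr1// ltW.
  rewrite ge0_ler_powR ?nnegrE ?powR_ge0 ?(ltW s0)//.
  exact: ltW.
move=> h1; rewrite -ler_pdivrMl// mulrC (le_trans _ h1)// lerDl//.
Qed.

Lemma capacitary_strong F : nneg_mfun F -> \int[mu]_x (F x `^ s) < +oo ->
  strong_sum s (pot F) <= (strong_const s)%:E * \int[mu]_x (F x `^ s).
Proof.
move=> mF Foo.
apply: le_trans (strong_estimate (ltW s1) (lexx s) mF (fun e e0 => tail_pot mF Foo e0)) _.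
apply: lee_wpmul2l; first by rewrite lee_fin strong_const_ge0 ?(ltW s1).
have mS := measurable_support mF; have mFs : nneg_mfun (fun x => F x `^ s).
  exact: nneg_mfun_poweR.
apply: le_trans (le_int_setT mFs mS); apply: le_int_in => //.
  apply: nneg_mfunM => //; apply: nneg_mfun_epow; exact: nneg_mfun_pot.
by move=> x _; rewrite subrr /epow lexx poweRe0 mule1.
Qed.

(* The constant in [pot (F * (pot F)^(r - 1)) >= kv r * (pot F)^r]. *)
Definition kv (r : R) : R := ((2 `^ (alpha - N) / 2) `^ (r - 1) / 2)%R.

Lemma kv_gt0 r : (0 < kv r)%R.
Proof. by rewrite divr_gt0// powR_gt0// divr_gt0// powR_gt0. Qed.

(** By the maximum principle, the part of [F] where [pot F] is below [2^(alpha - N) t / 2] accounts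
    for at most half of [t]; on the rest [h] dominates [g * F]. *)
Lemma pot_above F h x (t g : R) : nneg_mfun F -> nneg_mfun h -> (0 < t)%R ->
  (0 <= g)%R -> t%:E <= pot F x ->
  (forall y, (2 `^ (alpha - N) / 2 * t)%:E <= pot F y -> g%:E * F y <= h y) ->
  (g * (t / 2))%:E <= pot h x.
Proof.
move=> mF mh t0 g0 tx Fh; pose A := [set y | (2 `^ (alpha - N) / 2 * t)%:E <= pot F y].
have mA : measurable A.
  rewrite -[X in measurable X]setTI.
  exact: emeasurable_fun_c_infty (nneg_mfun_pot mF).1 _.
have t20 : (0 < t / 2)%R by rewrite divr_gt0.
have low : pot (F \_ (~` A)) x <= (t / 2)%:E.
  apply: le_trans (pot_truncate x mF t20); apply: le_pot.
  - by apply: nneg_mfun_restrict => //; exact: measurableC.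
  - apply: nneg_mfun_restrict => //; rewrite -[X in measurable X]setTI.
    exact: emeasurable_fun_infty_o (nneg_mfun_pot mF).1 _.
  move=> y; rewrite !patchE; case: ifPn => [|_]; last by case: ifP => // _; exact: mF.2.
  rewrite inE => /negP; rewrite -ltNge => fy; rewrite mem_set//=.
  by apply: lt_le_trans fy _; rewrite lee_fin mulrAC mulrA.
have up : (t / 2)%:E <= pot (F \_ A) x.
  move: tx; rewrite (pot_splitU x mA mF).
  have -> : t%:E = (t / 2)%:E + (t / 2)%:E by rewrite -EFinD; congr _%:E; field.
  by move=> h1; have := le_trans h1 (leeD (lexx _) low); rewrite leeD2rE.
apply: (@le_trans _ _ (g%:E * pot (F \_ A) x)).
  by rewrite EFinM; apply: lee_wpmul2l.
rewrite -potZ//; last exact: nneg_mfun_restrict.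
apply: le_pot => //; first by apply: nneg_mfunZ; rewrite ?lee_fin//; exact: nneg_mfun_restrict.
move=> y; rewrite patchE; case: ifPn => [|_]; last by rewrite mule0 mh.2.
by rewrite inE; exact: Fh.
Qed.

(** * Compositions with powers of potentials *)

Section composition.
Context (q : R) (q1 : (1 <= q)%R) (qs : (q < s)%R).

Let q0 : (0 < q)%R. Proof. exact: lt_le_trans q1. Qed.

(** The potential is capped at [M]: [M = 1] gives the sweeping functions, [M = +oo] the majorants of
    [u]. *)
Definition comp (M : \bar R) (F : T -> \bar R) y : \bar R :=
  F y * (mine (pot F y) M) `^ (s / q - 1).

Let r1 : (0 < s / q - 1)%R.
Proof. by rewrite subr_gt0 ltr_pdivlMr// mul1r. Qed.

Lemma nneg_mfun_comp M F : 0 <= M -> nneg_mfun F -> nneg_mfun (comp M F).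
Proof.
move=> M0 mF; apply: nneg_mfunM => //; apply: nneg_mfun_poweR.
split; last by move=> x; rewrite le_min pot_ge0.
by apply: measurable_mine => //; exact: measurable_pot.
Qed.

(** [pot_above] with the constant factor [(c * m)^(s / q - 1)]: since [c <= 1] and [m] is below both
    [t] and [M], the capped potential is at least [c * m] wherever [pot F >= c * t]. *)
Lemma pot_comp M F x (t m : R) : nneg_mfun F -> (0 < t)%R -> (0 <= m)%R ->
  (m <= t)%R -> m%:E <= M -> t%:E <= pot F x ->
  (kv (s / q) * m `^ (s / q - 1) * t)%:E <= pot (comp M F) x.
Proof.
move=> mF t0 m0 mt mM tx; set c : R := (2 `^ (alpha - N) / 2)%R.
have c0 : (0 < c)%R by rewrite divr_gt0// powR_gt0.
have c1 : (c <= 1)%R.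
  rewrite /c ler_pdivrMr// mul1r (@le_trans _ _ 1%R) ?ler1n//.
  rewrite -[leRHS](powRr0 2); apply: ler_powR; rewrite ?ler1n// subr_le0.
  exact: ltW.
have M0 : 0 <= M by apply: le_trans mM; rewrite lee_fin.
have -> : (kv (s / q) * m `^ (s / q - 1) * t = (c * m) `^ (s / q - 1) * (t / 2))%R.
  by rewrite (powRM _ (ltW c0) m0) /kv -/c; ring.
apply: (pot_above mF) => //; [exact: nneg_mfun_comp|exact: powR_ge0|].
move=> y cty; rewrite muleC; apply: lee_wpmul2l; first exact: mF.2.
rewrite -poweR_EFin; apply: le_poweR; [exact: ltW|by rewrite lee_fin mulr_ge0// ltW|].
rewrite le_min; apply/andP; split.
  by apply: le_trans cty; rewrite lee_fin ler_pM2l.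
by apply: le_trans mM; rewrite lee_fin ler_piMl.
Qed.

(** With [v = pot F x] and [m = min (v, M)], [pot_comp] bounds the potential below by
    [kv m^(s/q - 1) v]. The powers combine into [(m / v)^(s - q) <= 1]. If [v] is infinite, so is
    the potential of [comp M F], and its negative power is [0]. *)
Lemma comp_energy M F x : nneg_mfun F -> 0 < M -> comp M F x != 0 ->
  comp M F x `^ s * epow (pot (comp M F) x) (q - s) <=
  (kv (s / q) `^ (q - s))%:E * F x `^ s.
Proof.
move=> mF M0 hx; have [voo|] := eqVneq (pot F x) +oo.
  suff -> : pot (comp M F) x = +oo.
    have -> : epow +oo (q - s) = 0.
      by rewrite /epow leNgt subr_lt0 qs/= oppr_eq0 subr_eq0 (lt_eqF qs).
    by rewrite mule0; apply: mule_ge0; [rewrite lee_fin powR_ge0|exact: poweR_ge0].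
  have [m m0 mM] : exists2 m : R, (0 < m)%R & m%:E <= M.
    move: M0; case: (M) => [m m0||//]; first by exists m.
    by move=> _; exists 1%R; rewrite ?leey.
  apply/eqyP => A A0.
  pose b := (kv (s / q) * m `^ (s / q - 1))%R.
  have b0 : (0 < b)%R by rewrite mulr_gt0 ?kv_gt0 ?powR_gt0.
  pose t := (m + A / b)%R.
  have t0 : (0 < t)%R by rewrite addr_gt0// divr_gt0.
  have := @pot_comp M F x t m mF t0 (ltW m0) _ mM.
  rewrite voo leey => /(_ _ isT); rewrite lerDl divr_ge0 ?(ltW b0) ?(ltW A0)// => /(_ isT).
  apply: le_trans; rewrite lee_fin -/b mulrDr mulrCA divff ?gt_eqF// mulr1.
  by rewrite lerDr mulr_ge0 ?(ltW b0) ?(ltW m0).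
rewrite -ltey => voo.
have vfin : pot F x \is a fin_num by rewrite ge0_fin_numE ?pot_ge0.
pose v := fine (pot F x).
have v0 : (0 < v)%R.
  rewrite lt_neqAle fine_ge0 ?pot_ge0// andbT eq_sym; apply/negP => /eqP v0.
  move: hx; rewrite /comp -(fineK vfin) -/v v0 (_ : mine _ M = 0); last first.
    by apply/min_idPl; exact: ltW.
  by rewrite (poweR0r (lt0r_neq0 r1)) mule0 eqxx.
pose m := fine (mine (pot F x) M).
have mE : mine (pot F x) M = m%:E.
  rewrite /m fineK// ge0_fin_numE ?le_min ?pot_ge0 ?(ltW M0)//.
  by rewrite gt_min voo.
have m0 : (0 < m)%R.
  by rewrite -lte_fin -mE lt_min M0 -(fineK vfin) lte_fin v0.
have mv : (m <= v)%R by rewrite -lee_fin -mE /v fineK// ge_min lexx.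
have mM : m%:E <= M by rewrite -mE ge_min lexx orbT.
have vx : v%:E <= pot F x by rewrite /v fineK.
have low := pot_comp mF v0 (ltW m0) mv mM vx.
set b := (kv (s / q) * m `^ (s / q - 1) * v)%R in low.
have b0 : (0 < b)%R by rewrite mulr_gt0// mulr_gt0 ?kv_gt0 ?powR_gt0.
apply: (@le_trans _ _ (comp M F x `^ s * epow b%:E (q - s))).
  apply: lee_wpmul2l; first exact: poweR_ge0.
  by apply: epow_le0 low; [rewrite subr_le0 ltW|rewrite lee_fin ltW].
rewrite epow_EFin// /comp mE poweRM ?mF.2 ?poweR_ge0// !poweR_EFin.
rewrite -muleA muleC; apply: lee_wpmul2r; first exact: poweR_ge0.
rewrite -EFinM lee_fin /b.
have k0 := ltW (kv_gt0 (s / q)).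
have p0 : (0 <= m `^ (s / q - 1))%R by exact: powR_ge0.
rewrite (powRM _ (mulr_ge0 k0 p0) (ltW v0)) (powRM _ k0 p0) -!powRrM.
have -> : (m `^ ((s / q - 1) * s) * (kv (s / q) `^ (q - s) *
    m `^ ((s / q - 1) * (q - s)) * v `^ (q - s)) = kv (s / q) `^ (q - s) *
    (m `^ ((s / q - 1) * s) * m `^ ((s / q - 1) * (q - s)) * v `^ (q - s)))%R by ring.
rewrite -[leRHS]mulr1; apply: ler_wpM2l; first exact: powR_ge0.
rewrite -powRD; last by rewrite (gt_eqF m0) implybT.
have -> : ((s / q - 1) * s + (s / q - 1) * (q - s) = s - q)%R.
  by field; rewrite gt_eqF.
rewrite -(opprB s q) powRN ler_pdivrMr ?powR_gt0// mul1r.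
by rewrite ge0_ler_powR ?nnegrE ?subr_ge0 ?(ltW qs) ?(ltW m0) ?(ltW v0).
Qed.

Lemma energy_comp M F : nneg_mfun F -> 0 < M ->
  energy q (comp M F) (pot (comp M F)) <=
  (kv (s / q) `^ (q - s))%:E * \int[mu]_x (F x `^ s).
Proof.
move=> mF M0; have mh := nneg_mfun_comp (ltW M0) mF.
have mS := measurable_support mh.
have c0 : 0 <= (kv (s / q) `^ (q - s))%:E :> \bar R by rewrite lee_fin powR_ge0.
rewrite -int_nnegZ//; last exact: nneg_mfun_poweR.
apply: le_trans (le_int_setT _ mS); last by apply: nneg_mfunZ => //; exact: nneg_mfun_poweR.
apply: le_int_in => //.
- apply: nneg_mfunM; first exact: nneg_mfun_poweR.
  by apply: nneg_mfun_epow; exact: nneg_mfun_pot.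
- by apply: nneg_mfunZ => //; exact: nneg_mfun_poweR.
- by move=> x hx; exact: comp_energy.
Qed.

(* As [pot (comp 1 F)] is bounded below where [1 <= pot F], it serves as the
   sweeping potential attached to the set for which [F] is a capacitary test
   function. *)
Lemma capI_comp1 F (l : R) : nneg_mfun F -> \int[mu]_x (F x `^ s) < +oo -> (0 < l)%R ->
  capI [set x | l%:E < pot (comp 1 F) x] <=
  (2 `^ q * l `^ (- q) * (strong_const q * kv (s / q) `^ (q - s)))%:E *
    \int[mu]_x (F x `^ s).
Proof.
move=> mF Foo l0; have mh := nneg_mfun_comp (M := 1) lee01 mF.
(* The cap at [1] keeps [comp 1 F] below [F], hence in [L^s], and [tail_pot] then supplies the tail
   hypothesis of [strong_estimate]. *)
have hF y : comp 1 F y `^ s <= F y `^ s.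
  apply: le_poweR; [exact: ltW|exact: mh.2|].
  rewrite /comp -[leRHS]mule1; apply: lee_wpmul2l; first exact: mF.2.
  rewrite -[leRHS](poweR1r (s / q - 1)); apply: le_poweR; first exact: ltW.
    by rewrite le_min pot_ge0// lee01.
  by rewrite ge_min lexx orbT.
have hoo : \int[mu]_x (comp 1 F x `^ s) < +oo.
  by apply: le_lt_trans Foo; apply: le_int => //; exact: nneg_mfun_poweR.
have str := strong_estimate q1 (ltW qs) mh (fun e e0 => tail_pot mh hoo e0).
have [k /andP[k1 k2]] := dyadic_bracket l0.
apply: (@le_trans _ _ (capI (level (pot (comp 1 F)) k))).
  by apply: le_capI => x /=; apply: le_lt_trans; rewrite lee_fin.
have sc0 := strong_const_ge0 q1.
have t0 j : 0 <= (2 `^ (j%:~R * q))%:E * capI (level (pot (comp 1 F)) j).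
  by rewrite mule_ge0 ?capI_ge0// lee_fin powR_ge0.
have h1 : (2 `^ (k%:~R * q))%:E * capI (level (pot (comp 1 F)) k) <=
    (strong_const q * kv (s / q) `^ (q - s))%:E * \int[mu]_x (F x `^ s).
  apply: le_trans (@le_zsum_term _ (fun j => (2 `^ (j%:~R * q))%:E *
    capI (level (pot (comp 1 F)) j)) k t0) _.
  apply: le_trans str _; rewrite [X in _ <= X * _]EFinM -[leRHS]muleA.
  by apply: lee_wpmul2l; [rewrite lee_fin|exact: energy_comp].
have p0 : 0 <= (2 `^ (- (k%:~R * q)))%:E :> \bar R by rewrite lee_fin powR_ge0.
have := lee_wpmul2l p0 h1.
rewrite [X in X <= _]muleA -[X in X * _ <= _ -> _]EFinM -powR2D addNr powRr0 mul1e => h2.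
apply: le_trans h2 _; rewrite [X in X <= _]muleA -[X in X * _ <= _]EFinM.
apply: lee_wpmul2r; first by apply: integral_ge0 => x _; exact: poweR_ge0.
rewrite lee_fin; apply: ler_wpM2r; first by apply: mulr_ge0 => //; exact: powR_ge0.
have lk : (l `^ q <= 2 `^ ((k + 1)%:~R * q))%R.
  by rewrite powRrM ge0_ler_powR ?nnegrE ?powR_ge0 ?(ltW l0) ?(ltW q0)// ltW.
rewrite [leRHS]mulrC powRN ler_pdivlMl ?powR_gt0//.
apply: le_trans (ler_wpM2r (powR_ge0 _ _) lk) _; rewrite -powR2D le_eqVlt; apply/orP; left.
by apply/eqP; congr (_ `^ _)%R; rewrite intrD; ring.
Qed.

(** * The estimate with an external weight *)

Lemma tail_strong_sum (p : R) w (e : R) : (0 < p)%R -> strong_sum p w < +oo -> (0 < e)%R ->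
  exists m, capI (level w m) <= e%:E.
Proof.
move=> p0 woo e0; have t0 k : 0 <= (2 `^ (k%:~R * p))%:E * capI (level w k).
  by rewrite mule_ge0 ?capI_ge0// lee_fin powR_ge0.
have S0 : 0 <= strong_sum p w by exact: zsum_ge0.
have Sfin : strong_sum p w \is a fin_num by rewrite ge0_fin_numE.
set S := fine (strong_sum p w); have SE : strong_sum p w = S%:E by rewrite /S fineK.
have {}S0 : (0 <= S)%R by rewrite -lee_fin -SE.
have Se1 : (0 < S / e + 1)%R by rewrite ltr_wpDl// divr_ge0// ltW.
have [m /andP[_ Hm]] := dyadic_bracket (powR_gt0 p^-1 Se1).
exists (m + 1)%R; have := le_zsum_term (m + 1)%R t0.
rewrite -/(strong_sum p w) SE -lee_pdivlMl ?powR_gt0// => h; apply: le_trans h _.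
rewrite -EFinM lee_fin mulrC ler_pdivrMr ?powR_gt0//.
have h1 : (S / e + 1 <= 2 `^ ((m + 1)%:~R * p))%R.
  have -> : (S / e + 1 = ((S / e + 1) `^ p^-1) `^ p)%R.
    by rewrite -powRrM mulVf ?(lt0r_neq0 p0)// powRr1// ltW.
  rewrite powRrM ge0_ler_powR ?nnegrE ?powR_ge0 ?(ltW p0)//.
  exact: ltW.
by rewrite -ler_pdivrMl// mulrC (le_trans _ h1)// lerDl.
Qed.

Lemma near_optimal_family (E : int -> set T) (p e : R) : (0 < e)%R ->
  zsum (fun k => (2 `^ (k%:~R * p))%:E * capI (E k)) < +oo ->
  exists F : int -> T -> \bar R, [/\ forall k, nneg_mfun (F k),
    forall k x, E k x -> 1 <= pot (F k) x &
    zsum (fun k => (2 `^ (k%:~R * p))%:E * \int[mu]_x (F k x `^ s)) <=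
    zsum (fun k => (2 `^ (k%:~R * p))%:E * capI (E k)) + e%:E].
Proof.
move=> e0 Soo; have t0 k : 0 <= (2 `^ (k%:~R * p))%:E * capI (E k).
  by rewrite mule_ge0 ?capI_ge0// lee_fin powR_ge0.
pose idx (k : int) : nat := match k with Posz i | Negz i => i end.
(* Over the two halves of Z these errors add up to [e]. *)
pose d k : R := (e / 4 * 2^-1 ^+ idx k)%R.
have d0 k : (0 < d k)%R by rewrite mulr_gt0 ?divr_gt0// exprn_gt0// invr_gt0.
have ck k : capI (E k) < +oo.
  rewrite -(@lte_pmul2l _ (2 `^ (k%:~R * p))%:E) ?lte_fin ?powR_gt0//.
  rewrite gt0_muley ?lte_fin ?powR_gt0//.
  exact: le_lt_trans (le_zsum_term k t0) Soo.
have ek k : (0 < 2 `^ (- (k%:~R * p)) * d k)%R by rewrite mulr_gt0 ?powR_gt0.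
have [F HF] := choice (fun k => capI_approx (ek k) (ck k)).
exists F; split => [k|k|]; [by have [] := HF k|by have [] := HF k|].
apply: (@le_trans _ _ (zsum (fun k => (2 `^ (k%:~R * p))%:E * capI (E k) + (d k)%:E))).
  apply: le_zsum => k.
    by rewrite mule_ge0 ?lee_fin ?powR_ge0//; apply: integral_ge0 => x _; exact: poweR_ge0.
  have [_ _ h] := HF k; apply: le_trans (lee_wpmul2l _ h) _; first by rewrite lee_fin powR_ge0.
  rewrite ge0_muleDr ?capI_ge0 ?lee_fin ?(ltW (ek k))// -EFinM mulrA -powR2D subrr powRr0.
  by rewrite mul1r.
rewrite zsumD//; last by move=> k; rewrite lee_fin ltW.
apply: leeD => //; rewrite /zsum.
rewrite (@eq_eseriesr _ _ (fun i => (e / 2)%:E * (2^-1 ^+ i)%:E)); last first.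
  by move=> i _; rewrite /d/= -EFinD -EFinM; congr _%:E; field.
rewrite nneseriesZl; last by move=> i _; rewrite lee_fin exprn_ge0// invr_ge0.
have z01 : (0 <= (2^-1 : R) < 1)%R by rewrite invr_ge0 ler0n invf_lt1 ?ltr1n.
apply: le_trans (lee_wpmul2l _ (nneseries_geometric z01)) _.
  by rewrite lee_fin divr_ge0// ltW.
by rewrite -EFinM lee_fin le_eqVlt; apply/orP; left; apply/eqP; field.
Qed.

Lemma comp1_ge F x : nneg_mfun F -> 1 <= pot F x ->
  (kv (s / q))%:E <= pot (comp 1 F) x.
Proof.
move=> mF Fx; have := @pot_comp 1 F x 1 1 mF ltr01 ler01 (lexx _) (lexx _) Fx.
by rewrite powR1 !mulr1.
Qed.

(** [epow 0 (q - s)] is [+oo], so finite energy forces [f] to vanish almost everywhere on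
    [{w = 0}]. *)
Lemma energy_support f w : nneg_mfun f -> nneg_mfun w -> energy q f w < +oo ->
  mu.-negligible [set y | f y != 0 /\ w y = 0].
Proof.
move=> mf mw Eoo; have mS := measurable_support mf.
have mg : nneg_mfun (fun x => f x `^ s * epow (w x) (q - s)).
  by apply: nneg_mfunM; [exact: nneg_mfun_poweR|exact: nneg_mfun_epow].
have ig : mu.-integrable [set x | f x != 0] (fun x => f x `^ s * epow (w x) (q - s)).
  apply/integrableP; split; first exact: measurable_funTS mg.1.
  by under eq_integral => x _ do rewrite gee0_abs ?mg.2//.
have [Z [mZ Z0 hZ]] := integrable_ae mS ig.
exists Z; split => // y [fy wy]; apply: hZ => /(_ fy); rewrite wy.
have -> : epow 0 (q - s) = +oo.
  have sq : (s - q != 0)%R by rewrite subr_eq0 gt_eqF.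
  by rewrite /epow leNgt subr_lt0 qs opprB (poweR0r sq) inve0.
by rewrite gt0_muley// poweR_gt0// lt_neqAle eq_sym fy mf.2.
Qed.

(** The slabs below [m], of indices [m - 1 - i], miss only the points where [w = 0], and there [f]
    vanishes almost everywhere. *)
Lemma int_below_pieces f w (m : int) : nneg_mfun f -> nneg_mfun w ->
  mu.-negligible [set y | f y != 0 /\ w y = 0] ->
  \int[mu]_x ((f \_ (~` [set y | (2 `^ m%:~R)%:E <= w y])) x `^ s) <=
  \sum_(i <oo) \int[mu]_x (piece f w (m + Negz i)%R x `^ s).
Proof.
move=> mf mw [Z [mZ Z0 wZ]].
have mp i : nneg_mfun (fun x => piece f w (m + Negz i)%R x `^ s).
  by apply: nneg_mfun_poweR; exact: nneg_mfun_piece.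
set A := [set y | _].
have mA : measurable A.
  rewrite -[X in measurable X]setTI.
  exact: emeasurable_fun_c_infty mw.1 _.
have mfA : nneg_mfun (fun x => (f \_ (~` A)) x `^ s).
  by apply: nneg_mfun_poweR; apply: nneg_mfun_restrict => //; exact: measurableC.
rewrite -integral_nneseries//; last 2 first.
- by move=> i; exact: (mp i).1.
- by move=> i x _; exact: (mp i).2.
have S0 y : 0 <= \sum_(i <oo) piece f w (m + Negz i)%R y `^ s.
  by apply: nneseries_ge0 => i _ _; exact: (mp i).2.
apply: ae_ge0_le_integral => //.
- by move=> y _; exact: mfA.2.
- exact: mfA.1.
- by apply: ge0_emeasurable_sum => i *; [exact: (mp i).2|exact: (mp i).1].
exists Z; split => // y /= H; apply: wZ; apply: contrapT => /= fw; apply: H => _.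
rewrite patchE; case: ifPn => [|_]; last by rewrite poweR0r ?gt_eqF.
rewrite inE /A/= => /negP; rewrite -ltNge => wy.
have [->|fy] := eqVneq (f y) 0; first by rewrite poweR0r ?gt_eqF.
have wfin : w y \is a fin_num.
  by rewrite ge0_fin_numE ?mw.2//; apply: lt_trans wy (ltry _).
have w0 : (0 < fine (w y))%R.
  rewrite -lte_fin fineK// lt_neqAle mw.2 andbT eq_sym; apply/eqP => w0.
  by apply: fw.
have [m' /andP[h1 h2]] := dyadic_bracket w0.
have m'm : (m' < m)%R.
  rewrite ltNge; apply/negP => mm'; move: wy; rewrite -(fineK wfin) lte_fin => wy.
  have := le_lt_trans h1 wy; rewrite ltNge ler_powR ?ler1n//.
  by rewrite ler_int.
have [i mi] : exists i : nat, m' = (m + Negz i)%R.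
  exists `|(m - m' - 1)%R|%N; rewrite NegzE intS gez0_abs; first by ring.
  by rewrite -addrA -opprD subr_ge0 addrC lez1D.
apply: le_trans (@le_nneseries_term _ (fun i => piece f w (m + Negz i)%R y `^ s) i _).
  by rewrite /piece patchE mem_set// /slab/= -mi -(fineK wfin) lee_fin lte_fin h1.
by move=> j; exact: (mp j).2.
Qed.

Definition comp_const : R := (2 `^ q * (strong_const q * kv (s / q) `^ (q - s)))%R.

(** The midpoint of [(s - q) / sweep_exp s] and [1], so that [slope * sweep_exp s = s - q +
    step_rate q]. *)
Definition slope : R := ((1 + (s - q) / sweep_exp s) / 2)%R.

Definition weight_const : R :=
  (sweep_const * ((1 - 2 `^ (- (step_rate q / 2 / s))) / 4) `^ (- s) *
   (kv (s / q))^-1 `^ sweep_exp s)%R.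

Let sigma0 : (0 < sweep_exp s)%R.
Proof. by have := sweep_exp_gt; have := s1; lra. Qed.

Lemma slope_lt1 : (slope < 1)%R.
Proof.
rewrite /slope ltr_pdivrMr// mul1r -[X in (_ < X)%R]/(1 + 1)%R ltrD2l.
by rewrite (ltr_pdivrMr _ _ sigma0) mul1r; have := sweep_exp_gt; have := q1; lra.
Qed.

(** The three sums have three sources. The part of [f] below the level [2^k] of [w] is a test
    function as it stands; the pieces above are swept with the functions [comp 1 (F m)]; the last
    sum pays for the points where one of the sweeping potentials is too large. *)
Lemma capI_weighted_step w f F (k : int) : nneg_mfun f -> nneg_mfun w ->
  (forall m, nneg_mfun (F m)) ->
  (forall m x, (2 `^ m%:~R)%:E <= w x -> 1 <= pot (F m) x) ->
  (forall m, \int[mu]_x (F m x `^ s) < +oo) ->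
  mu.-negligible [set y | w y = +oo] ->
  mu.-negligible [set y | f y != 0 /\ w y = 0] ->
  capI (level (pot f) k) <=
  (2 `^ (k%:~R * - s))%:E *
    ((2 `^ s)%:E * \sum_(i <oo) 1%:E * \int[mu]_x (piece f w (k + Negz i)%R x `^ s) +
     weight_const%:E * \sum_(i <oo) (2 `^ (i%:R * (q - s - step_rate q / 2)))%:E *
       \int[mu]_x (piece f w (k + i%:Z)%R x `^ s)) +
  comp_const%:E * \sum_(i <oo) (2 `^ (i%:R * (slope * q)))%:E *
    \int[mu]_x (F (k + i%:Z)%R x `^ s).
Proof.
move=> mf mw mF FE Foo woo w0; pose eta : R := (step_rate q / 2 / s)%R.
have sr0 := step_rate_gt0 q1.
have eta0 : (0 < eta)%R by apply: divr_gt0 => //; exact: divr_gt0.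
pose z : R := (2 `^ (- eta))%R.
have z01 : (0 <= z < 1)%R by exact: powR2_itv.
have /andP[z0 z1] := z01.
have z_gt0 : (0 < z)%R by rewrite powR_gt0.
pose g i := piece f w (k + i%:Z)%R.
have mg i : nneg_mfun (g i) by exact: nneg_mfun_piece.
have g0 i : 0 <= \int[mu]_x (g i x `^ s).
  by apply: integral_ge0 => x _; exact: poweR_ge0.
pose l (i : nat) : R := (2 `^ (- (slope * i%:R)))%R.
have l0 i : (0 < l i)%R by rewrite powR_gt0.
(* On [D] all sweeping potentials are small at once, so that every piece of the series can be swept
   there. *)
pose D := [set x | forall i, pot (comp 1 (F (k + i%:Z)%R)) x <= (l i)%:E].
pose t : R := (2 `^ k%:~R / 2)%R.
have t0 : (0 < t)%R by rewrite divr_gt0// powR_gt0.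
have t2 : (t + t = 2 `^ k%:~R)%R by rewrite /t; field.
pose A := [set y | (2 `^ k%:~R)%:E <= w y].
have mA : measurable A.
  rewrite -[X in measurable X]setTI.
  exact: emeasurable_fun_c_infty mw.1 _.
have mfA : nneg_mfun (f \_ (~` A)) by apply: nneg_mfun_restrict => //; exact: measurableC.
apply: (@le_trans _ _ (capI (([set x | t%:E <= pot (f \_ (~` A)) x] `|`
    [set x | D x /\ t%:E <= \sum_(i <oo) pot (g i) x]) `|`
    \bigcup_i [set x | (l i)%:E < pot (comp 1 (F (k + i%:Z)%R)) x]))).
  apply: le_capI => x kx.
  have /orP[low|low] := le_total t%:E (pot (f \_ (~` A)) x); first by left; left.
  have [Dx|/existsNP[i /negP]] := pselect (D x); last by rewrite -ltNge => h; right; exists i.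
  left; right; split => //; apply: le_trans (pot_pieces k x mf mw woo).
  have h : t%:E + t%:E <= pot f x by rewrite -EFinD t2 ltW.
  move: h; rewrite (pot_splitU x mA mf) => h.
  have := le_trans h (leeD (lexx _) low); rewrite leeD2rE//; exact.
apply: le_trans (capIU _ _) _; apply: leeD; last first.
  apply: le_trans (capI_sigma_subadditive _) _.
  rewrite ge0_nneseriesZl; last 2 first.
  - by rewrite lee_fin mulr_ge0 ?powR_ge0// mulr_ge0 ?powR_ge0// strong_const_ge0.
  - move=> i; rewrite mule_ge0 ?lee_fin ?powR_ge0//.
    by apply: integral_ge0 => x _; exact: poweR_ge0.
  apply: lee_nneseries => i _; first by move=> _; exact: capI_ge0.
  apply: le_trans (capI_comp1 (mF _) (Foo _) (l0 i)) _.
  rewrite muleA -EFinM; apply: lee_wpmul2r.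
    by apply: integral_ge0 => x _; exact: poweR_ge0.
  rewrite lee_fin /comp_const /l -powRrM.
  have -> : (- (slope * i%:R) * - q = i%:R * (slope * q))%R by ring.
  by rewrite le_eqVlt; apply/orP; left; apply/eqP; ring.
apply: le_trans (capIU _ _) _.
rewrite ge0_muleDr; last 2 first.
- apply: mule_ge0; first by rewrite lee_fin powR_ge0.
  by apply: nneseries_ge0 => i _ _; rewrite mul1e; apply: integral_ge0 => x _; exact: poweR_ge0.
- apply: mule_ge0.
    by rewrite lee_fin mulr_ge0 ?powR_ge0// mulr_ge0 ?powR_ge0// ltW// sweep_const_gt0.
  apply: nneseries_ge0 => i _ _; apply: mule_ge0; last exact: g0.
  by rewrite lee_fin powR_ge0.
apply: leeD.
  apply: le_trans (capI_le mfA t0 _) _; first by move=> x.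
  have -> : (t `^ (- s) = 2 `^ (k%:~R * - s) * 2 `^ s)%R.
    have -> : t = (2 `^ (k%:~R - 1))%R by rewrite /t powR2D powR_inv1.
    by rewrite -powRrM -powR2D; congr (_ `^ _)%R; ring.
  rewrite EFinM -muleA; apply: lee_wpmul2l; first by rewrite lee_fin powR_ge0.
  apply: lee_wpmul2l; first by rewrite lee_fin powR_ge0.
  apply: le_trans (int_below_pieces k mf mw w0) _.
  by under [leRHS]eq_eseriesr => i _ do rewrite mul1e.
apply: le_trans (capI_pot_series D t0 z01 mg) _.
have wc0 : (0 <= weight_const)%R.
  by rewrite mulr_ge0 ?powR_ge0// mulr_ge0 ?powR_ge0// ltW// sweep_const_gt0.
rewrite muleA -EFinM ge0_nneseriesZl; last 2 first.
- by rewrite lee_fin mulr_ge0 ?powR_ge0.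
- by move=> i; apply: mule_ge0; [rewrite lee_fin powR_ge0|exact: g0].
apply: lee_nneseries => i _; first by move=> _; exact: capI_ge0.
have ti0 : (0 < t * (1 - z) / 2 * z ^+ i)%R.
  by rewrite mulr_gt0 ?exprn_gt0// divr_gt0// mulr_gt0// subr_gt0.
have mh : nneg_mfun (comp 1 (F (k + i%:Z)%R)) by exact: nneg_mfun_comp.
apply: (@le_trans _ _ (capI [set x | pot (comp 1 (F (k + i%:Z)%R)) x <= (l i)%:E /\
    (t * (1 - z) / 2 * z ^+ i)%:E <= pot (g i) x])).
  by apply: le_capI => x [Dx hx]; split.
apply: le_trans (capI_sweep mh (mg i) (l0 i) (kv_gt0 (s / q)) ti0 _) _.
  move=> y; rewrite /g /piece patchE; case: ifPn; last by rewrite eqxx.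
  by rewrite inE => /andP[wy _] _; apply: comp1_ge => //; exact: FE.
rewrite muleA -!EFinM lee_wpmul2r// lee_fin /weight_const -/eta -/z.
have -> : (t * (1 - z) / 2 * z ^+ i = 2 `^ k%:~R * ((1 - z) / 4) * z ^+ i)%R.
  by rewrite /t; field.
have y0 : (0 <= (1 - z) / 4)%R by rewrite divr_ge0// subr_ge0 ltW.
have p0 : (0 <= 2 `^ k%:~R :> R)%R by exact: powR_ge0.
rewrite (powRM _ (mulr_ge0 p0 y0) (exprn_ge0 i z0)) (powRM _ p0 y0) -[in X in (X <= _)%R]powRrM.
have es : (eta * s = step_rate q / 2)%R by rewrite /eta divfK// gt_eqF.
have -> : ((z ^+ i) `^ (- s) = 2 `^ (i%:R * (step_rate q / 2)))%R.
  by rewrite /z -powR2_natM -powRrM -es; congr (_ `^ _)%R; ring.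
have ki0 : (0 <= (kv (s / q))^-1)%R by rewrite invr_ge0 ltW// kv_gt0.
rewrite (powRM _ (ltW (l0 i)) ki0) /l -[in X in (X <= _)%R]powRrM.
have -> : (2 `^ (i%:R * (q - s - step_rate q / 2)) =
    2 `^ (i%:R * (step_rate q / 2)) * 2 `^ (- (slope * i%:R) * sweep_exp s) :> R)%R.
  rewrite -powR2D; congr (_ `^ _)%R; rewrite /slope /step_rate; field.
  by rewrite gt_eqF.
by rewrite le_eqVlt; apply/orP; left; apply/eqP; ring.
Qed.

(* With [F m] near-optimal for [level w (m - 1)], the part of [f] living where
   [w] is about [2^(k + i)] is swept out of [pot (comp 1 (F (k + i))) <= l i] with
   [l i = 2^(- slope i)]: the capacity of the complementary sets grows like
   [2^(slope q i)], which [slope < 1] makes summable against [2^(- q i)], while the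
   gain [l i ^ sweep_exp s] beats the factor [2^((s - q) i)]. *)
Lemma weighted_estimate (K : R) : (0 <= K)%R -> exists2 C : R, (0 < C)%R & forall w f,
  nneg_mfun w -> nneg_mfun f -> strong_sum q w <= K%:E ->
  strong_sum q (pot f) <= C%:E * (1 + energy q f w).
Proof.
move=> K0; pose z1 : R := (2 `^ (- (s - q)))%R.
pose z2 : R := (2 `^ (- (step_rate q / 2)))%R.
pose z3 : R := (2 `^ (- ((1 - slope) * q)))%R.
have sr0 := step_rate_gt0 q1.
have z1P : (0 <= z1 < 1)%R by apply: powR2_itv; rewrite subr_gt0.
have z2P : (0 <= z2 < 1)%R by apply: powR2_itv; rewrite divr_gt0.
have z3P : (0 <= z3 < 1)%R.
  by apply: powR2_itv; rewrite mulr_gt0// subr_gt0 slope_lt1.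
have wc0 : (0 <= weight_const)%R.
  by rewrite mulr_ge0 ?powR_ge0// mulr_ge0 ?powR_ge0// ltW// sweep_const_gt0.
have cc0 : (0 <= comp_const)%R.
  by rewrite mulr_ge0 ?powR_ge0// mulr_ge0 ?powR_ge0// strong_const_ge0.
pose K1 : R := ((2 `^ s * (z1 / (1 - z1)) + weight_const * (1 / (1 - z2))) * (2 * 2 `^ (s - q)))%R.
pose K2 : R := (comp_const * (1 / (1 - z3)) * (2 `^ q * K + 1))%R.
have d0 z : (0 <= z < 1)%R -> (0 <= 1 / (1 - z) :> R)%R.
  by move=> /andP[_ h]; rewrite divr_ge0// subr_ge0 ltW.
have z1d : (0 <= z1 / (1 - z1))%R.
  by have /andP[h h'] := z1P; rewrite divr_ge0// subr_ge0 ltW.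
have K10 : (0 <= K1)%R.
  rewrite mulr_ge0 ?mulr_ge0 ?powR_ge0// addr_ge0//.
    by rewrite mulr_ge0 ?powR_ge0.
  by rewrite mulr_ge0 ?d0.
have K20 : (0 <= K2)%R.
  apply: mulr_ge0; first by apply: mulr_ge0 => //; exact: d0.
  by apply: addr_ge0 => //; apply: mulr_ge0 => //; exact: powR_ge0.
exists (K1 + K2 + 1)%R; first by rewrite ltr_wpDl// addr_ge0.
move=> w f mw mf w1.
have E0 : 0 <= energy q f w.
  by apply: integral_ge0 => x _; rewrite mule_ge0 ?poweR_ge0 ?epow_ge0.
have C0 : (0 < K1 + K2 + 1)%R by rewrite ltr_wpDl// addr_ge0.
have [Eoo|] := eqVneq (energy q f w) +oo.
  by rewrite Eoo addey// gt0_muley ?leey.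
rewrite -ltey => Eoo.
have woo : strong_sum q w < +oo by apply: le_lt_trans w1 (ltry _).
have nw := negligible_oo (fun e e0 => tail_strong_sum q0 woo e0).
have nf := energy_support mf mw Eoo.
have t0 k : 0 <= (2 `^ (k%:~R * q))%:E * capI (level w (k - 1)%R).
  by rewrite mule_ge0 ?capI_ge0// lee_fin powR_ge0.
(* The family is built for [level w (k - 1)] because the strict inequality in [level w k] misses the
   points with [w = 2^k]; the shift costs [2^q]. *)
have sh : zsum (fun k => (2 `^ (k%:~R * q))%:E * capI (level w (k - 1)%R)) =
    (2 `^ q)%:E * strong_sum q w.
  rewrite -(zsumZ _ (powR_ge0 _ _)); last first.
    by move=> k; rewrite mule_ge0 ?capI_ge0// lee_fin powR_ge0.
  rewrite -(zsumS t0); congr zsum; apply/funext => k; rewrite addrK muleA -EFinM -powR2D.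
  by congr ((_ `^ _)%:E * _); rewrite intrD; ring.
have shle : (2 `^ q)%:E * strong_sum q w <= (2 `^ q * K)%:E.
  by rewrite [leRHS]EFinM; apply: lee_wpmul2l; rewrite // lee_fin powR_ge0.
have [|F [mF FE Fle]] := @near_optimal_family (fun k => level w (k - 1)%R) q 1 ltr01.
  by rewrite sh; apply: le_lt_trans shle (ltry _).
have {}Fle := le_trans Fle (leeD (_ : _ <= (2 `^ q * K)%:E) (lexx _)).
move: Fle; rewrite sh -EFinD => /(_ shle) Fle.
pose a k := \int[mu]_x (F k x `^ s).
have a0 k : 0 <= a k by apply: integral_ge0 => x _; exact: poweR_ge0.
have ta0 k : 0 <= (2 `^ (k%:~R * q))%:E * a k by rewrite mule_ge0// lee_fin powR_ge0.
pose Y k := \int[mu]_x (piece f w k x `^ s).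
have Y0 k : 0 <= Y k by apply: integral_ge0 => x _; exact: poweR_ge0.
have aoo k : a k < +oo.
  rewrite -(@lte_pmul2l _ (2 `^ (k%:~R * q))%:E) ?lte_fin ?powR_gt0//.
  rewrite gt0_muley ?lte_fin ?powR_gt0//.
  by apply: le_lt_trans (le_zsum_term k ta0) _; apply: le_lt_trans Fle (ltry _).
have FE' m x : (2 `^ m%:~R)%:E <= w x -> 1 <= pot (F m) x.
  move=> wx; apply: FE; apply: lt_le_trans wx; rewrite lte_fin.
  have -> : (m%:~R = (m - 1)%:~R + 1 :> R)%R by rewrite intrB subrK.
  rewrite powR2D powRr1//.
  by rewrite ltr_pMr ?powR_gt0// ltr1n.
pose S1 k := \sum_(i <oo) 1%:E * Y (k + Negz i)%R.
pose S2 k := \sum_(i <oo) (2 `^ (i%:R * (q - s - step_rate q / 2)))%:E * Y (k + i%:Z)%R.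
pose S3 k := \sum_(i <oo) (2 `^ (i%:R * (slope * q)))%:E * a (k + i%:Z)%R.
have S10 k : 0 <= S1 k by apply: nneseries_ge0 => i _ _; rewrite mul1e.
have S20 k : 0 <= S2 k.
  by apply: nneseries_ge0 => i _ _; rewrite mule_ge0 ?lee_fin ?powR_ge0.
have S30 k : 0 <= S3 k.
  by apply: nneseries_ge0 => i _ _; rewrite mule_ge0 ?lee_fin ?powR_ge0.
have p0 (x : R) : 0 <= (2 `^ x)%:E :> \bar R by rewrite lee_fin powR_ge0.
have EP := energy_pieces (ltW qs) mf mw.
have H1 : zsum (fun k => (2 `^ (k%:~R * (q - s)))%:E * S1 k) <=
    (z1 / (1 - z1) * (2 * 2 `^ (s - q)))%:E * energy q f w.
  have /andP[z1_ge0 _] := z1P.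
  apply: le_trans (@zsum_layers R Y (fun=> 1%R) Negz (q - s) z1 z1 Y0 (fun=> ler01) z1P z1_ge0 _) _.
    move=> i; rewrite mul1r /z1 -powR2_natM -powR2D le_eqVlt; apply/orP; left; apply/eqP.
    by congr (_ `^ _)%R; rewrite NegzE intrN -pmulrn -natr1; ring.
  by rewrite [X in _ <= X * _]EFinM -[leRHS]muleA; apply: lee_wpmul2l; rewrite ?lee_fin.
have H2 : zsum (fun k => (2 `^ (k%:~R * (q - s)))%:E * S2 k) <=
    (1 / (1 - z2) * (2 * 2 `^ (s - q)))%:E * energy q f w.
  apply: le_trans (@zsum_layers R Y (fun i => 2 `^ (i%:R * (q - s - step_rate q / 2)))%R
    Posz (q - s) 1 z2 Y0 (fun=> powR_ge0 _ _) z2P ler01 _) _.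
    move=> i; rewrite mul1r /z2 -powR2_natM -powR2D le_eqVlt; apply/orP; left; apply/eqP.
    by congr (_ `^ _)%R; rewrite -pmulrn; ring.
  by rewrite [X in _ <= X * _]EFinM -[leRHS]muleA; apply: lee_wpmul2l; rewrite ?lee_fin ?d0.
have H3 : zsum (fun k => (2 `^ (k%:~R * q))%:E * S3 k) <=
    (1 / (1 - z3) * (2 `^ q * K + 1))%:E.
  apply: le_trans (@zsum_layers R a (fun i => 2 `^ (i%:R * (slope * q)))%R
    Posz q 1 z3 a0 (fun=> powR_ge0 _ _) z3P ler01 _) _.
    move=> i; rewrite mul1r /z3 -powR2_natM -powR2D le_eqVlt; apply/orP; left; apply/eqP.
    by congr (_ `^ _)%R; rewrite -pmulrn; ring.
  by rewrite [leRHS]EFinM; apply: lee_wpmul2l; rewrite ?lee_fin ?d0.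
have step k : capI (level (pot f) k) <= (2 `^ (k%:~R * - s))%:E *
    ((2 `^ s)%:E * S1 k + weight_const%:E * S2 k) + comp_const%:E * S3 k.
  exact: capI_weighted_step mf mw mF FE' aoo nw nf.
clearbody S1 S2 S3.
apply: (@le_trans _ _ (zsum (fun k =>
    ((2 `^ s)%:E * ((2 `^ (k%:~R * (q - s)))%:E * S1 k) +
     weight_const%:E * ((2 `^ (k%:~R * (q - s)))%:E * S2 k)) +
    comp_const%:E * ((2 `^ (k%:~R * q))%:E * S3 k)))).
  apply: le_zsum => k; first by rewrite mule_ge0 ?capI_ge0.
  apply: le_trans (lee_wpmul2l (p0 _) (step k)) _.
  rewrite ge0_muleDr; last 2 first.
  - by rewrite !(mule_ge0, adde_ge0)// lee_fin.
  - by rewrite mule_ge0// lee_fin.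
  rewrite muleA -EFinM -powR2D -mulrDr -/(q - s)%R.
  rewrite ge0_muleDr; last 2 first.
  - by rewrite mule_ge0.
  - by rewrite mule_ge0// lee_fin.
  by rewrite [X in X + _ + _]muleCA [X in _ + X + _]muleCA [X in _ + _ + X]muleCA.
have u1 k : 0 <= (2 `^ (k%:~R * (q - s)))%:E * S1 k by rewrite mule_ge0.
have u2 k : 0 <= (2 `^ (k%:~R * (q - s)))%:E * S2 k by rewrite mule_ge0.
have u3 k : 0 <= (2 `^ (k%:~R * q))%:E * S3 k by rewrite mule_ge0.
rewrite zsumD; last 2 first.
- by move=> k; rewrite adde_ge0// mule_ge0// lee_fin.
- by move=> k; rewrite mule_ge0// lee_fin.
rewrite zsumD; last 2 first.
- by move=> k; rewrite mule_ge0.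
- by move=> k; rewrite mule_ge0// lee_fin.
rewrite !zsumZ ?powR_ge0//.
apply: (@le_trans _ _ (K1%:E * energy q f w + K2%:E)).
  apply: leeD; last by rewrite /K2 -mulrA [leRHS]EFinM; apply: lee_wpmul2l; rewrite ?lee_fin.
  apply: le_trans (leeD (lee_wpmul2l (p0 s) H1) (lee_wpmul2l (_ : 0 <= weight_const%:E) H2)) _.
    by rewrite lee_fin.
  rewrite !muleA -!EFinM -ge0_muleDl ?lee_fin; last 2 first.
  - apply: mulr_ge0; first exact: powR_ge0.
    by apply: mulr_ge0 => //; apply: mulr_ge0; rewrite ?powR_ge0.
  - apply: mulr_ge0 => //; apply: mulr_ge0; first exact: d0.
    by apply: mulr_ge0; rewrite ?powR_ge0.
  rewrite -EFinD le_eqVlt; apply/orP; left; apply/eqP; congr (_%:E * _).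
  by rewrite /K1; ring.
apply: (@le_trans _ _ ((K1 + K2 + 1)%:E * energy q f w + (K1 + K2 + 1)%:E)).
  apply: leeD; first by apply: lee_wpmul2r => //; rewrite lee_fin -addrA lerDl addr_ge0.
  by rewrite lee_fin addrAC lerDr addr_ge0.
by rewrite addeC -[X in X + _]mule1 -(ge0_muleDr _ lee01 E0).
Qed.

(** * Majorants built from near-optimal test functions *)

(** [pot_comp] at [m = t = pot F x], or at arbitrarily large [t] when the potential is infinite. *)
Lemma pot_comp_oo F x : nneg_mfun F ->
  (kv (s / q))%:E * pot F x `^ (s / q) <= pot (comp +oo F) x.
Proof.
move=> mF; have k0 := kv_gt0 (s / q).
have sq0 : (0 < s / q)%R by rewrite divr_gt0.
have low (t : R) : (0 < t)%R -> t%:E <= pot F x ->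
    (kv (s / q) * t `^ (s / q))%:E <= pot (comp +oo F) x.
  move=> t0 tx; have := pot_comp mF t0 (ltW t0) (lexx t) (leey _) tx.
  rewrite -mulrA -[X in (_ * (_ * X))%R](powRr1 (ltW t0)) -powRD; last first.
    by rewrite (gt_eqF t0) implybT.
  by rewrite subrK.
have [voo|] := eqVneq (pot F x) +oo.
  suff -> : pot (comp +oo F) x = +oo by rewrite leey.
  apply/eqyP => A A0; pose t : R := ((A / kv (s / q)) `^ (s / q)^-1)%R.
  have Ak0 : (0 < A / kv (s / q))%R by rewrite divr_gt0.
  have t0 : (0 < t)%R by rewrite powR_gt0.
  have := low t t0; rewrite voo leey => /(_ isT); apply: le_trans.
  rewrite lee_fin /t -powRrM mulVf ?gt_eqF// powRr1 ?(ltW Ak0)//.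
  by rewrite mulrC divfK ?gt_eqF.
rewrite -ltey => voo.
have vfin : pot F x \is a fin_num by rewrite ge0_fin_numE ?pot_ge0.
have v0 : (0 <= fine (pot F x))%R by rewrite fine_ge0 ?pot_ge0.
move: v0; rewrite le_eqVlt => /predU1P[v0|v0].
  by rewrite -(fineK vfin) -v0 poweR0r ?gt_eqF// mule0 pot_ge0//; exact: nneg_mfun_comp.
by have := low _ v0; rewrite fineK// lexx => /(_ isT); rewrite EFinM -poweR_EFin fineK.
Qed.

(** The total exponent of [v = pot F] is [(s/q - 1) s + (s/q) (q - s) = 0]: only [F^s] and the power
    of [b] survive. *)
Lemma energy_comp_weight F (b : R) : nneg_mfun F -> (0 < b)%R ->
  energy q (comp +oo F) (fun x => (b^-1)%:E * pot F x `^ (s / q)) <=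
  (b `^ (s - q))%:E * \int[mu]_x (F x `^ s).
Proof.
move=> mF b0; have mh := nneg_mfun_comp (leey 0) mF.
have mS := measurable_support mh.
have mv := nneg_mfun_pot mF.
have bi0 : (0 < b^-1)%R by rewrite invr_gt0.
have mw : nneg_mfun (fun x => (b^-1)%:E * pot F x `^ (s / q)).
  by apply: nneg_mfunZ; [rewrite lee_fin ltW|exact: nneg_mfun_poweR].
have c0 : 0 <= (b `^ (s - q))%:E :> \bar R by rewrite lee_fin powR_ge0.
rewrite -int_nnegZ//; last exact: nneg_mfun_poweR.
apply: le_trans (le_int_setT _ mS); last by apply: nneg_mfunZ => //; exact: nneg_mfun_poweR.
apply: le_int_in => //.
- by apply: nneg_mfunM; [exact: nneg_mfun_poweR|exact: nneg_mfun_epow].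
- by apply: nneg_mfunZ => //; exact: nneg_mfun_poweR.
move=> x /= hx; have [voo|] := eqVneq (pot F x) +oo.
  have -> : epow ((b^-1)%:E * pot F x `^ (s / q)) (q - s) = 0.
    rewrite voo poweRyr ?gt_eqF ?divr_gt0// gt0_muley ?lte_fin//.
    by rewrite /epow leNgt subr_lt0 qs/= oppr_eq0 subr_eq0 (lt_eqF qs).
  by rewrite mule0; apply: mule_ge0 => //; exact: poweR_ge0.
rewrite -ltey => voo.
have vfin : pot F x \is a fin_num by rewrite ge0_fin_numE ?pot_ge0.
pose v := fine (pot F x).
have v0 : (0 < v)%R.
  rewrite lt_neqAle fine_ge0 ?pot_ge0// andbT eq_sym; apply/negP => /eqP v0.
  move: hx; rewrite /comp -(fineK vfin) -/v v0 (_ : mine _ +oo = 0); last first.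
    by apply/min_idPl; exact: leey.
  by rewrite (poweR0r (lt0r_neq0 r1)) mule0 eqxx.
have p0 t : (0 <= v `^ t)%R by exact: powR_ge0.
rewrite /comp -(fineK vfin) -/v (_ : mine v%:E +oo = v%:E); last first.
  by apply/min_idPl; exact: leey.
rewrite poweRM ?mF.2 ?poweR_ge0// !poweR_EFin -EFinM epow_EFin ?mulr_gt0 ?powR_gt0//.
rewrite -muleA muleC; apply: lee_wpmul2r; first exact: poweR_ge0.
rewrite -EFinM lee_fin (powRM _ (ltW bi0) (p0 _)) -!powRrM.
rewrite -(opprB s q) (powRVN _ (ltW b0)).
rewrite mulrCA -powRD; last by rewrite (gt_eqF v0) implybT.
have -> : ((s / q - 1) * s + s / q * - (s - q) = 0)%R by field; rewrite gt_eqF.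
by rewrite powRr0 mulr1.
Qed.

(** [F] is the [l^s] sum of the functions [2^((k + 2) q / s) F_k]. The shift by [2] has room for
    points with [2^k <= |u| < 2^(k + 1)], which are only certain to lie in [{|u| > 2^(k - 1)}]; it
    costs [2^(2 q)]. *)
Lemma majorant (E : int -> set T) (e : R) : (0 < e)%R ->
  zsum (fun k => (2 `^ (k%:~R * q))%:E * capI (E k)) < +oo ->
  exists F, [/\ nneg_mfun F,
    forall k x, E k x -> (2 `^ ((k + 2)%:~R * (q / s)))%:E <= pot F x &
    \int[mu]_x (F x `^ s) <= (2 `^ (2 * q))%:E *
      (zsum (fun k => (2 `^ (k%:~R * q))%:E * capI (E k)) + e%:E)].
Proof.
move=> e0 Soo; have [F [mF FE Fle]] := near_optimal_family e0 Soo.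
pose c (k : int) : R := (2 `^ ((k + 2)%:~R * (q / s)))%R.
have c0 k : 0 <= (c k)%:E by rewrite lee_fin powR_ge0.
pose G k x := (c k)%:E * F k x.
have mG k : nneg_mfun (G k) by exact: nneg_mfunZ.
have mGs k : nneg_mfun (fun x => G k x `^ s) by exact: nneg_mfun_poweR.
pose H x := zsum (fun k => G k x `^ s).
have H0 x : 0 <= H x by apply: zsum_ge0 => k; exact: poweR_ge0.
have mP i : nneg_mfun (fun x => G (Posz i) x `^ s + G (Negz i) x `^ s).
  by split => [|x]; [apply: emeasurable_funD; exact: (mGs _).1|rewrite adde_ge0 ?poweR_ge0].
have mH : nneg_mfun H.
  by split => //; apply: ge0_emeasurable_sum => i *; [exact: (mP i).2|exact: (mP i).1].
have si0 : (0 < s^-1)%R by rewrite invr_gt0.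
exists (fun x => H x `^ s^-1).
have mHs : nneg_mfun (fun x => H x `^ s^-1) by exact: nneg_mfun_poweR.
split => //.
  move=> k x Ekx; rewrite -[leLHS]mule1 -/(c k).
  apply: le_trans (lee_wpmul2l (c0 k) (FE k x Ekx)) _; rewrite -potZ ?powR_ge0//.
  rewrite -/(G k); apply: (le_pot x (mG k) mHs) => y.
  have sn0 : s != 0%R by exact: lt0r_neq0.
  rewrite -[leLHS](poweRK ((mG k).2 y) sn0).
  apply: le_poweR; [exact: ltW|exact: poweR_ge0|].
  exact: (@le_zsum_term _ (fun k => G k y `^ s) k (fun=> poweR_ge0 _ _)).
under eq_integral => x _ do rewrite -poweRrM mulVf ?gt_eqF// poweRe1//.
rewrite /H /zsum integral_nneseries//; last 2 first.
- by move=> i; exact: (mP i).1.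
- by move=> i x _; exact: (mP i).2.
apply: le_trans (lee_wpmul2l _ Fle); last by rewrite lee_fin powR_ge0.
have a0 k : 0 <= \int[mu]_x (F k x `^ s).
  by apply: integral_ge0 => x _; exact: poweR_ge0.
rewrite -zsumZ ?powR_ge0//; last first.
  by move=> k; apply: mule_ge0 => //; rewrite lee_fin powR_ge0.
apply: lee_nneseries => [i _ _|i _]; first by apply: integral_ge0 => x _; exact: (mP i).2.
have EG k : \int[mu]_x (G k x `^ s) =
    (2 `^ (2 * q))%:E * ((2 `^ (k%:~R * q))%:E * \int[mu]_x (F k x `^ s)).
  under eq_integral => x _ do rewrite /G poweRM ?(mF k).2// poweR_EFin.
  rewrite int_nnegZ ?lee_fin ?powR_ge0//; last exact: nneg_mfun_poweR.
  rewrite muleA -EFinM; congr (_%:E * _); rewrite /c -powRrM -powR2D; congr (_ `^ _)%R.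
  by rewrite intrD; field; rewrite gt_eqF.
rewrite ge0_integralD//; last 4 first.
- by move=> x _; exact: poweR_ge0.
- exact: (mGs _).1.
- by move=> x _; exact: poweR_ge0.
- exact: (mGs _).1.
by rewrite !EG.
Qed.

(** * Kernels comparable to a power of the distance *)

(* A set [D] and a function [u] stand for a q.e. defined function with domain [D]
   and values [u]. *)
Section comparable_kernel.
Context (rker : T -> T -> \bar R) (gam upp : R) (gam0 : (0 < gam)%R) (upp0 : (0 < upp)%R)
  (mrker : measurable_fun [set: T * T] (fun p => rker p.1 p.2))
  (kern_le_rker : forall x y, kern x y <= rker x y)
  (rker_le : forall x y, rker x y <= upp%:E * kern x y).
Context (balls : set (set T)) (ballsP : forall B, balls B -> measurable B /\
  exists x r, (0 < r)%R /\ B `<=` [set y | (dist x y < r)%R]).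

Implicit Types (f g w u F : T -> \bar R) (D E : set T) (b : R).

(** For the Riesz kernel and its constant, [rpot], [rcap] and [rnorm] unfold to [riesz], [cap] and
    [capnorm]. *)
Definition rpot f x : \bar R := gam%:E * \int[mu]_y (rker x y * f y).

Let rup : R := (gam * upp)%R.

Let rup0 : (0 < rup)%R. Proof. exact: mulr_gt0. Qed.

Let gam_ge0 : 0 <= gam%:E. Proof. by rewrite lee_fin ltW. Qed.

Let rker_ge0 x y : 0 <= rker x y.
Proof. exact: le_trans (kern_ge0 x y) (kern_le_rker x y). Qed.

Let nneg_mfun_rker x f : nneg_mfun f -> nneg_mfun (fun y => rker x y * f y).
Proof.
move=> mf; apply: nneg_mfunM => //; split => //.
exact: (measurableT_comp mrker (pair1_measurable x)).
Qed.

Lemma pot_le_rpot f x : nneg_mfun f -> gam%:E * pot f x <= rpot f x.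
Proof.
move=> mf; apply: lee_wpmul2l => //; apply: le_int.
- by apply: nneg_mfunM => //; exact: nneg_mfun_kern.
- exact: nneg_mfun_rker.
by move=> y; apply: lee_wpmul2r; [exact: mf.2|exact: kern_le_rker].
Qed.

Lemma rpot_le_pot f x : nneg_mfun f -> rpot f x <= rup%:E * pot f x.
Proof.
move=> mf; rewrite /rpot EFinM -muleA; apply: lee_wpmul2l => //.
have mk : nneg_mfun (fun y => kern x y * f y).
  by apply: nneg_mfunM => //; exact: nneg_mfun_kern.
rewrite -int_nnegZ ?lee_fin ?(ltW upp0)//; apply: le_int.
- exact: nneg_mfun_rker.
- by apply: nneg_mfunZ => //; rewrite lee_fin ltW.
by move=> y; rewrite muleA; apply: lee_wpmul2r; [exact: mf.2|exact: rker_le].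
Qed.

Lemma rpotZ f (c : R) x : nneg_mfun f -> (0 <= c)%R ->
  rpot (fun y => c%:E * f y) x = c%:E * rpot f x.
Proof.
move=> mf c0; rewrite /rpot muleCA; congr (_ * _).
rewrite -int_nnegZ ?lee_fin//; last exact: nneg_mfun_rker.
by apply: eq_integral => y _; rewrite muleCA.
Qed.

Lemma nneg_mfun_rpot f : nneg_mfun f -> nneg_mfun (rpot f).
Proof.
move=> mf; apply: nneg_mfunZ => //; split => [|x]; last first.
  by apply: integral_ge0 => y _; exact: (nneg_mfun_rker x mf).2.
have mF : measurable_fun [set: T * T] (fun p => rker p.1 p.2 * f p.2).
  by apply: emeasurable_funM => //; exact: (measurableT_comp mf.1).
have := measurable_fun_fubini_tonelli_F (m2 := mu) _ mF.
by apply => p; exact: mule_ge0 (rker_ge0 _ _) (mf.2 _).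
Qed.

Definition rcap E : \bar R :=
  ereal_inf [set ('N[mu]_(s%:E) [f]) `^ s | f in
    [set f : T -> \bar R |
      [/\ measurable_fun [set: T] f, (forall x, 0 <= f x) &
          (forall x, E x -> 1 <= rpot f x)]]].

Lemma le_rcap E E' : E `<=` E' -> rcap E <= rcap E'.
Proof.
move=> EE'; apply: ereal_inf_le_tmp => _ [F [mF F0 F1] <-]; exists F => //; split => //.
by move=> x /EE'; exact: F1.
Qed.

Lemma rcap_ge0 E : 0 <= rcap E.
Proof. by apply: le_ereal_inf_tmp => _ [F _ <-]; exact: poweR_ge0. Qed.

Let Lnorm_nneg f : nneg_mfun f -> ('N[mu]_(s%:E) [f]) `^ s = \int[mu]_x (f x `^ s).
Proof.
move=> mf; rewrite poweR_Lnorm ?(lt0r_neq0 s0)//; apply: eq_integral => x _.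
by rewrite gee0_abs// mf.2.
Qed.

Lemma rcap_le_capI E : rcap E <= (gam `^ (- s))%:E * capI E.
Proof.
rewrite -lee_pdivrMl ?powR_gt0//; apply: le_ereal_inf_tmp => _ [F [mF F1] <-].
rewrite lee_pdivrMl ?powR_gt0//; apply: ereal_inf_lbound.
have gi0 : (0 <= gam^-1)%R by rewrite invr_ge0 ltW.
have mG : nneg_mfun (fun y => (gam^-1)%:E * F y) by apply: nneg_mfunZ; rewrite ?lee_fin.
exists (fun y => (gam^-1)%:E * F y).
  split; [exact: mG.1|exact: mG.2|] => x Ex; rewrite rpotZ//.
  rewrite -lee_pdivrMl ?invr_gt0// invrK mule1.
  apply: le_trans (pot_le_rpot x mF); rewrite -[leLHS]mule1.
  by apply: lee_wpmul2l => //; exact: F1.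
rewrite Lnorm_nneg// -int_nnegZ ?lee_fin ?powR_ge0//; last exact: nneg_mfun_poweR.
apply: eq_integral => x _; rewrite poweRM ?lee_fin ?mF.2// poweR_EFin.
by rewrite -[X in (_ `^ X)%R](opprK s) powRVN// ltW.
Qed.

Lemma capI_le_rcap E : capI E <= (rup `^ s)%:E * rcap E.
Proof.
have ui0 : (0 < rup^-1)%R by rewrite invr_gt0.
rewrite -lee_pdivrMl ?powR_gt0//; apply: le_ereal_inf_tmp => _ [F [mF F0 F1] <-].
have nF : nneg_mfun F by [].
rewrite lee_pdivrMl ?powR_gt0// Lnorm_nneg// -(powRVN s (ltW rup0)).
apply: capI_le => // x Ex; rewrite -[leLHS]mule1 lee_pdivrMl//.
exact: le_trans (F1 x Ex) (rpot_le_pot x nF).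
Qed.

Lemma capI_rcap_null E : rcap E = 0 -> capI E = 0.
Proof.
move=> E0; apply/eqP; rewrite eq_le capI_ge0 andbT.
by apply: le_trans (capI_le_rcap _) _; rewrite E0 mule0.
Qed.

Lemma rcap0 : rcap set0 = 0.
Proof.
apply/eqP; rewrite eq_le rcap_ge0 andbT.
by apply: le_trans (rcap_le_capI _) _; rewrite capI0 mule0.
Qed.

(** * Capacitary norms and dyadic sums *)

Definition rint D u : \bar R := \int[lebesgue_measure]_(t in `]0%R, +oo[)
  rcap [set x | D x /\ t%:E < `|u x| `^ q].

Definition rnorm D u : \bar R := rint D u `^ q^-1.

Let measurable_rcap_level D u :
  measurable_fun [set: R] (fun t => rcap [set x | D x /\ t%:E < `|u x| `^ q]).
Proof.
apply: antitone_measurable => x y xy; apply: le_rcap => z [Dz yz]; split => //.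
by apply: le_lt_trans yz; rewrite lee_fin.
Qed.

Lemma rint_ge0 D u : 0 <= rint D u.
Proof. by apply: integral_ge0 => t _; exact: rcap_ge0. Qed.

Let lt_poweRV (x y : \bar R) : 0 <= x -> 0 <= y -> (x `^ q < y `^ q) = (x < y).
Proof. by move=> x0 y0; rewrite !ltNge le_poweRV. Qed.

Lemma rint_le D u (c p : R) (M : int -> \bar R) : (0 < c)%R -> (0 < p)%R ->
  (forall k, 0 <= M k) ->
  (forall k, rcap [set x | D x /\ (c * 2 `^ (k%:~R * p))%:E < `|u x| `^ q] <= M k) ->
  rint D u <= (c * (2 `^ p - 1))%:E * zsum (fun k => (2 `^ (k%:~R * p))%:E * M k).
Proof.
move=> c0 p0 M0 HM.
apply: le_trans (int_le_layers c0 p0 (measurable_rcap_level D u) _ M0 _) _.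
- by move=> t; exact: rcap_ge0.
- move=> k t; rewrite /layer/= in_itv/= => /andP[kt _]; apply: le_trans (HM k).
  by apply: le_rcap => x [Dx tx]; split => //; apply: le_lt_trans tx; rewrite lee_fin.
have p1 : (0 <= 2 `^ p - 1 :> R)%R.
  by rewrite subr_ge0 -[leLHS](powRr0 2); apply: ler_powR; rewrite ?ler1n// ltW.
rewrite -zsumZ//; last 2 first.
- by move=> k; rewrite mule_ge0// lee_fin powR_ge0.
- by rewrite mulr_ge0// ltW.
apply: le_zsum => k.
  by rewrite mule_ge0// lee_fin mulr_ge0// mulr_ge0 ?powR_ge0// ltW.
by rewrite muleA -EFinM mulrAC.
Qed.

Lemma rint_level D u (b : R) w : (0 < b)%R ->
  (forall k, capI [set x | D x /\ (b * 2 `^ k%:~R)%:E < `|u x|] <= capI (level w k)) ->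
  rint D u <= (b `^ q * (2 `^ q - 1) * gam `^ (- s))%:E * strong_sum q w.
Proof.
move=> b0 H; have bq0 : (0 < b `^ q)%R by rewrite powR_gt0.
apply: le_trans (rint_le (M := fun k => (gam `^ (- s))%:E * capI (level w k)) bq0 q0 _ _) _.
- by move=> k; rewrite mule_ge0 ?capI_ge0// lee_fin powR_ge0.
- move=> k; apply: (@le_trans _ _ (rcap [set x | D x /\ (b * 2 `^ k%:~R)%:E < `|u x|])).
    apply: le_rcap => x [Dx]; rewrite powRrM -powRM ?powR_ge0 ?(ltW b0)// -(poweR_EFin (b * _)).
    by rewrite lt_poweRV// lee_fin mulr_ge0 ?powR_ge0// ltW.
  apply: le_trans (rcap_le_capI _) _; apply: lee_wpmul2l (H k).
  by rewrite lee_fin powR_ge0.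
under [X in _ * zsum X]eq_fun => k do rewrite muleCA.
rewrite zsumZ ?powR_ge0//; last first.
  by move=> k; rewrite mule_ge0 ?capI_ge0// lee_fin powR_ge0.
by rewrite muleA -EFinM.
Qed.

Definition level_const : R := (rup `^ s * (2 `^ q / (2 `^ q - 1)))%R.

Let q21 : (0 < 2 `^ q - 1 :> R)%R.
Proof.
by rewrite subr_gt0 -[ltLHS](powRr0 2) -[X in (_ < _ `^ X)%R](add0r q) powR2D ltr_pMr ?powR_gt0//;
  have /andP[_] := powR2_itv q0; rewrite powRN invf_lt1 ?powR_gt0.
Qed.

Lemma level_const_ge0 : (0 <= level_const)%R.
Proof. by rewrite mulr_ge0 ?powR_ge0// divr_ge0 ?powR_ge0// ltW. Qed.

Lemma level_le_rint D u :
  zsum (fun k => (2 `^ (k%:~R * q))%:E * capI [set x | D x /\ (2 `^ k%:~R)%:E < `|u x|]) <=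
  level_const%:E * rint D u.
Proof.
pose M k := rcap [set x | D x /\ (2 `^ (k%:~R * q))%:E < `|u x| `^ q].
have M0 k : 0 <= M k by exact: rcap_ge0.
(* Starting the layers at [2^(- q)] puts layer [k] below [2^(k q)], where the distribution function
   is at least its value at [2^(k q)]. *)
have c0 : (0 < 2 `^ (- q) :> R)%R by rewrite powR_gt0.
have := layers_le_int c0 q0 (measurable_rcap_level D u) (fun=> rcap_ge0 _) M0.
move=> /(_ _)/wrap[].
  move=> k t; rewrite /layer/= in_itv/= => /andP[_ kt].
  apply: le_rcap => x [Dx tx]; split => //; apply: lt_trans tx; rewrite lte_fin.
  by move: kt; rewrite -powR2D (_ : - q + (k + 1)%:~R * q = k%:~R * q)%R// intrD; ring.
rewrite -/(rint D u) => h.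
have pc0 : 0 <= level_const%:E by rewrite lee_fin level_const_ge0.
apply: le_trans (lee_wpmul2l pc0 h); rewrite -zsumZ ?level_const_ge0//; last first.
  by move=> k; rewrite mule_ge0// lee_fin mulr_ge0 ?mulr_ge0 ?powR_ge0// ltW.
apply: le_zsum => k; first by rewrite mule_ge0 ?capI_ge0// lee_fin powR_ge0.
have -> : level_const%:E * ((2 `^ (- q) * 2 `^ (k%:~R * q) * (2 `^ q - 1))%:E * M k) =
    (2 `^ (k%:~R * q))%:E * ((rup `^ s)%:E * M k).
  rewrite !muleA -!EFinM; congr (_%:E * _); rewrite /level_const powRN; field.
  by rewrite !gt_eqF ?powR_gt0.
apply: lee_wpmul2l; first by rewrite lee_fin powR_ge0.
apply: le_trans (capI_le_rcap _) _; apply: lee_wpmul2l; first by rewrite lee_fin powR_ge0.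
apply: le_rcap => x [Dx kx]; split => //; rewrite powRrM -(poweR_EFin (2 `^ k%:~R) q).
by rewrite lt_poweRV// lee_fin powR_ge0.
Qed.

Definition rweight D w : Prop :=
  [/\ (forall x, D x -> 0 <= w x), measurable D, measurable_fun D w &
      forall B, balls B -> \int[mu]_(x in D `&` B) w x < +oo].

Lemma nneg_mfun_weight D w : rweight D w -> nneg_mfun (w \_ D).
Proof.
move=> [w0 mD mw _]; split; first exact/(measurable_restrictT _ _).1.
by move=> x; rewrite patchE; case: ifPn => //; rewrite inE; exact: w0.
Qed.

Lemma strong_sum_weight D w : rweight D w -> rnorm D w <= 1 ->
  strong_sum q (w \_ D) <= level_const%:E.
Proof.
move=> [w0 _ _ _]; rewrite -[X in _ <= X -> _](poweR1r q^-1) le_poweRV ?invr_gt0 ?rint_ge0//.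
move=> w1; apply: (@le_trans _ _ (level_const%:E * rint D w)); last first.
  by rewrite -[leRHS]mule1; apply: lee_wpmul2l; rewrite ?lee_fin ?level_const_ge0.
apply: le_trans (level_le_rint D w); apply: le_zsum => k.
  by rewrite mule_ge0 ?capI_ge0// lee_fin powR_ge0.
apply: lee_wpmul2l; first by rewrite lee_fin powR_ge0.
apply: le_capI => x; rewrite /level/= patchE; case: ifPn => [|_].
  by rewrite inE => Dx kx; rewrite gee0_abs ?w0.
by rewrite ltNge lee_fin powR_ge0.
Qed.

(** Sets of zero capacity are null by [capI_null], so extending the weight by [0] outside [D] is
    harmless although [epow 0 (q - s)] is infinite. *)
Lemma energy_weight D w f : rweight D w -> rcap (~` D) = 0 -> nneg_mfun f ->
  energy q f (w \_ D) =
  \int[mu]_(x in D `&` [set x | f x != 0]) (`|f x| `^ s * epow (w x) (q - s)).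
Proof.
move=> ww D0 mf; have mw := nneg_mfun_weight ww; have [w0 mD _ _] := ww.
have mS := measurable_support mf; have mDc : measurable (~` D) by exact: measurableC.
have muD : mu (~` D) = 0.
  exact/negligibleP/capI_null/capI_rcap_null.
have mg : nneg_mfun (fun x => f x `^ s * epow ((w \_ D) x) (q - s)).
  by apply: nneg_mfunM; [exact: nneg_mfun_poweR|exact: nneg_mfun_epow].
rewrite /energy (ge0_negligible_integral mDc mS _ _ muD)//; last 2 first.
- exact: measurable_funTS mg.1.
- by move=> x _; exact: mg.2.
have -> : [set x | f x != 0] `\` ~` D = D `&` [set x | f x != 0].
  by rewrite setDE setCK setIC.
apply: eq_integral => x; rewrite inE => -[Dx _].
by rewrite gee0_abs ?mf.2// patchE mem_set.
Qed.

Lemma energyZ f w (c : R) : nneg_mfun f -> nneg_mfun w -> (0 < c)%R ->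
  energy q (fun x => c%:E * f x) w = (c `^ s)%:E * energy q f w.
Proof.
move=> mf mw c0; rewrite /energy.
have -> : [set x | c%:E * f x != 0] = [set x | f x != 0].
  by apply/seteqP; split => x /=; rewrite mule_eq0 eqe (gt_eqF c0).
rewrite -int_nnegZ_in ?lee_fin ?powR_ge0//; last 2 first.
- exact: measurable_support.
- by apply: nneg_mfunM; [exact: nneg_mfun_poweR|exact: nneg_mfun_epow].
apply: eq_integral => x _; rewrite poweRM ?mf.2 ?lee_fin ?(ltW c0)// poweR_EFin.
by rewrite muleA.
Qed.

Lemma rnorm_lt D u b : (0 < b)%R -> (rnorm D u < b%:E) = (rint D u < (b `^ q)%:E).
Proof.
move=> b0; rewrite /rnorm -poweR_EFin !ltNge; congr (~~ _).
rewrite -[LHS](@le_poweRV _ _ _ q)// ?lee_fin ?(ltW b0) ?poweR_ge0//.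
by rewrite -poweRrM mulVf ?(lt0r_neq0 q0)// poweRe1// rint_ge0.
Qed.

Lemma rnorm_le D u b : (0 <= b)%R -> rint D u <= (b `^ q)%:E -> rnorm D u <= b%:E.
Proof.
move=> b0 h; rewrite -(@le_poweRV _ _ _ q)// ?lee_fin ?poweR_ge0//.
by rewrite /rnorm -poweRrM mulVf ?(lt0r_neq0 q0)// poweRe1 ?rint_ge0// poweR_EFin.
Qed.

(** * The norm against the two functionals *)

Lemma capI_level_majorized D u f w (c b : R) (k : int) : nneg_mfun f ->
  rcap (~` [set x | D x /\ `|u x| <= rpot f x]) = 0 ->
  (forall x, rpot f x <= b%:E * w x) -> (0 < b)%R ->
  capI [set x | D x /\ (b * 2 `^ k%:~R)%:E < `|u x|] <= capI (level w k).
Proof.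
move=> mf u0 fw b0; set Z := [set x | _] in u0.
apply: (@le_trans _ _ (capI (level w k `|` ~` Z))); last first.
  by apply: le_trans (capIU _ _) _; rewrite (capI_rcap_null u0) adde0.
apply: le_capI => x [Dx kx]; have [[_ ux]|] := pselect (Z x); last by right.
left; have := lt_le_trans kx (le_trans ux (fw x)).
by rewrite EFinM lte_pmul2l.
Qed.

(** The bound of [weighted_estimate] is not homogeneous in [f], so it is applied to [f / b], whose
    energy is at most [1]. *)
Lemma rnorm_le_Onorm : exists2 C : R, (0 < C)%R & forall D u f Dw w b,
  nneg_mfun f -> rcap (~` [set x | D x /\ `|u x| <= rpot f x]) = 0 ->
  rcap (~` Dw) = 0 -> rweight Dw w -> rnorm Dw w <= 1 -> (0 < b)%R ->
  (\int[mu]_(x in Dw `&` [set x | f x != 0]) (`|f x| `^ s * epow (w x) (q - s))) `^ s^-1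
    < b%:E ->
  rnorm D u <= (C * b)%:E.
Proof.
have [C C0 HC] := weighted_estimate level_const_ge0.
pose A : R := ((2 `^ q - 1) * gam `^ (- s) * (C * 2))%R.
have A0 : (0 < A)%R by rewrite !mulr_gt0// powR_gt0.
exists (rup * A `^ q^-1)%R; first by rewrite mulr_gt0// powR_gt0.
move=> D u f Dw w b mf fu Dw0 ww w1 b0; rewrite -energy_weight//.
have mw := nneg_mfun_weight ww; set w0 := w \_ Dw.
have E0 : 0 <= energy q f w0.
  by apply: integral_ge0 => x _; rewrite mule_ge0 ?poweR_ge0 ?epow_ge0.
move=> /ltW Eb; have {}Eb : energy q f w0 <= (b `^ s)%:E.
  rewrite -poweR_EFin -(@le_poweRV _ _ _ s^-1) ?invr_gt0 ?poweR_ge0//.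
  by rewrite -[leRHS]poweRrM mulfV ?(lt0r_neq0 s0)// poweRe1// lee_fin ltW.
have bi0 : (0 < b^-1)%R by rewrite invr_gt0.
pose g x := (b^-1)%:E * f x.
have mg : nneg_mfun g by apply: nneg_mfunZ => //; rewrite lee_fin ltW.
have Eg : energy q g w0 <= 1.
  rewrite energyZ//; apply: le_trans (lee_wpmul2l _ Eb) _; first by rewrite lee_fin powR_ge0.
  by rewrite -EFinM -(powRM _ (ltW bi0) (ltW b0)) mulVf ?gt_eqF// powR1.
have Sg : strong_sum q (pot g) <= (C * 2)%:E.
  apply: le_trans (HC _ _ mw mg (strong_sum_weight ww w1)) _.
  rewrite [leRHS]EFinM; apply: lee_wpmul2l; first by rewrite lee_fin ltW.
  by apply: le_trans (leeD (lexx _) Eg) _; rewrite -EFinD lee_fin.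
apply: rnorm_le; first by rewrite mulr_ge0 ?(ltW b0)// mulr_ge0 ?powR_ge0// ltW.
have rb0 : (0 < rup * b)%R by rewrite mulr_gt0.
apply: le_trans (@rint_level D u (rup * b) (pot g) rb0 _) _.
  move=> k; apply: (@capI_level_majorized D u f) => // x.
  apply: le_trans (rpot_le_pot x mf) _; rewrite /g potZ ?(ltW bi0)// muleA -EFinM.
  by rewrite mulfK ?gt_eqF.
apply: le_trans (lee_wpmul2l _ Sg) _.
  by rewrite lee_fin mulr_ge0 ?powR_ge0// mulr_ge0 ?powR_ge0// ltW.
rewrite -EFinM lee_fin.
have p0 : (0 <= A `^ q^-1)%R by exact: powR_ge0.
have -> : (rup * A `^ q^-1 * b = rup * b * A `^ q^-1)%R by ring.
rewrite (powRM _ (ltW rb0) p0) -[X in (_ <= _ * X)%R]powRrM mulVf ?(lt0r_neq0 q0)//.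
by rewrite powRr1 ?(ltW A0)// /A le_eqVlt; apply/orP; left; apply/eqP; ring.
Qed.

Lemma epowZ (c r : R) (x : \bar R) : (0 < c)%R -> 0 <= x ->
  epow (c%:E * x) r = (c `^ r)%:E * epow x r.
Proof.
move=> c0 x0; have c0' : 0 <= c%:E by rewrite lee_fin ltW.
rewrite /epow; case: ifPn => r0; first by rewrite poweRM.
have nr0 : (0 < - r)%R by rewrite oppr_gt0 ltNge.
rewrite poweRM// poweR_EFin; have cr0 : (0 < c `^ (- r))%R by rewrite powR_gt0.
have -> : (c `^ r = (c `^ (- r))^-1)%R by rewrite powRN invrK.
move: x x0 => [x||]// x0.
- rewrite poweR_EFin -EFinM !inver mulf_eq0 (gt_eqF cr0)/=.
  case: ifPn => _; first by rewrite gt0_muley// lte_fin invr_gt0.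
  by rewrite -EFinM invfM.
- by rewrite poweRyr ?gt_eqF// gt0_muley// invey mule0.
Qed.

(** [weighted_estimate] enters qualitatively: the weight makes [strong_sum q (pot f)] finite, which
    gives the tail hypothesis. The constant then comes from [strong_estimate], which does not see
    the weight. *)
Lemma rnorm_le_beta : exists2 C : R, (0 < C)%R & forall D u f Dw w b,
  nneg_mfun f -> rcap (~` [set x | D x /\ `|u x| <= rpot f x]) = 0 ->
  rcap (~` Dw) = 0 -> rweight Dw w -> rnorm Dw w <= 1 -> (0 < b)%R ->
  (\int[mu]_(x in Dw `&` [set x | f x != 0]) (`|f x| `^ s * epow (w x) (q - s))) `^ s^-1
    < +oo ->
  (\int[mu]_(x in [set x | f x != 0]) (f x `^ s * epow (rpot f x) (q - s))) `^ q^-1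
    < b%:E ->
  rnorm D u <= (C * b)%:E.
Proof.
have [C C0 HC] := weighted_estimate level_const_ge0.
have sc0 := strong_const_ge0 q1.
pose A : R := (rup `^ q * (2 `^ q - 1) * gam `^ (- s) * (strong_const q * rup `^ (s - q)))%R.
have A0 : (0 <= A)%R.
  rewrite mulr_ge0//; last by rewrite mulr_ge0 ?powR_ge0.
  by rewrite mulr_ge0 ?powR_ge0// mulr_ge0 ?powR_ge0// ltW.
exists (A `^ q^-1 + 1)%R; first by rewrite ltr_wpDl ?powR_ge0.
move=> D u f Dw w b mf fu Dw0 ww w1 b0; rewrite -energy_weight//.
have mw := nneg_mfun_weight ww; set w0 := w \_ Dw.
have E0 : 0 <= energy q f w0.
  by apply: integral_ge0 => x _; rewrite mule_ge0 ?poweR_ge0 ?epow_ge0.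
move=> Eoo; have {}Eoo : energy q f w0 < +oo.
  rewrite ltey; apply/eqP => h; move: Eoo.
  by rewrite h poweRyr ?ltxx// invr_eq0 (lt0r_neq0 s0).
have Soo : strong_sum q (pot f) < +oo.
  apply: le_lt_trans (HC _ _ mw mf (strong_sum_weight ww w1)) _.
  have fE : energy q f w0 \is a fin_num by rewrite ge0_fin_numE.
  by rewrite -(fineK fE) -EFinD -EFinM ltry.
have str := strong_estimate q1 (ltW qs) mf (fun e e0 => tail_strong_sum q0 Soo e0).
set J := \int[mu]_(x in _) _ => /ltW Jb.
have J0 : 0 <= J by apply: integral_ge0 => x _; rewrite mule_ge0 ?poweR_ge0 ?epow_ge0.
have {}Jb : J <= (b `^ q)%:E.
  rewrite -poweR_EFin -(@le_poweRV _ _ _ q^-1) ?invr_gt0 ?poweR_ge0//.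
  by rewrite -[leRHS]poweRrM mulfV ?(lt0r_neq0 q0)// poweRe1// lee_fin ltW.
have mS := measurable_support mf; have mp := nneg_mfun_pot mf.
have mfs : nneg_mfun (fun x => f x `^ s) by exact: nneg_mfun_poweR.
have EJ : energy q f (pot f) <= (rup `^ (s - q))%:E * J.
  have mrp := nneg_mfun_rpot mf.
  rewrite /J -int_nnegZ_in ?lee_fin ?powR_ge0//; last first.
    by apply: nneg_mfunM => //; exact: nneg_mfun_epow.
  apply: le_int_in => //.
  - by apply: nneg_mfunM => //; exact: nneg_mfun_epow.
  - apply: nneg_mfunZ; first by rewrite lee_fin powR_ge0.
    by apply: nneg_mfunM => //; exact: nneg_mfun_epow.
  move=> x _; rewrite muleCA; apply: lee_wpmul2l; first exact: mfs.2.
  have := epow_le0 _ (mrp.2 x) (rpot_le_pot x mf) => /(_ (q - s)%R).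
  rewrite subr_le0 (ltW qs) => /(_ isT); rewrite epowZ ?mp.2// => h.
  rewrite -(opprB q s) powRN -lee_pdivrMl ?invr_gt0 ?powR_gt0// invrK.
  exact: h.
have rA : rint D u <= (A * b `^ q)%:E.
  apply: le_trans (@rint_level D u rup (pot f) rup0 _) _.
    by move=> k; apply: (@capI_level_majorized D u f) => // x; exact: rpot_le_pot.
  apply: (@le_trans _ _ ((rup `^ q * (2 `^ q - 1) * gam `^ (- s))%:E *
      ((strong_const q)%:E * ((rup `^ (s - q))%:E * (b `^ q)%:E)))).
    apply: lee_wpmul2l.
      by rewrite lee_fin mulr_ge0 ?powR_ge0// mulr_ge0 ?powR_ge0// ltW.
    apply: le_trans str _; apply: lee_wpmul2l; first by rewrite lee_fin.
    apply: le_trans EJ _; apply: lee_wpmul2l => //; by rewrite lee_fin powR_ge0.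
  by rewrite -!EFinM lee_fin /A le_eqVlt; apply/orP; left; apply/eqP; ring.
apply: (@le_trans _ _ (A `^ q^-1 * b)%:E).
  apply: rnorm_le; first by rewrite mulr_ge0 ?powR_ge0 ?ltW.
  rewrite (powRM _ (powR_ge0 _ _) (ltW b0)) -[X in (X * _)%:E]powRrM mulVf ?(lt0r_neq0 q0)//.
  by rewrite powRr1.
by rewrite lee_fin ler_wpM2r ?(ltW b0)// lerDl.
Qed.

Lemma rnorm_majorized : exists2 C : R, (0 < C)%R & forall D u b,
  (0 < b)%R -> rnorm D u < b%:E -> exists f w,
  [/\ nneg_mfun f, (forall x, D x -> `|u x| <= rpot f x),
      rweight [set: T] w /\ rnorm [set: T] w <= 1,
      (\int[mu]_(x in [set: T] `&` [set x | f x != 0])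
        (`|f x| `^ s * epow (w x) (q - s))) `^ s^-1 <= (C * b)%:E &
      (\int[mu]_(x in [set x | f x != 0]) (f x `^ s * epow (rpot f x) (q - s))) `^ q^-1
        <= (C * b)%:E].
Proof.
have k0 := kv_gt0 (s / q); have sq0 : (0 < s / q)%R by rewrite divr_gt0.
have lc0 := level_const_ge0.
(* Normalised so that the potential of [a * comp +oo F] dominates [(pot F)^(s / q)]. *)
pose a : R := (gam * kv (s / q))^-1%R.
have a0 : (0 < a)%R by rewrite invr_gt0 mulr_gt0.
pose A3 : R := (2 `^ (2 * q) * (level_const + 1))%R.
have A30 : (0 < A3)%R by rewrite mulr_gt0 ?powR_gt0// ltr_wpDl.
have s21 : (0 <= 2 `^ s - 1 :> R)%R.
  by rewrite subr_ge0 -[leLHS](powRr0 2); apply: ler_powR; rewrite ?ler1n// ltW.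
pose A4 : R := ((2 `^ s - 1) * gam `^ (- s) * strong_const s + 1)%R.
have sc0 := strong_const_ge0 (ltW s1).
have A40' : (0 <= (2 `^ s - 1) * gam `^ (- s) * strong_const s)%R.
  by apply: mulr_ge0 => //; apply: mulr_ge0 => //; exact: powR_ge0.
have A40 : (0 < A4)%R by rewrite ltr_wpDl.
(* By the strong type inequality [A5 * b] bounds the capacitary norm of [(pot F)^(s / q)]; dividing
   by it gives an admissible weight. *)
pose A5 : R := ((A4 * A3) `^ q^-1)%R.
have A50 : (0 < A5)%R by apply: powR_gt0; exact: mulr_gt0.
pose C1 : R := ((a `^ s * (A5 `^ (s - q) * A3)) `^ s^-1)%R.
pose C2 : R := ((a `^ s * (gam * a) `^ (q - s) * (kv (s / q) `^ (q - s) * A3)) `^ q^-1)%R.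
exists (C1 + C2 + 1)%R; first by rewrite ltr_wpDl// addr_ge0 ?powR_ge0.
move=> D u b b0; rewrite rnorm_lt// => ub; have bq0 : (0 < b `^ q)%R by rewrite powR_gt0.
pose E (k : int) := [set x | D x /\ (2 `^ k%:~R)%:E < `|u x|].
have SE : zsum (fun k => (2 `^ (k%:~R * q))%:E * capI (E k)) <= (level_const * b `^ q)%:E.
  apply: le_trans (level_le_rint D u) _; rewrite [leRHS]EFinM; apply: lee_wpmul2l; last exact: ltW.
  by rewrite lee_fin.
have [F [mF FE F3]] := majorant bq0 (le_lt_trans SE (ltry _)).
have {}F3 : \int[mu]_x (F x `^ s) <= (A3 * b `^ q)%:E.
  apply: le_trans F3 _; rewrite /A3 -mulrA [leRHS]EFinM; apply: lee_wpmul2l.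
    by rewrite lee_fin powR_ge0.
  by apply: le_trans (leeD SE (lexx _)) _; rewrite -EFinD lee_fin mulrDl mul1r.
have Foo := le_lt_trans F3 (ltry _).
have mv := nneg_mfun_pot mF; have mh := nneg_mfun_comp (leey 0) mF.
pose h := comp +oo F; pose B : R := (A5 * b)%R.
have B0 : (0 < B)%R by rewrite mulr_gt0.
have Bi0 : (0 < B^-1)%R by rewrite invr_gt0.
pose f x := a%:E * h x; pose w x := (B^-1)%:E * pot F x `^ (s / q).
have mf : nneg_mfun f by apply: nneg_mfunZ => //; rewrite lee_fin ltW.
have mw : nneg_mfun w.
  by apply: nneg_mfunZ; [rewrite lee_fin ltW|exact: nneg_mfun_poweR].
exists f, w; split => //.
- move=> x Dx; apply: (@le_trans _ _ (pot F x `^ (s / q))); last first.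
    rewrite /f rpotZ ?(ltW a0)//; apply: le_trans (_ : _ <= a%:E * (gam%:E * pot h x)) _.
      have ak : (a * (gam * kv (s / q)) = 1)%R by rewrite mulVf// gt_eqF// mulr_gt0.
      rewrite -[leLHS]mul1e -ak EFinM -muleA; apply: lee_wpmul2l.
        by rewrite lee_fin ltW.
      by rewrite EFinM -muleA; apply: lee_wpmul2l => //; exact: pot_comp_oo.
    by apply: lee_wpmul2l; [rewrite lee_fin ltW|exact: pot_le_rpot].
  (* Such a point lies in [E (k - 1)], and the shift by [2] in [majorant] raises the exponent to
     [k + 1]. *)
  have lowk (k : int) : (2 `^ k%:~R)%:E <= `|u x| -> (2 `^ (k + 1)%:~R)%:E <= pot F x `^ (s / q).
    move=> ku; have Ek : E (k - 1)%R x.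
      split => //; apply: lt_le_trans ku; rewrite lte_fin.
      have -> : (k%:~R = (k - 1)%:~R + 1 :> R)%R by rewrite intrB subrK.
      by rewrite powR2D powRr1// ltr_pMr ?powR_gt0// ltr1n.
    have p0 : 0 <= (2 `^ ((k - 1 + 2)%:~R * (q / s)))%:E :> \bar R.
      by rewrite lee_fin powR_ge0.
    apply: le_trans (le_poweR (ltW sq0) p0 (FE _ _ Ek)); rewrite poweR_EFin lee_fin -powRrM; apply: ler_powR; first by rewrite ler1n.
    have -> : ((k - 1 + 2)%:~R * (q / s) * (s / q) = (k - 1 + 2)%:~R :> R)%R.
      by field; rewrite !gt_eqF.
    by rewrite ler_int -addrA.
  have [uoo|] := eqVneq `|u x| +oo.
    suff -> : pot F x `^ (s / q) = +oo by rewrite leey.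
    apply/eqyP => t t0; have [k /andP[_ kt]] := dyadic_bracket t0.
    by apply: le_trans (lowk k _); rewrite ?uoo ?leey// lee_fin ltW.
  rewrite -ltey => uoo; have ufin : `|u x| \is a fin_num by rewrite ge0_fin_numE.
  have [->|u0] := eqVneq `|u x| 0; first exact: poweR_ge0.
  have u_gt0 : (0 < fine `|u x|)%R.
    by rewrite -lte_fin fineK// lt_neqAle eq_sym u0 abse_ge0.
  have [k /andP[k1 k2]] := dyadic_bracket u_gt0.
  apply: le_trans (lowk k _); rewrite -(fineK ufin) lee_fin//; exact: ltW.
- split.
    split=> //; [by move=> x _; exact: mw.2|exact: mw.1|].
    move=> ball /ballsP[mball [x0 [r [r0 ballr]]]]; rewrite setTI.
    have mdr : measurable [set y | (dist x0 y < r)%R] by exact: measurable_ball_dist.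
    have e0 : (0 < A3 * b `^ q)%R by rewrite mulr_gt0.
    have loc := int_pot_local x0 r0 e0 mF F3.
    have mvs : nneg_mfun (fun x => pot F x `^ s) by exact: nneg_mfun_poweR.
    have mone : nneg_mfun (fun x => 1 + pot F x `^ s).
      by apply: nneg_mfunD => //; split => // x; exact: lee01.
    (* Since [s / q <= s], the weight is controlled by [1 + (pot F)^s], which [int_pot_local]
       integrates over balls. *)
    have wle x : w x <= (B^-1)%:E * (1 + pot F x `^ s).
      apply: lee_wpmul2l; first by rewrite lee_fin ltW.
      have [v1|v1] := leP (pot F x) 1.
        rewrite -[leLHS]adde0; apply: leeD; last exact: poweR_ge0.
        by rewrite -[leRHS](poweR1r (s / q)); apply: le_poweR v1; rewrite ?(ltW sq0) ?mv.2.
      rewrite -[leLHS]add0e; apply: leeD => //.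
      have sqs : (s / q <= s)%R by rewrite ler_pdivrMr// ler_pMr.
      case: (pot F x) v1 => [v||]//.
        by rewrite lte_fin !poweR_EFin lee_fin => /ltW v1; exact: ler_powR.
      by rewrite !poweRyr ?gt_eqF.
    apply: le_lt_trans (le_int_set mw mball mdr ballr) _.
    apply: le_lt_trans (le_int_in mdr mw _ (fun x _ => wle x)) _.
      by apply: nneg_mfunZ => //; rewrite lee_fin ltW.
    rewrite int_nnegZ_in ?lee_fin ?(ltW Bi0)// ge0_integralD//; last 2 first.
    - by move=> x _; exact: mvs.2.
    - exact: measurable_funTS mvs.1.
    rewrite integral_cst// mul1e.
    have m1 := mu_ball x0 r0.
    apply: le_lt_trans (lee_wpmul2l _ (leeD m1 loc)) _; first by rewrite lee_fin ltW.
    by rewrite -EFinD -EFinM ltry.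
  apply: (rnorm_le ler01); rewrite powR1.
  have Bq0 : (0 < B `^ (- q))%R by rewrite powR_gt0.
  (* As [w^q = B^(- q) (pot F)^s], layers of ratio [2^s] based at [B^(- q)] match the dyadic levels
     of [pot F]. *)
  apply: le_trans (rint_le (M := fun k => (gam `^ (- s))%:E * capI (level (pot F) k)) Bq0 s0 _ _) _.
  + by move=> k; rewrite mule_ge0 ?capI_ge0// lee_fin powR_ge0.
  + move=> k; apply: le_trans (rcap_le_capI _) _; apply: lee_wpmul2l.
      by rewrite lee_fin powR_ge0.
    apply: le_capI => x [_]; rewrite /w gee0_abs ?mw.2//.
    rewrite poweRM ?lee_fin ?(ltW Bi0) ?poweR_ge0// -poweRrM divfK ?(lt0r_neq0 q0)//.
    rewrite poweR_EFin -(powRVN q (ltW Bi0)) invrK EFinM lte_pmul2l ?lte_fin//.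
    rewrite powRrM -(poweR_EFin (2 `^ k%:~R) s) ltNge le_poweRV ?mv.2//.
    by rewrite -ltNge.
  have t0 k : 0 <= (2 `^ (k%:~R * s))%:E * capI (level (pot F) k).
    by rewrite mule_ge0 ?capI_ge0// lee_fin powR_ge0.
  rewrite (_ : (fun k => _ * (_ * capI _)) = (fun k => (gam `^ (- s))%:E *
    ((2 `^ (k%:~R * s))%:E * capI (level (pot F) k)))); last first.
    by apply/funext => k; rewrite muleCA.
  rewrite zsumZ ?powR_ge0// muleA -EFinM.
  have c0 : 0 <= (B `^ (- q) * (2 `^ s - 1) * gam `^ (- s))%:E :> \bar R.
    by rewrite lee_fin mulr_ge0 ?powR_ge0// mulr_ge0// powR_ge0.
  apply: le_trans (lee_wpmul2l c0 (capacitary_strong mF Foo)) _.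
  apply: le_trans (lee_wpmul2l c0 (lee_wpmul2l _ F3)) _; first by rewrite lee_fin.
  rewrite -!EFinM lee_fin powRN /B (powRM _ (ltW A50) (ltW b0)) /A5.
  rewrite -powRrM mulVf ?(lt0r_neq0 q0)// (powRr1 (ltW (mulr_gt0 A40 A30))).
  have -> : ((A4 * A3 * b `^ q)^-1 * (2 `^ s - 1) * gam `^ (- s) *
      (strong_const s * (A3 * b `^ q)) =
      (2 `^ s - 1) * gam `^ (- s) * strong_const s / A4)%R.
    by field; rewrite !gt_eqF.
  by rewrite ler_pdivrMr// mul1r /A4 lerDl.
- rewrite setTI -[X in _ <= X](poweRK (r := s)) ?lee_fin ?(lt0r_neq0 s0)//; last first.
    by rewrite mulr_ge0 ?(ltW b0)// addr_ge0// addr_ge0 ?powR_ge0.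
  apply: le_poweR; first by rewrite invr_ge0 ltW.
    by apply: integral_ge0 => x _; rewrite mule_ge0 ?poweR_ge0 ?epow_ge0.
  rewrite (_ : \int[mu]_(x in _) _ = energy q f w); last first.
    by apply: eq_integral => x _; rewrite gee0_abs// mf.2.
  rewrite /f energyZ//; apply: le_trans (lee_wpmul2l _ (energy_comp_weight mF B0)) _.
    by rewrite lee_fin powR_ge0.
  have c0 : 0 <= (B `^ (s - q))%:E :> \bar R by rewrite lee_fin powR_ge0.
  apply: le_trans (lee_wpmul2l _ (lee_wpmul2l c0 F3)) _; first by rewrite lee_fin powR_ge0.
  rewrite -!EFinM poweR_EFin lee_fin.
  apply: (@le_trans _ _ ((C1 * b) `^ s)%R); last first.
    rewrite ge0_ler_powR ?nnegrE ?(ltW s0)//.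
    - by rewrite mulr_ge0 ?powR_ge0// ltW.
    - by rewrite mulr_ge0 ?(ltW b0)// addr_ge0// addr_ge0 ?powR_ge0.
    by rewrite ler_wpM2r ?(ltW b0)// -addrA lerDl addr_ge0 ?powR_ge0.
  have X0 : (0 <= a `^ s * (A5 `^ (s - q) * A3))%R.
    by rewrite mulr_ge0 ?powR_ge0// mulr_ge0 ?powR_ge0// ltW.
  have C1s : (C1 `^ s = a `^ s * (A5 `^ (s - q) * A3))%R.
    by rewrite /C1 -powRrM mulVf ?(lt0r_neq0 s0)// (powRr1 X0).
  have C10 : (0 <= C1)%R by exact: powR_ge0.
  rewrite (powRM _ C10 (ltW b0)) C1s /B (powRM _ (ltW A50) (ltW b0)).
  have -> : (b `^ s = b `^ (s - q) * b `^ q)%R.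
    by rewrite -powRD ?subrK// (gt_eqF b0) implybT.
  by rewrite le_eqVlt; apply/orP; left; apply/eqP; ring.
- rewrite -[X in _ <= X](poweRK (r := q)) ?lee_fin ?(lt0r_neq0 q0)//; last first.
    by rewrite mulr_ge0 ?(ltW b0)// addr_ge0// addr_ge0 ?powR_ge0.
  apply: le_poweR; first by rewrite invr_ge0 ltW.
    by apply: integral_ge0 => x _; rewrite mule_ge0 ?poweR_ge0 ?epow_ge0.
  have ga0 : (0 < gam * a)%R by rewrite mulr_gt0.
  have mh' : nneg_mfun (pot h) by exact: nneg_mfun_pot.
  have mr := nneg_mfun_rpot mf.
  apply: (@le_trans _ _ (((gam * a) `^ (q - s))%:E * energy q f (pot h))).
    rewrite /energy -int_nnegZ_in ?lee_fin ?powR_ge0//; last 2 first.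
    - exact: measurable_support.
    - by apply: nneg_mfunM; [exact: nneg_mfun_poweR|exact: nneg_mfun_epow].
    apply: le_int_in.
    - exact: measurable_support.
    - by apply: nneg_mfunM; [exact: nneg_mfun_poweR|exact: nneg_mfun_epow].
    - apply: nneg_mfunZ; first by rewrite lee_fin powR_ge0.
      by apply: nneg_mfunM; [exact: nneg_mfun_poweR|exact: nneg_mfun_epow].
    move=> x _; rewrite muleCA; apply: lee_wpmul2l; first exact: poweR_ge0.
    rewrite -epowZ ?mh'.2//; apply: epow_le0.
    - by rewrite subr_le0 ltW.
    - by rewrite mule_ge0 ?mh'.2// lee_fin ltW.
    rewrite EFinM -muleA /f rpotZ ?(ltW a0)// muleCA.
    by apply: lee_wpmul2l; [rewrite lee_fin ltW|exact: pot_le_rpot].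
  rewrite /f energyZ//.
  have c0 : 0 <= (a `^ s)%:E :> \bar R by rewrite lee_fin powR_ge0.
  have c1 : 0 <= ((gam * a) `^ (q - s))%:E :> \bar R by rewrite lee_fin powR_ge0.
  have c2 : 0 <= (kv (s / q) `^ (q - s))%:E :> \bar R by rewrite lee_fin powR_ge0.
  apply: le_trans (lee_wpmul2l c1 (lee_wpmul2l c0 (energy_comp mF (ltry 0)))) _.
  apply: le_trans (lee_wpmul2l c1 (lee_wpmul2l c0 (lee_wpmul2l c2 F3))) _.
  rewrite -!EFinM poweR_EFin lee_fin.
  apply: (@le_trans _ _ ((C2 * b) `^ q)%R); last first.
    rewrite ge0_ler_powR ?nnegrE ?(ltW q0)//.
    - by rewrite mulr_ge0 ?powR_ge0// ltW.
    - by rewrite mulr_ge0 ?(ltW b0)// addr_ge0// addr_ge0 ?powR_ge0.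
    by rewrite ler_wpM2r ?(ltW b0)// addrAC lerDr addr_ge0 ?powR_ge0.
  have X0 : (0 <= a `^ s * (gam * a) `^ (q - s) * (kv (s / q) `^ (q - s) * A3))%R.
    apply: mulr_ge0; first by apply: mulr_ge0; exact: powR_ge0.
    by apply: mulr_ge0; [exact: powR_ge0|exact: ltW].
  have C2q : (C2 `^ q = a `^ s * (gam * a) `^ (q - s) * (kv (s / q) `^ (q - s) * A3))%R.
    by rewrite /C2 -powRrM mulVf ?(lt0r_neq0 q0)// (powRr1 X0).
  have C20 : (0 <= C2)%R by exact: powR_ge0.
  rewrite (powRM _ C20 (ltW b0)) C2q.
  by rewrite le_eqVlt; apply/orP; left; apply/eqP; ring.
Qed.

End comparable_kernel.

End composition.

End capacity.

End potentials.

(** Working with strict upper bounds [b > 0] treats [A = 0] like any other finite value and lets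
    near-minimisers stand for an infimum. *)
Lemma lee_scale {R : realType} (A B : \bar R) (C : R) : 0 < C -> (0 <= A)%E ->
  (forall b, 0 < b -> (A < b%:E)%E -> (B <= (C * b)%:E)%E) -> (B <= C%:E * A)%E.
Proof.
move=> C0; case: A => [a||]// A0 H; last by rewrite gt0_muley ?leey.
apply/lee_addgt0Pr => e e0; rewrite -EFinM -EFinD.
have eC : 0 < e / C by rewrite divr_gt0.
have b0 : 0 < a + e / C by rewrite ltr_wpDl.
apply: le_trans (H _ b0 _) _; first by rewrite lte_fin ltrDl.
by rewrite lee_fin mulrDr lerD2l mulrC divfK ?gt_eqF.
Qed.

(** * Riesz potentials on R^n *)

Section riesz_kernel.
Context {R : realType} {n : nat} (alpha : R) (n0 : (0 < n)%N) (alphaN : alpha < n%:R).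

Lemma measurable_eucl_dist :
  measurable_fun [set: Rn R n * Rn R n] (fun p => eucl_dist p.1 p.2).
Proof.
apply: (@measurableT_comp _ _ _ _ _ _ (@Num.sqrt R)).
  by apply: continuous_measurable_fun; exact: sqrt_continuous.
apply: measurable_sum => i; apply: measurable_funX; apply: measurable_funB.
  exact: (measurableT_comp (@measurable_Rn_tnth R n i)).
exact: (measurableT_comp (@measurable_Rn_tnth R n i)).
Qed.

Definition riesz_kernel (x y : Rn R n) : \bar R := epow (eucl_dist x y)%:E (alpha - n%:R).

Lemma measurable_riesz_kernel :
  measurable_fun [set: Rn R n * Rn R n] (fun p => riesz_kernel p.1 p.2).
Proof.
apply: (measurableT_comp (measurable_epow _)); apply/measurable_EFinP.
exact: measurable_eucl_dist.
Qed.

Lemma kern_le_riesz_kernel x y : (kern (@dist1 R n) n%:R alpha x y <= riesz_kernel x y)%E.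
Proof.
apply: epow_le0; rewrite ?subr_le0 ?(ltW alphaN)// lee_fin ?eucl_dist_le//.
exact: sqrtr_ge0.
Qed.

Lemma riesz_kernel_le x y :
  (riesz_kernel x y <= (n%:R `^ (n%:R - alpha))%:E * kern (@dist1 R n) n%:R alpha x y)%E.
Proof.
have N0 : 0 < n%:R :> R by rewrite ltr0n.
have an : alpha - n%:R < 0 by rewrite subr_lt0.
have na : 0 < n%:R - alpha by rewrite subr_gt0.
rewrite /riesz_kernel /kern.
have := eucl_dist_le x y; have := dist1_le x y.
have e0 : 0 <= eucl_dist x y by exact: sqrtr_ge0.
move: (eucl_dist x y) (dist1 x y) e0 => e d; rewrite le_eqVlt => /predU1P[<-|e0] d1 d2.
  have -> : d = 0 by apply/eqP; rewrite eq_le d2 andbT (le_trans d1)// mulr0.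
  have -> : (epow 0 (alpha - n%:R) = +oo :> \bar R)%E.
    have an0 : - (alpha - n%:R) != 0 by rewrite oppr_eq0 lt_eqF.
    by rewrite /epow leNgt an (poweR0r an0) inve0.
  by rewrite gt0_muley ?leey// lte_fin powR_gt0.
have d0 : 0 < d by exact: lt_le_trans d2.
rewrite !epow_EFin// -EFinM lee_fin -(opprB n%:R alpha) !powRN.
rewrite ler_pdivlMr ?powR_gt0// mulrC ler_pdivrMr ?powR_gt0//.
rewrite -powRM ?(ltW N0) ?(ltW e0)//.
by rewrite ge0_ler_powR ?nnegrE ?mulr_ge0 ?(ltW d0) ?(ltW N0) ?(ltW e0) ?(ltW na).
Qed.

Lemma riesz_const_gt0 : 0 < alpha -> 0 < riesz_const n alpha.
Proof.
move=> alpha0; rewrite divr_gt0 ?Gamma_gt0 ?divr_gt0 ?subr_gt0//.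
by rewrite !mulr_gt0 ?powR_gt0 ?pi_gt0// Gamma_gt0// divr_gt0.
Qed.

Definition eucl_balls : set (set (Rn R n)) :=
  [set B | exists c r, B = [set x | eucl_dist c x <= r]].

Lemma eucl_ballsP B : eucl_balls B -> measurable B /\
  exists x r, 0 < r /\ B `<=` [set y | dist1 x y < r].
Proof.
move=> [c [r ->]]; split.
  rewrite -[X in measurable X]setTI.
  have := measurableT_comp measurable_eucl_dist (pair1_measurable c).
  move=> /(_ measurableT _ (measurable_itv `]-oo, r])).
  by congr (measurable _); apply/seteqP; split => y /=; rewrite in_itv.
exists c, (n%:R * `|r| + 1); split; first by rewrite ltr_wpDl// mulr_ge0.
move=> y /= cr; apply: le_lt_trans (dist1_le c y) _.
apply: (@le_lt_trans _ _ (n%:R * `|r|)); last by rewrite ltrDl.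
by rewrite ler_wpM2l// (le_trans cr)// ler_norm.
Qed.

End riesz_kernel.

(** * The three norms for Riesz potentials *)

Section main.
Context {R : realType} {n : nat} (s alpha q : R) (n0 : (0 < n)%N) (s1 : 1 < s)
  (alpha0 : 0 < alpha) (alpha_lt : alpha < n%:R / s) (q1 : 1 <= q) (qs : q < s).
Local Open Scope ereal_scope.

Let s0 : (0 < s)%R. Proof. exact: lt_trans s1. Qed.

Let N0 : (0 < n%:R :> R)%R. Proof. by rewrite ltr0n. Qed.

Let alphas : (alpha * s < n%:R)%R. Proof. by rewrite -ltr_pdivlMr. Qed.

Let alphaN : (alpha < n%:R)%R.
Proof. by apply: lt_trans alphas; rewrite ltr_pMr. Qed.

Let gam0 := riesz_const_gt0 alphaN alpha0.

Let upp0 : (0 < n%:R `^ (n%:R - alpha) :> R)%R. Proof. by rewrite powR_gt0. Qed.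

Let d0 (x : Rn R n) : dist1 x x = 0%R.
Proof. by rewrite /dist1 big1// => i _; rewrite subrr normr0. Qed.

Let V0 : (0 < 2 ^+ n :> R)%R. Proof. by rewrite exprn_gt0. Qed.

Implicit Types u w : qe_fun n alpha s.

Notation rk := (@riesz_kernel R n alpha).
Notation gam := (riesz_const n alpha).
Notation mu := (lebesgue R n).

Let capE (E : set (Rn R n)) : cap alpha s E = rcap mu s rk gam E.
Proof. by []. Qed.

Let capnormE u : capnorm q u = rnorm mu s q rk gam (qe_dom u) u.
Proof. by []. Qed.

Let is_weightE w : is_weight w <-> rweight mu (@eucl_balls R n) (qe_dom w) w.
Proof.
split=> -[w0 mD mw wfin]; split => //; first by move=> B [c [r ->]]; exact: wfin.
by move=> c r; apply: wfin; exists c, r.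
Qed.

Let le_Onorm := @rnorm_le_Onorm _ _ _ _ _ _ _ _ d0 (@dist1C R n) (@dist1_triangle R n)
  (@measurable_dist1 R n) V0 (@le_lebesgue_ball R n) alpha0 alphaN _ _ _ N0
  (@measurable_cell R n) (@lebesgue_cell R n) (fun j x y => @cell_dist1 R n j x y n0)
  (@cell_nested R n) s s1 alphas q q1 qs rk gam _ gam0 upp0 (measurable_riesz_kernel alpha)
  (kern_le_riesz_kernel alphaN) (riesz_kernel_le n0 alphaN) (@eucl_balls R n).

Let le_beta := @rnorm_le_beta _ _ _ _ _ _ _ _ d0 (@dist1C R n) (@dist1_triangle R n)
  (@measurable_dist1 R n) V0 (@le_lebesgue_ball R n) alpha0 alphaN _ _ _ N0
  (@measurable_cell R n) (@lebesgue_cell R n) (fun j x y => @cell_dist1 R n j x y n0)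
  (@cell_nested R n) s s1 alphas q q1 qs rk gam _ gam0 upp0 (measurable_riesz_kernel alpha)
  (kern_le_riesz_kernel alphaN) (riesz_kernel_le n0 alphaN) (@eucl_balls R n).

Let majorized := @rnorm_majorized _ _ _ _ _ _ _ _ d0 (@dist1C R n) (@dist1_triangle R n)
  (@measurable_dist1 R n) V0 (@le_lebesgue_ball R n) alpha0 alphaN _ _ _ N0
  (@measurable_cell R n) (@lebesgue_cell R n) (fun j x y => @cell_dist1 R n j x y n0)
  (@cell_nested R n) s s1 alphas q q1 qs rk gam _ gam0 upp0 (measurable_riesz_kernel alpha)
  (kern_le_riesz_kernel alphaN) (riesz_kernel_le n0 alphaN) _ (@eucl_ballsP R n).

Let capT0 : cap alpha s (~` [set: Rn R n]) = 0.
Proof.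
rewrite setCT capE; exact: (rcap0 mu (@measurable_dist1 R n) s1 gam0
  (measurable_riesz_kernel alpha) (kern_le_riesz_kernel alphaN)).
Qed.

Lemma capnorm_ge0 u : 0 <= capnorm q u.
Proof. exact: poweR_ge0. Qed.

Lemma lambda_dot_ge0 u : 0 <= lambda_dot q u.
Proof.
apply: le_ereal_inf_tmp => _ [f _ <-]; apply: le_ereal_inf_tmp => _ [w _ <-].
exact: poweR_ge0.
Qed.

Lemma beta_dot_ge0 u : 0 <= beta_dot q u.
Proof. by apply: le_ereal_inf_tmp => _ [f _ <-]; exact: poweR_ge0. Qed.

Lemma capnorm_le_lambda : exists2 C : R, (0 < C)%R &
  forall u, capnorm q u <= C%:E * lambda_dot q u.
Proof.
have [C C0 HC] := le_Onorm; exists C => // u.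
apply: lee_scale => //; first exact: lambda_dot_ge0.
move=> b b0 /ereal_inf_lt[_ [f [f0 [mf _] fu] <-] /ereal_inf_lt[_ [w [ww w1] <-] fb]].
rewrite capnormE; apply: (HC _ _ f (qe_dom w) w) => //.
- exact: qe_domP.
- exact/is_weightE.
Qed.

Lemma capnorm_le_beta : exists2 C : R, (0 < C)%R &
  forall u, capnorm q u <= C%:E * beta_dot q u.
Proof.
have [C C0 HC] := le_beta; exists C => // u.
apply: lee_scale => //; first exact: beta_dot_ge0.
move=> b b0 /ereal_inf_lt[_ [f [f0 [mf /ereal_inf_lt[_ [w [ww w1] <-] foo]] fu] <-] fb].
rewrite capnormE; apply: (HC _ _ f (qe_dom w) w) => //.
- exact: qe_domP.
- exact/is_weightE.
Qed.

Lemma lambda_beta_le_capnorm : exists2 C : R, (0 < C)%R &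
  forall u, lambda_dot q u <= C%:E * capnorm q u /\ beta_dot q u <= C%:E * capnorm q u.
Proof.
have [C C0 HC] := majorized; exists C => // u.
have H b : (0 < b)%R -> capnorm q u < b%:E ->
    lambda_dot q u <= (C * b)%:E /\ beta_dot q u <= (C * b)%:E.
  move=> b0 ub; have [f [w [mf fu [ww w1] fl fb]]] := HC (qe_dom u) u b b0 ub.
  pose W := QeFun (qe_dom := [set: Rn R n]) w capT0.
  have Ol : Onorm alpha s q f <= (C * b)%:E.
    apply: le_trans fl; apply: ereal_inf_lbound; exists W => //; split => //.
    exact/is_weightE.
  have af : admissible q u f.
    split; [exact: mf.2|split; [exact: mf.1|exact: le_lt_trans Ol (ltry _)]|].
    apply/eqP; rewrite eq_le; apply/andP; split; last exact: rcap_ge0.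
    (* The majorisation holds on all of [qe_dom u], so the exceptional set lies in its
       complement. *)
    rewrite -(qe_domP u); apply: le_rcap; apply: subsetC => x Dx; split => //.
    exact: fu.
  split; first by apply: le_trans Ol; apply: ereal_inf_lbound; exists f.
  by apply: le_trans fb; apply: ereal_inf_lbound; exists f.
by split; apply: lee_scale => //; [exact: capnorm_ge0|move=> b b0 /(H b b0)[]|
  exact: capnorm_ge0|move=> b b0 /(H b b0)[]].
Qed.

End main.

Theorem theorem1p7 (R : realType) (n : nat) (s alpha q : R)
    (hn : (1 <= n)%N) (hs : 1 < s) (halpha0 : 0 < alpha)
    (halpha : alpha < n%:R / s) (hq1 : 1 <= q) (hqs : q < s) :
  simeq (@capnorm R n alpha s q) (@lambda_dot R n alpha s q) /\
  simeq (@lambda_dot R n alpha s q) (@beta_dot R n alpha s q).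
Proof.
have [C1 C10 H1] := capnorm_le_lambda hn hs halpha0 halpha hq1 hqs.
have [C2 C20 H2] := capnorm_le_beta hn hs halpha0 halpha hq1 hqs.
have [C3 C30 H3] := lambda_beta_le_capnorm hn hs halpha0 halpha hq1 hqs.
have ci (C : R) (A B : \bar R) : 0 < C -> (A <= C%:E * B)%E -> (C^-1%:E * A <= B)%E.
  by move=> C0 AB; rewrite lee_pdivrMl.
split.
  exists C1^-1, C3; split; rewrite ?invr_gt0// => u; split; last by have [] := H3 u.
  exact: ci.
exists (C3 * C2)^-1, (C3 * C1); split; rewrite ?invr_gt0 ?mulr_gt0// => u; split.
  apply: ci; first by rewrite mulr_gt0.
  have [h _] := H3 u; apply: le_trans h _; rewrite EFinM -muleA.
  by apply: lee_wpmul2l (H2 u); rewrite lee_fin ltW.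
have [_ h] := H3 u; apply: le_trans h _; rewrite EFinM -muleA.
by apply: lee_wpmul2l (H1 u); rewrite lee_fin ltW.
Qed.
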